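(* Assume the Generalized Riemann Hypothesis. Let $q>2$ and let $\chi$ be a primitive Dirichlet character mod $q$. Let $\rho'=\beta'+i\gamma'$ run over the critical points of the Riemann zeta function (points with $\zeta'(\rho')=0$) satisfying $\beta'\geq 1$. Then $$\limsup_{\gamma'\to\infty}\frac{|L(\rho',\chi)|}{\log\log\gamma'}\leq 2e^{C_0}\frac{\phi(q)}{q}.$$
   Context: $\zeta$ is the Riemann zeta function, $L(s,\chi)$ is the Dirichlet $L$-function of $\chi$, $\phi$ is Euler's totient function, and $C_0$ is Euler's constant. The Generalized Riemann Hypothesis (GRH) states that all non-trivial zeros of Dirichlet $L$-functions (including $\zeta$) attached to primitive characters lie on the line $\Re s=1/2$. The limsup is taken over the critical points $\rho'=\beta'+i\gamma'$ of $\zeta$ with $\beta'\ge 1$ as $\gamma'\to+\infty$, with $q$ and $\chi$ fixed. *)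

(* Defs.v *)
From Stdlib Require Import Reals ZArith.
From Coquelicot Require Import Coquelicot.
From mathcomp Require prime.

Open Scope R_scope.

Definition Cexp (z : C) : C :=
  (exp (Re z) * cos (Im z), exp (Re z) * sin (Im z)).

Definition nat_cpow (n : nat) (s : C) : C := Cexp (s * RtoC (ln (INR n)))%C.

(** [F] is the analytic continuation to [D] of the function given for
    [Re s > 1] by the Dirichlet series with bounded coefficients [a n].  When [D]
    is the plane or the plane without a point, the identity theorem makes [F]
    unique on [D]; its values outside [D] are unconstrained. *)
Definition continues_dirichlet_series
    (a : nat -> C) (D : C -> Prop) (F : C -> C) : Prop :=
  (forall s : C, D s -> ex_derive F s) /\
  (forall s : C, 1 < Re s ->
     is_series (fun k : nat => (a (S k) * nat_cpow (S k) (- s))%C) (F s)).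

Definition is_riemann_zeta (zeta : C -> C) : Prop :=
  continues_dirichlet_series
    (fun _ => RtoC 1) (fun s => s <> RtoC 1) zeta.

Definition dirichlet_character (q : nat) (chi : Z -> C) : Prop :=
  (0 < q)%nat /\
  (forall m n : Z, chi (m * n)%Z = (chi m * chi n)%C) /\
  (forall n : Z, chi (n + Z.of_nat q)%Z = chi n) /\
  (forall n : Z, chi n <> RtoC 0 <-> Z.gcd n (Z.of_nat q) = 1%Z).

Definition principal (q : nat) (chi : Z -> C) : Prop :=
  forall n : Z, Z.gcd n (Z.of_nat q) = 1%Z -> chi n = RtoC 1.

(** [chi] mod [q] is induced by the character [psi] mod [d]. *)
Definition induced_by (q : nat) (chi : Z -> C) (d : nat) (psi : Z -> C) : Prop :=
  Nat.divide d q /\ dirichlet_character d psi /\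
  (forall n : Z, Z.gcd n (Z.of_nat q) = 1%Z -> chi n = psi n).

Definition primitive_character (q : nat) (chi : Z -> C) : Prop :=
  dirichlet_character q chi /\
  (forall (d : nat) (psi : Z -> C), (d < q)%nat -> ~ induced_by q chi d psi).

(** The L-function is entire, except for a pole at [1] when [chi] is principal. *)
Definition is_dirichlet_L (q : nat) (chi : Z -> C) (L : C -> C) : Prop :=
  continues_dirichlet_series
    (fun n => chi (Z.of_nat n)) (fun s => s <> RtoC 1 \/ ~ principal q chi) L.

(** Non-trivial zeros are those in the open critical strip.  The modulus [1]
    is included; its only character is constant [1], with L-function zeta. *)
Definition GRH : Prop :=
  forall (q : nat) (chi : Z -> C) (L : C -> C),
    primitive_character q chi -> is_dirichlet_L q chi L ->
    forall s : C, L s = RtoC 0 -> 0 < Re s < 1 -> Re s = 1 / 2.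

Definition euler_constant : R :=
  real (Lim_seq (fun n : nat => sum_n_m (fun k : nat => / INR k) 1 n - ln (INR n))).

(** The limsup of [f s] over the points [s] of [P], as [Im s] tends to plus
    infinity: the infimum over [T] of the supremum of [f] over the points of [P]
    with [T < Im s].  It is [m_infty] when [Im] is bounded above on [P]. *)
Definition limsup_Im (P : C -> Prop) (f : C -> R) : Rbar :=
  Rbar_glb (fun v : Rbar => exists T : R,
    v = Lub_Rbar (fun y : R => exists s : C, P s /\ T < Im s /\ y = f s)).

Definition critical_point (F : C -> C) (s : C) : Prop :=
  is_derive F s (RtoC 0).

(* Main.v *)
(** Littlewood's argument bounds |L(s, chi)| in the whole half-plane Re s >= 1, so
    that of the critical points only their position in this half-plane matters.
    Expand log L(., chi) in a Taylor series at s + a.  Under GRH, and by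
    3 + 4 cos t + cos 2t >= 0 on the line Re s = 1, it is analytic in the disc of
    radius a + 1/2, where Re log L is O(log t); by Borel-Caratheodory the k-th
    coefficient is O(log t) (a + 1/2)^(-k).  Hence the first
    K ~ (1 + eta) loglog t / log (1 + 1/(2a)) terms give log L(s, chi) up to o(1).
    This Taylor polynomial is a sum over prime powers with nonnegative (Poisson)
    weights, so its real part is largest when chi is replaced by the principal
    character and s by 1.  There it equals H_K - log a + log (phi(q)/q) + o(1), H_K
    being the harmonic number, because (s - 1) L(s, chi_0) is analytic and zero-free
    around the disc and has the value phi(q)/q at 1.  Thus |L(s, chi)| is at most
    (1 + o(1)) (K / a) e^gamma phi(q)/q, and K / (a loglog t) tends to 2 as a tends to
    infinity and eta to 0. *)

Require Import Defs.
From Stdlib Require Import Reals ZArith.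
From Coquelicot Require Import Coquelicot.
From mathcomp Require prime.
From Stdlib Require Import Lra Lia Classical FunctionalExtensionality Bool List Permutation.
From Stdlib Require Cantor.
From mathcomp Require ssrbool ssrnat div bigop.

Open Scope R_scope.

(** * Sums and series *)

#[global] Arguments Cmod_triangle (x y)%_C_scope.
#[global] Arguments Cmod_ge_0 x%_C_scope.
#[global] Arguments Cmod_mult (x y)%_C_scope.
#[global] Arguments Cmod_opp x%_C_scope.
#[global] Arguments Cmod_gt_0 x%_C_scope.
#[global] Arguments re_le_Cmod c%_C_scope.

(** The continuation of L is obtained from its own Taylor coefficients: Abel summation is applied to
    each of them and the result summed before the cutoff is removed. One estimate thus yields both
    analyticity up to the line Re s = 1/2 and the bound O(|s|) that makes Re log L = O(log t). The
    logarithm is explicit only where the Euler product converges, in the disc of radius Re s + a - 1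
    about s + a. What has to grow is its radius of convergence, so its coefficients stay fixed and
    are merely re-estimated on larger circles, where they are circle integrals of L'/L. On Re s = 1
    the square of chi may be principal, so its series near 1 + 2iu is compared with a multiple of
    zeta, which is analytic there for u <> 0. The main term cannot be read off at s = 1, where the
    logarithm of the principal series is infinite. Its Taylor polynomials remain finite, and H_K -
    log K brings in Euler's constant. The parameters are tied by a = 1/eta and fixed before t grows.
    The truncation error is then of order (log t)^(-eta). *)

Fixpoint rsum (a : nat -> R) (n : nat) : R :=
  match n with O => 0 | S m => rsum a m + a m end.

Fixpoint csum (a : nat -> C) (n : nat) : C :=
  match n with O => RtoC 0 | S m => (csum a m + a m)%C end.

Lemma rsum_ext (a b : nat -> R) n :
  (forall k, (k < n)%nat -> a k = b k) -> rsum a n = rsum b n.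
Proof.
  induction n as [|n IH]; intros H; simpl; [reflexivity|].
  rewrite IH by (intros; apply H; lia). now rewrite H by lia.
Qed.

Lemma rsum_plus (a b : nat -> R) n :
  rsum (fun k => a k + b k) n = rsum a n + rsum b n.
Proof. induction n as [|n IH]; simpl; [ring|rewrite IH; ring]. Qed.

Lemma rsum_scal (c : R) (a : nat -> R) n :
  rsum (fun k => c * a k) n = c * rsum a n.
Proof. induction n as [|n IH]; simpl; [ring|rewrite IH; ring]. Qed.

Lemma rsum_le (a b : nat -> R) n :
  (forall k, (k < n)%nat -> a k <= b k) -> rsum a n <= rsum b n.
Proof.
  induction n as [|n IH]; intros H; simpl; [lra|].
  apply Rplus_le_compat; [apply IH; intros; apply H; lia | apply H; lia].
Qed.

Lemma rsum_nonneg (a : nat -> R) n : (forall k, 0 <= a k) -> 0 <= rsum a n.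
Proof.
  intros H; induction n as [|n IH]; simpl; [lra|specialize (H n); lra].
Qed.

Lemma rsum_mono (a : nat -> R) n m :
  (forall k, 0 <= a k) -> (n <= m)%nat -> rsum a n <= rsum a m.
Proof.
  intros H; induction 1 as [|m _ IH]; [lra|simpl; specialize (H m); lra].
Qed.

Lemma rsum_swap (a : nat -> nat -> R) n m :
  rsum (fun i => rsum (fun j => a i j) m) n = rsum (fun j => rsum (fun i => a i j) n) m.
Proof.
  induction n as [|n IH]; simpl.
  - induction m as [|m IHm]; simpl; [reflexivity|rewrite <- IHm; ring].
  - rewrite IH, <- rsum_plus. reflexivity.
Qed.

Lemma rsum_sum_n (a : nat -> R) n : rsum a (S n) = sum_n a n.
Proof.
  induction n as [|n IH].
  - simpl. rewrite sum_O. ring.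
  - rewrite sum_Sn, <- IH. reflexivity.
Qed.

Lemma is_series_rsum (a : nat -> R) (l : R) :
  is_series a l <-> is_lim_seq (rsum a) l.
Proof.
  split; intros H.
  - apply is_lim_seq_incr_1.
    apply is_lim_seq_ext with (sum_n a); [intros; now rewrite <- rsum_sum_n|exact H].
  - change (is_lim_seq (sum_n a) l).
    apply is_lim_seq_ext with (fun n => rsum a (S n)); [intros; now rewrite rsum_sum_n|].
    now apply -> is_lim_seq_incr_1.
Qed.

Lemma Series_lim (a : nat -> R) : ex_series a -> is_lim_seq (rsum a) (Series a).
Proof. intros H. apply is_series_rsum, Series_correct, H. Qed.

Lemma nonneg_summable (a : nat -> R) (M : R) :
  (forall n, 0 <= a n) -> (forall n, rsum a n <= M) -> ex_series a /\ Series a <= M.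
Proof.
  intros Ha HM.
  destruct (ex_finite_lim_seq_incr (rsum a) M) as [l Hl].
  - intros n; simpl; specialize (Ha n); lra.
  - exact HM.
  - assert (Hs : is_series a l) by now apply is_series_rsum.
    split; [now exists l|].
    rewrite (is_series_unique _ _ Hs).
    exact (is_lim_seq_le _ _ l M HM Hl (is_lim_seq_const M)).
Qed.

Lemma rsum_le_Series (a : nat -> R) n :
  (forall k, 0 <= a k) -> ex_series a -> rsum a n <= Series a.
Proof.
  intros Ha Hs.
  apply (is_lim_seq_incr_compare (rsum a) (Series a)).
  - now apply Series_lim.
  - intros m; simpl; specialize (Ha m); lra.
Qed.

Lemma Series_nonneg (a : nat -> R) : (forall k, 0 <= a k) -> ex_series a -> 0 <= Series a.
Proof. intros Ha Hs. exact (rsum_le_Series a 0 Ha Hs). Qed.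

Lemma term_le_Series (a : nat -> R) n :
  (forall k, 0 <= a k) -> ex_series a -> a n <= Series a.
Proof.
  intros Ha Hs. apply Rle_trans with (rsum a (S n)); [|now apply rsum_le_Series].
  simpl. pose proof (rsum_nonneg a n Ha). lra.
Qed.

Lemma ex_series_comp (a b : nat -> R) :
  (forall n, 0 <= a n <= b n) -> ex_series b -> ex_series a.
Proof.
  intros H Hb. apply (ex_series_le a b); [|exact Hb].
  intros n. unfold norm; simpl; unfold abs; simpl.
  rewrite Rabs_pos_eq; apply H.
Qed.

(** Finite rectangles can be summed in either order, and the iterated series bounds each of them.
    Only an inequality is claimed, because equality follows by applying it to the transposed array
    as well. *)
Lemma fubini_nonneg (a : nat -> nat -> R) :
  (forall i j, 0 <= a i j) ->
  (forall i, ex_series (a i)) ->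
  ex_series (fun i => Series (a i)) ->
  (forall j, ex_series (fun i => a i j)) /\
  ex_series (fun j => Series (fun i => a i j)) /\
  Series (fun j => Series (fun i => a i j)) <= Series (fun i => Series (a i)).
Proof.
  intros Ha H1 H2.
  assert (Hj : forall j, ex_series (fun i => a i j)).
  { intros j. apply ex_series_comp with (fun i => Series (a i)); [|exact H2].
    intros i; split; [apply Ha|]. now apply (term_le_Series (a i) j). }
  split; [exact Hj|].
  apply nonneg_summable.
  - intros j. apply Series_nonneg; [intros; apply Ha|apply Hj].
  - intros n.
    assert (E : is_lim_seq (fun m => rsum (fun j => rsum (fun i => a i j) m) n)
                  (rsum (fun j => Series (fun i => a i j)) n)).
    { induction n as [|n IH]; simpl; [apply is_lim_seq_const|].
      apply is_lim_seq_plus'; [exact IH|]. apply Series_lim, Hj. }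
    refine (is_lim_seq_le _ _ (Finite _) (Finite _) _ E (is_lim_seq_const _)).
    intros m. rewrite <- rsum_swap.
    apply Rle_trans with (rsum (fun i => Series (a i)) m).
    + apply rsum_le; intros i _. apply rsum_le_Series; [apply Ha|apply H1].
    + apply rsum_le_Series; [|exact H2].
      intros i; apply Series_nonneg; [apply Ha|apply H1].
Qed.

Lemma fubini_nonneg_eq (a : nat -> nat -> R) :
  (forall i j, 0 <= a i j) ->
  (forall i, ex_series (a i)) ->
  ex_series (fun i => Series (a i)) ->
  Series (fun j => Series (fun i => a i j)) = Series (fun i => Series (a i)).
Proof.
  intros Ha H1 H2.
  destruct (fubini_nonneg a Ha H1 H2) as (H3 & H4 & H5).
  destruct (fubini_nonneg (fun j i => a i j) (fun j i => Ha i j) H3 H4) as (_ & _ & H6).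
  apply Rle_antisym; assumption.
Qed.

(** * Absolutely convergent complex series *)

Lemma Re_plus (x y : C) : Re (x + y)%C = Re x + Re y. Proof. reflexivity. Qed.
Lemma Im_plus (x y : C) : Im (x + y)%C = Im x + Im y. Proof. reflexivity. Qed.

Lemma im_le_Cmod (c : C) : Rabs (Im c) <= Cmod c.
Proof. eapply Rle_trans; [apply Rmax_r|apply Rmax_Cmod]. Qed.

Lemma Re_le_Cmod (c : C) : Re c <= Cmod c.
Proof. eapply Rle_trans; [apply Rle_abs|apply re_le_Cmod]. Qed.

Lemma Cmod_le_sum (c : C) : Cmod c <= Rabs (Re c) + Rabs (Im c).
Proof.
  pose proof (Cmod2_alt c) as E. pose proof (Cmod_ge_0 c).
  pose proof (Rabs_pos (Re c)); pose proof (Rabs_pos (Im c)).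
  assert (Cmod c ^ 2 <= (Rabs (Re c) + Rabs (Im c)) ^ 2).
  { rewrite E, <- (pow2_abs (Re c)), <- (pow2_abs (Im c)). nra. }
  nra.
Qed.

Lemma Cmod_sub_le (x y : C) : Cmod (x - y) <= Cmod x + Cmod y.
Proof. unfold Cminus. rewrite <- (Cmod_opp y). apply Cmod_triangle. Qed.

Lemma Cmod_sub_ge (x y : C) : Cmod x - Cmod y <= Cmod (x - y).
Proof.
  pose proof (Cmod_triangle (x - y) y). replace (x - y + y)%C with x in H by ring. lra.
Qed.

Lemma Re_csum (a : nat -> C) n : Re (csum a n) = rsum (fun k => Re (a k)) n.
Proof. induction n as [|n IH]; simpl; [reflexivity|rewrite <- IH; reflexivity]. Qed.

Lemma Im_csum (a : nat -> C) n : Im (csum a n) = rsum (fun k => Im (a k)) n.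
Proof. induction n as [|n IH]; simpl; [reflexivity|rewrite <- IH; reflexivity]. Qed.

Lemma C_ext (x y : C) : Re x = Re y -> Im x = Im y -> x = y.
Proof. destruct x, y; simpl; intros -> ->; reflexivity. Qed.

Lemma csum_ext (a b : nat -> C) n :
  (forall k, (k < n)%nat -> a k = b k) -> csum a n = csum b n.
Proof.
  induction n as [|n IH]; intros H; simpl; [reflexivity|].
  rewrite IH by (intros; apply H; lia). now rewrite H by lia.
Qed.

Lemma csum_plus (a b : nat -> C) n :
  csum (fun k => a k + b k)%C n = (csum a n + csum b n)%C.
Proof. induction n as [|n IH]; simpl; [ring|rewrite IH; ring]. Qed.

Lemma csum_scal (c : C) (a : nat -> C) n :
  csum (fun k => c * a k)%C n = (c * csum a n)%C.
Proof. induction n as [|n IH]; simpl; [ring|rewrite IH; ring]. Qed.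

Lemma Cmod_csum_le (a : nat -> C) n : Cmod (csum a n) <= rsum (fun k => Cmod (a k)) n.
Proof.
  induction n as [|n IH]; simpl; [rewrite Cmod_0; lra|].
  eapply Rle_trans; [apply Cmod_triangle|lra].
Qed.

Definition asum (a : nat -> C) : Prop := ex_series (fun n => Cmod (a n)).

Definition CSer (a : nat -> C) : C :=
  (Series (fun n => Re (a n)), Series (fun n => Im (a n))).

Lemma asum_Re a : asum a -> ex_series (fun n => Re (a n)).
Proof.
  intros H. apply (ex_series_le (fun n => Re (a n)) (fun n => Cmod (a n))); [|exact H].
  intros n. apply re_le_Cmod.
Qed.

Lemma asum_Im a : asum a -> ex_series (fun n => Im (a n)).
Proof.
  intros H. apply (ex_series_le (fun n => Im (a n)) (fun n => Cmod (a n))); [|exact H].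
  intros n. apply im_le_Cmod.
Qed.

Lemma asum_le (a : nat -> C) (b : nat -> R) :
  (forall n, Cmod (a n) <= b n) -> ex_series b -> asum a.
Proof.
  intros H Hb. apply ex_series_comp with b; [|exact Hb].
  intros n; split; [apply Cmod_ge_0|apply H].
Qed.

Definition clim (u : nat -> C) (l : C) : Prop :=
  is_lim_seq (fun n => Re (u n)) (Re l) /\ is_lim_seq (fun n => Im (u n)) (Im l).

Lemma clim_unique u l1 l2 : clim u l1 -> clim u l2 -> l1 = l2.
Proof.
  intros [H1 H2] [H3 H4]. apply C_ext.
  - apply is_lim_seq_unique in H1; apply is_lim_seq_unique in H3. congruence.
  - apply is_lim_seq_unique in H2; apply is_lim_seq_unique in H4. congruence.
Qed.

Lemma clim_ext u v l : (forall n, u n = v n) -> clim u l -> clim v l.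
Proof.
  intros E [H1 H2]; split; [eapply is_lim_seq_ext; [|exact H1]|eapply is_lim_seq_ext; [|exact H2]];
    intros n; simpl; now rewrite E.
Qed.

Lemma clim_const c : clim (fun _ => c) c.
Proof. split; apply is_lim_seq_const. Qed.

Lemma clim_plus u v l m : clim u l -> clim v m -> clim (fun n => u n + v n)%C (l + m)%C.
Proof. intros [H1 H2] [H3 H4]; split; now apply is_lim_seq_plus'. Qed.

Lemma clim_mult u v l m : clim u l -> clim v m -> clim (fun n => u n * v n)%C (l * m)%C.
Proof.
  intros [H1 H2] [H3 H4]; split; simpl.
  - apply is_lim_seq_minus'; now apply is_lim_seq_mult'.
  - apply is_lim_seq_plus'; now apply is_lim_seq_mult'.
Qed.

Lemma clim_Cmod u l : clim u l <-> is_lim_seq (fun n => Cmod (u n - l)) 0.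
Proof.
  split.
  - intros [H1 H2].
    apply is_lim_seq_le_le with (fun _ => 0)
      (fun n => Rabs (Re (u n) - Re l) + Rabs (Im (u n) - Im l)).
    + intros n; split; [apply Cmod_ge_0|]. exact (Cmod_le_sum (u n - l)).
    + apply is_lim_seq_const.
    + replace (Finite 0) with (Finite (Rabs (Re l - Re l) + Rabs (Im l - Im l))).
      * apply is_lim_seq_plus'.
        -- apply (is_lim_seq_abs _ (Finite _)), is_lim_seq_minus'; [exact H1|apply is_lim_seq_const].
        -- apply (is_lim_seq_abs _ (Finite _)), is_lim_seq_minus'; [exact H2|apply is_lim_seq_const].
      * f_equal. rewrite !Rminus_diag, !Rabs_R0. ring.
  - intros H.
    assert (K : forall f : C -> R, (forall x y, f (x - y)%C = f x - f y) ->
       (forall x, Rabs (f x) <= Cmod x) -> is_lim_seq (fun n => f (u n)) (f l)).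
    { intros f Hf Hb.
      apply is_lim_seq_ext with (fun n => f (u n - l)%C + f l).
      - intros n; rewrite Hf; ring.
      - replace (Finite (f l)) with (Finite (0 + f l)) by (f_equal; ring).
        apply is_lim_seq_plus'; [|apply is_lim_seq_const].
        apply is_lim_seq_abs_0.
        apply is_lim_seq_le_le with (fun _ => 0) (fun n => Cmod (u n - l)).
        + intros n; split; [apply Rabs_pos|apply Hb].
        + apply is_lim_seq_const.
        + exact H. }
    split; apply K; try reflexivity; [apply re_le_Cmod|apply im_le_Cmod].
Qed.

Lemma clim_norm u l : clim u l -> is_lim_seq (fun n => Cmod (u n)) (Cmod l).
Proof.
  intros H. apply clim_Cmod in H.
  apply is_lim_seq_ext with (fun n => (Cmod (u n) - Cmod l) + Cmod l); [intros; ring|].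
  replace (Finite (Cmod l)) with (Finite (0 + Cmod l)) by (f_equal; ring).
  apply is_lim_seq_plus'; [|apply is_lim_seq_const].
  apply is_lim_seq_abs_0.
  apply is_lim_seq_le_le with (fun _ => 0) (fun n => Cmod (u n - l)); [|apply is_lim_seq_const|exact H].
  intros n; split; [apply Rabs_pos|].
  apply Rabs_le. pose proof (Cmod_sub_ge (u n) l). pose proof (Cmod_sub_ge l (u n)).
  replace (l - u n)%C with (- (u n - l))%C in H1 by ring. rewrite Cmod_opp in H1. lra.
Qed.

Lemma CSer_lim a : asum a -> clim (csum a) (CSer a).
Proof.
  intros H. split; simpl.
  - apply is_lim_seq_ext with (rsum (fun n => Re (a n))); [intros; now rewrite Re_csum|].
    now apply Series_lim, asum_Re.
  - apply is_lim_seq_ext with (rsum (fun n => Im (a n))); [intros; now rewrite Im_csum|].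
    now apply Series_lim, asum_Im.
Qed.

Lemma CSer_ext a b : (forall n, a n = b n) -> CSer a = CSer b.
Proof. intros H. now replace b with a by (apply functional_extensionality; exact H). Qed.

Lemma asum_ext a b : (forall n, a n = b n) -> asum a -> asum b.
Proof. intros H. now replace b with a by (apply functional_extensionality; exact H). Qed.

Lemma asum_plus a b : asum a -> asum b -> asum (fun n => a n + b n)%C.
Proof.
  intros Ha Hb. apply asum_le with (fun n => Cmod (a n) + Cmod (b n)).
  - intros; apply Cmod_triangle.
  - exact (ex_series_plus _ _ Ha Hb).
Qed.

Lemma asum_scal c a : asum a -> asum (fun n => c * a n)%C.
Proof.
  intros Ha. apply asum_le with (fun n => Cmod c * Cmod (a n)).
  - intros; rewrite Cmod_mult; lra.
  - exact (ex_series_scal_l (Cmod c) _ Ha).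
Qed.

Lemma CSer_plus a b : asum a -> asum b -> CSer (fun n => a n + b n)%C = (CSer a + CSer b)%C.
Proof.
  intros Ha Hb. apply clim_unique with (csum (fun n => a n + b n)%C).
  - now apply CSer_lim, asum_plus.
  - apply clim_ext with (fun n => csum a n + csum b n)%C; [intros; now rewrite csum_plus|].
    apply clim_plus; now apply CSer_lim.
Qed.

Lemma CSer_scal c a : asum a -> CSer (fun n => c * a n)%C = (c * CSer a)%C.
Proof.
  intros Ha. apply clim_unique with (csum (fun n => c * a n)%C).
  - now apply CSer_lim, asum_scal.
  - apply clim_ext with (fun n => c * csum a n)%C; [intros; now rewrite csum_scal|].
    apply clim_mult; [apply clim_const|now apply CSer_lim].
Qed.

Lemma CSer_norm a : asum a -> Cmod (CSer a) <= Series (fun n => Cmod (a n)).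
Proof.
  intros Ha.
  refine (is_lim_seq_le _ _ (Finite _) (Finite _) _ (clim_norm _ _ (CSer_lim a Ha)) (Series_lim _ Ha)).
  intros n; apply Cmod_csum_le.
Qed.

Lemma CSer_bound a (b : nat -> R) :
  (forall n, Cmod (a n) <= b n) -> ex_series b -> Cmod (CSer a) <= Series b.
Proof.
  intros H Hb. eapply Rle_trans; [apply CSer_norm, asum_le with b; assumption|].
  apply Series_le; [|exact Hb]. intros n; split; [apply Cmod_ge_0|apply H].
Qed.

Lemma csum_shift a n : csum a (S n) = (a O + csum (fun k => a (S k)) n)%C.
Proof.
  induction n as [|n IH]; [simpl; ring|].
  change (csum a (S (S n))) with (csum a (S n) + a (S n))%C. rewrite IH. simpl. ring.
Qed.

Lemma asum_shift a : asum a <-> asum (fun k => a (S k)).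
Proof. exact (ex_series_incr_1 (fun n => Cmod (a n))). Qed.

Lemma CSer_shift a : asum a -> CSer a = (a O + CSer (fun k => a (S k)))%C.
Proof.
  intros Ha. apply clim_unique with (fun n => csum a (S n)).
  - destruct (CSer_lim a Ha) as [H1 H2]; split.
    + exact (proj1 (is_lim_seq_incr_1 (fun n => Re (csum a n)) _) H1).
    + exact (proj1 (is_lim_seq_incr_1 (fun n => Im (csum a n)) _) H2).
  - apply clim_ext with (fun n => a O + csum (fun k => a (S k)) n)%C.
    + intros n; symmetry; apply csum_shift.
    + apply clim_plus; [apply clim_const|]. apply CSer_lim. now apply (proj1 (asum_shift a)).
Qed.

Lemma csum_sum_n a n : csum a (S n) = @sum_n (NormedModule.AbelianMonoid C_AbsRing C_NormedModule) a n.
Proof.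
  induction n as [|n IH].
  - rewrite sum_O. simpl. ring.
  - rewrite sum_Sn, <- IH. reflexivity.
Qed.

Lemma clim_filterlim (u : nat -> C) (l : C) :
  filterlim u eventually (@locally C_NormedModule l) -> clim u l.
Proof.
  intros H. apply clim_Cmod.
  apply is_lim_seq_spec. intros eps.
  destruct (H _ (locally_ball_norm (V := C_NormedModule) l eps)) as [N HN].
  exists N. intros n Hn. specialize (HN n Hn).
  change (Cmod (u n - l) < eps) in HN.
  rewrite Rminus_0_r, Rabs_pos_eq by apply Cmod_ge_0. exact HN.
Qed.

Lemma is_series_clim (a : nat -> C) (l : C) :
  @is_series C_AbsRing C_NormedModule a l -> clim (csum a) l.
Proof.
  intros H.
  assert (K : clim (fun n => csum a (S n)) l).
  { apply clim_ext with (sum_n a); [intros; now rewrite csum_sum_n|].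
    now apply clim_filterlim. }
  destruct K as [K1 K2]. split.
  - exact (proj2 (is_lim_seq_incr_1 (fun n => Re (csum a n)) _) K1).
  - exact (proj2 (is_lim_seq_incr_1 (fun n => Im (csum a n)) _) K2).
Qed.

Lemma is_series_CSer (a : nat -> C) (l : C) :
  @is_series C_AbsRing C_NormedModule a l -> asum a -> l = CSer a.
Proof.
  intros H Ha. apply clim_unique with (csum a); [now apply is_series_clim|now apply CSer_lim].
Qed.

Lemma fubini_C (a : nat -> nat -> C) :
  (forall i, asum (a i)) ->
  ex_series (fun i => Series (fun j => Cmod (a i j))) ->
  (forall j, asum (fun i => a i j)) /\
  ex_series (fun j => Series (fun i => Cmod (a i j))) /\
  CSer (fun j => CSer (fun i => a i j)) = CSer (fun i => CSer (a i)).
Proof.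
  intros H1 H2.
  destruct (fubini_nonneg (fun i j => Cmod (a i j)) (fun i j => Cmod_ge_0 _) H1 H2) as (H3 & H4 & _).
  split; [exact H3|]. split; [exact H4|].
  (* Signed terms reduce to nonnegative ones: both [Cmod] and [Cmod + f] can be interchanged, hence
     so can their difference [f], here [Re] or [Im]. *)
  assert (K : forall f : C -> R, (forall x, Rabs (f x) <= Cmod x) ->
    Series (fun j => Series (fun i => f (a i j))) = Series (fun i => Series (fun j => f (a i j)))).
  { intros f Hf.
    assert (Hex : forall u, ex_series (fun n => Cmod (u n)) -> ex_series (fun n => f (u n))).
    { intros u Hu. apply (ex_series_le (fun n => f (u n)) (fun n => Cmod (u n))); [|exact Hu].
      intros; apply Hf. }
    assert (Hb : forall i j, 0 <= Cmod (a i j) + f (a i j)).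
    { intros i j. specialize (Hf (a i j)). apply Rabs_le_between in Hf. lra. }
    assert (E1 : forall i, Series (fun j => Cmod (a i j) + f (a i j)) =
       Series (fun j => Cmod (a i j)) + Series (fun j => f (a i j))).
    { intros i. apply Series_plus; [apply H1|apply Hex, H1]. }
    assert (E2 : forall j, Series (fun i => Cmod (a i j) + f (a i j)) =
       Series (fun i => Cmod (a i j)) + Series (fun i => f (a i j))).
    { intros j. apply Series_plus; [apply H3|apply Hex, H3]. }
    assert (X1 : ex_series (fun i => Series (fun j => f (a i j)))).
    { apply (ex_series_le (fun i => Series (fun j => f (a i j))) (fun i => Series (fun j => Cmod (a i j)))); [|exact H2].
      intros i. apply Rle_trans with (Series (fun j => Rabs (f (a i j)))).
      - apply Series_Rabs. apply ex_series_comp with (fun j => Cmod (a i j)); [|apply H1].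
        intros; split; [apply Rabs_pos|apply Hf].
      - apply Series_le; [|apply H1]. intros; split; [apply Rabs_pos|apply Hf]. }
    assert (X2 : ex_series (fun j => Series (fun i => f (a i j)))).
    { apply (ex_series_le (fun j => Series (fun i => f (a i j))) (fun j => Series (fun i => Cmod (a i j)))); [|exact H4].
      intros j. apply Rle_trans with (Series (fun i => Rabs (f (a i j)))).
      - apply Series_Rabs. apply ex_series_comp with (fun i => Cmod (a i j)); [|apply H3].
        intros; split; [apply Rabs_pos|apply Hf].
      - apply Series_le; [|apply H3]. intros; split; [apply Rabs_pos|apply Hf]. }
    pose proof (fubini_nonneg_eq (fun i j => Cmod (a i j)) (fun i j => Cmod_ge_0 _) H1 H2) as F1.
    pose proof (fubini_nonneg_eq (fun i j => Cmod (a i j) + f (a i j)) Hb) as F2.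
    cbv beta in F1, F2.
    rewrite (Series_ext _ _ E2), (Series_ext _ _ E1) in F2.
    rewrite !Series_plus in F2 by assumption.
    assert (F3 : forall x y z t : R, x = z -> x + y = z + t -> y = t) by (intros; lra).
    apply (F3 _ _ _ _ F1). apply F2.
    - intros i. exact (ex_series_plus _ _ (H1 i) (Hex _ (H1 i))).
    - apply ex_series_ext with (fun i => Series (fun j => Cmod (a i j)) + Series (fun j => f (a i j))).
      + intros i; now rewrite <- E1.
      + exact (ex_series_plus _ _ H2 X1). }
  unfold CSer. simpl. f_equal.
  - apply (K Re), re_le_Cmod.
  - apply (K Im), im_le_Cmod.
Qed.

(** * Complex derivatives and power series *)


Notation cderive F z l := (@is_derive C_AbsRing C_NormedModule F z l).
Notation ex_cderive F z := (@ex_derive C_AbsRing C_NormedModule F z).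

(** The variable lives in [AbsRing_NormedModule C_AbsRing] and the value in [C_NormedModule]; the
    form in terms of [Cmod] hides the difference. *)
Lemma cderive_eps (F : C -> C) (z l : C) :
  cderive F z l <->
  forall eps, 0 < eps -> exists delta, 0 < delta /\
    forall h, Cmod h < delta -> Cmod (F (z + h) - F z - h * l)%C <= eps * Cmod h.
Proof.
  split.
  - intros [_ H] eps Heps.
    specialize (H z (fun P HP => HP) (mkposreal eps Heps)).
    apply (@locally_le_locally_norm C_AbsRing (AbsRing_NormedModule C_AbsRing)) in H.
    destruct H as [d Hd].
    exists d. split; [apply cond_pos|]. intros h Hh.
    specialize (Hd (z + h)%C).
    assert (E : (z + h - z)%C = h) by ring.
    assert (B : @ball_norm C_AbsRing (AbsRing_NormedModule C_AbsRing) z d (z + h)%C).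
    { change (Cmod (z + h - z)%C < d). now rewrite E. }
    specialize (Hd B).
    change (Cmod ((F (z + h) - F z) - (z + h - z) * l)%C <= eps * Cmod (z + h - z)%C) in Hd.
    now rewrite E in Hd.
  - intros H. split; [apply is_linear_scal_l|].
    intros x Hx.
    assert (E : z = x) by exact (@is_filter_lim_locally_unique C_AbsRing (AbsRing_NormedModule C_AbsRing) z x Hx).
    subst x. intros eps. destruct (H eps (cond_pos eps)) as (d & Hd & K).
    apply (@locally_norm_le_locally C_AbsRing (AbsRing_NormedModule C_AbsRing)).
    exists (mkposreal d Hd). intros y Hy.
    change (Cmod (y - z)%C < d) in Hy.
    change (Cmod ((F y - F z) - (y - z) * l)%C <= eps * Cmod (y - z)%C).
    specialize (K (y - z)%C Hy).
    assert (E : forall y : C, (z + (y - z))%C = y) by (intros; ring).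
    now rewrite (E y) in K.
Qed.

Lemma cderive_ext_loc (F G : C -> C) (z l : C) (d : R) :
  0 < d -> (forall w, Cmod (w - z) < d -> F w = G w) -> cderive F z l -> cderive G z l.
Proof.
  intros Hd E HF. apply cderive_eps. intros eps Heps.
  destruct (proj1 (cderive_eps F z l) HF eps Heps) as (d1 & Hd1 & K).
  exists (Rmin d d1). split; [now apply Rmin_glb_lt|].
  intros h Hh. rewrite <- !E.
  - apply K. eapply Rlt_le_trans; [exact Hh|apply Rmin_r].
  - replace (z - z)%C with (RtoC 0) by ring. now rewrite Cmod_0.
  - replace (z + h - z)%C with h by ring. eapply Rlt_le_trans; [exact Hh|apply Rmin_l].
Qed.

Lemma cderive_eq (F : C -> C) (z l l' : C) : cderive F z l -> l = l' -> cderive F z l'.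
Proof. now intros H <-. Qed.

Lemma cderive_const (c z : C) : cderive (fun _ => c) z (RtoC 0).
Proof. exact (is_derive_const (K := C_AbsRing) (V := C_NormedModule) c z). Qed.

Lemma cderive_id (z : C) : cderive (fun w => w) z (RtoC 1).
Proof.
  apply cderive_eps. intros eps Heps; exists 1; split; [lra|]. intros h _.
  replace (z + h - z - h * 1)%C with (RtoC 0) by ring. rewrite Cmod_0.
  pose proof (Cmod_ge_0 h); nra.
Qed.

Lemma cderive_plus (F G : C -> C) (z l m : C) :
  cderive F z l -> cderive G z m -> cderive (fun w => F w + G w)%C z (l + m)%C.
Proof. exact (is_derive_plus (K := C_AbsRing) (V := C_NormedModule) F G z l m). Qed.

Lemma cderive_continuous (F : C -> C) (z l : C) : cderive F z l ->
  forall eps, 0 < eps -> exists delta, 0 < delta /\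
    forall h, Cmod h < delta -> Cmod (F (z + h) - F z)%C < eps.
Proof.
  intros H eps Heps.
  destruct (proj1 (cderive_eps F z l) H 1 Rlt_0_1) as (d & Hd & K).
  set (M := 1 + Cmod l). pose proof (Cmod_ge_0 l).
  assert (HM : 0 < M) by (unfold M; lra).
  exists (Rmin d (eps / M)). split; [apply Rmin_glb_lt; [exact Hd|now apply Rdiv_lt_0_compat]|].
  intros h Hh.
  assert (H1 : Cmod h < d) by (eapply Rlt_le_trans; [exact Hh|apply Rmin_l]).
  assert (H2 : Cmod h < eps / M) by (eapply Rlt_le_trans; [exact Hh|apply Rmin_r]).
  specialize (K h H1).
  pose proof (Cmod_triangle (F (z + h) - F z - h * l)%C (h * l)) as T.
  replace (F (z + h) - F z - h * l + h * l)%C with (F (z + h) - F z)%C in T by ring.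
  rewrite Cmod_mult in T.
  apply Rle_lt_trans with (Cmod h * M); [unfold M; lra|].
  apply Rmult_lt_compat_r with (r := M) in H2; [|exact HM].
  unfold Rdiv in H2. rewrite Rmult_assoc, Rinv_l, Rmult_1_r in H2; lra.
Qed.

Lemma cderive_mult (F G : C -> C) (z l m : C) :
  cderive F z l -> cderive G z m -> cderive (fun w => F w * G w)%C z (l * G z + F z * m)%C.
Proof.
  intros HF HG.
  apply cderive_eps. intros eps Heps.
  pose proof (Cmod_ge_0 (F z)) as P1. pose proof (Cmod_ge_0 l) as P2. pose proof (Cmod_ge_0 (G z)) as P3.
  set (A := 1 + Cmod (F z)). set (B := 1 + Cmod (G z)). set (D := 1 + Cmod l).
  assert (HA : 0 < A) by (unfold A; lra). assert (HB : 0 < B) by (unfold B; lra). assert (HD : 0 < D) by (unfold D; lra).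
  destruct (proj1 (cderive_eps F z l) HF (eps / (3 * B))) as (d1 & Hd1 & K1); [apply Rdiv_lt_0_compat; lra|].
  destruct (proj1 (cderive_eps G z m) HG (eps / (3 * A))) as (d2 & Hd2 & K2); [apply Rdiv_lt_0_compat; lra|].
  destruct (cderive_continuous G z m HG (Rmin 1 (eps / (3 * D)))) as (d3 & Hd3 & K3).
  { apply Rmin_glb_lt; [lra|apply Rdiv_lt_0_compat; lra]. }
  exists (Rmin d1 (Rmin d2 d3)). split; [now repeat apply Rmin_glb_lt|].
  intros h Hh.
  assert (h1 : Cmod h < d1) by (eapply Rlt_le_trans; [exact Hh|apply Rmin_l]).
  assert (h2 : Cmod h < d2) by (eapply Rlt_le_trans; [exact Hh|eapply Rle_trans; [apply Rmin_r|apply Rmin_l]]).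
  assert (h3 : Cmod h < d3) by (eapply Rlt_le_trans; [exact Hh|eapply Rle_trans; [apply Rmin_r|apply Rmin_r]]).
  specialize (K1 h h1). specialize (K2 h h2). specialize (K3 h h3).
  set (u := (F (z + h) - F z - h * l)%C) in *. set (v := (G (z + h) - G z - h * m)%C) in *.
  set (g := (G (z + h) - G z)%C) in *.
  assert (G1 : Cmod g < 1) by (eapply Rlt_le_trans; [exact K3|apply Rmin_l]).
  assert (G2 : Cmod g < eps / (3 * D)) by (eapply Rlt_le_trans; [exact K3|apply Rmin_r]).
  replace (F (z + h) * G (z + h) - F z * G z - h * (l * G z + F z * m))%C
    with (u * (G z + g) + F z * v + h * l * g)%C by (unfold u, v, g; ring).
  eapply Rle_trans; [apply Cmod_triangle|].
  eapply Rle_trans; [apply Rplus_le_compat_r, Cmod_triangle|].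
  rewrite !Cmod_mult.
  pose proof (Cmod_triangle (G z) g). pose proof (Cmod_ge_0 h) as P4.
  pose proof (Cmod_ge_0 u). pose proof (Cmod_ge_0 v). pose proof (Cmod_ge_0 g).
  assert (E1 : Cmod u * Cmod (G z + g) <= eps / 3 * Cmod h).
  { apply Rle_trans with (eps / (3 * B) * Cmod h * B).
    - apply Rmult_le_compat; try assumption; [apply Cmod_ge_0|unfold B; lra].
    - right. field. lra. }
  assert (E2 : Cmod (F z) * Cmod v <= eps / 3 * Cmod h).
  { apply Rle_trans with (A * (eps / (3 * A) * Cmod h)).
    - apply Rmult_le_compat; try assumption; unfold A; lra.
    - right. field. lra. }
  assert (E3 : Cmod h * Cmod l * Cmod g <= eps / 3 * Cmod h).
  { apply Rle_trans with (Cmod h * D * (eps / (3 * D))).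
    - apply Rmult_le_compat; try lra; [now apply Rmult_le_pos|apply Rmult_le_compat_l; unfold D; lra].
    - right. field. lra. }
  lra.
Qed.

Lemma cderive_comp (F G : C -> C) (z l m : C) :
  cderive F (G z) l -> cderive G z m -> cderive (fun w => F (G w)) z (m * l)%C.
Proof.
  intros HF HG.
  assert (HG' : @is_derive C_AbsRing (AbsRing_NormedModule C_AbsRing) G z m).
  { destruct HG as [H1 H2]. split; [apply is_linear_scal_l|exact H2]. }
  exact (is_derive_comp (K := C_AbsRing) (V := C_NormedModule) F G z l m HF HG').
Qed.

Lemma cderive_inv_id (z : C) : z <> RtoC 0 -> cderive (fun w => / w)%C z (- / (z * z))%C.
Proof.
  intros Hz. apply cderive_eps. intros eps Heps.
  assert (Hm : 0 < Cmod z) by now apply Cmod_gt_0.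
  set (c := Cmod z) in *.
  exists (Rmin (c / 2) (eps * c ^ 3 / 2)). split.
  { apply Rmin_glb_lt; [lra|]. assert (0 < c ^ 3) by (apply pow_lt; lra). nra. }
  intros h Hh.
  assert (h1 : Cmod h < c / 2) by (eapply Rlt_le_trans; [exact Hh|apply Rmin_l]).
  assert (h2 : Cmod h < eps * c ^ 3 / 2) by (eapply Rlt_le_trans; [exact Hh|apply Rmin_r]).
  assert (Hb : c / 2 <= Cmod (z + h)).
  { pose proof (Cmod_sub_ge z (- h)). rewrite Cmod_opp in H.
    replace (z - - h)%C with (z + h)%C in H by ring. fold c in H. lra. }
  assert (Hn : (z + h)%C <> RtoC 0) by (apply Cmod_gt_0; lra).
  replace (/ (z + h) - / z - h * (- / (z * z)))%C with (h * h * / (z * z * (z + h)))%C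
    by (field; split; assumption).
  rewrite !Cmod_mult, Cmod_inv by (repeat apply Cmult_neq_0; assumption).
  rewrite !Cmod_mult. fold c.
  pose proof (Cmod_ge_0 h).
  rewrite Rmult_assoc, (Rmult_comm eps). apply Rmult_le_compat_l; [assumption|].
  assert (P : 0 < c * c * Cmod (z + h)) by (repeat apply Rmult_lt_0_compat; lra).
  apply Rmult_le_reg_r with (c * c * Cmod (z + h)); [exact P|].
  rewrite Rmult_assoc, Rinv_l, Rmult_1_r by lra.
  apply Rle_trans with (eps * (c * c * (c / 2))); [nra|].
  apply Rmult_le_compat_l; [lra|]. apply Rmult_le_compat_l; [nra|exact Hb].
Qed.

Lemma cderive_inv (F : C -> C) (z l : C) :
  cderive F z l -> F z <> RtoC 0 -> cderive (fun w => / F w)%C z (l * (- / (F z * F z)))%C.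
Proof.
  intros HF Hz. exact (cderive_comp (fun w => / w)%C F z _ l (cderive_inv_id _ Hz) HF).
Qed.

Lemma cderive_unique (F : C -> C) (z l m : C) : cderive F z l -> cderive F z m -> l = m.
Proof.
  intros H1 H2.
  apply is_C_derive_unique in H1. apply is_C_derive_unique in H2. congruence.
Qed.

Lemma cderive_line (F : C -> C) (p d l : C) (t : R) :
  cderive F (p + t * d)%C l ->
  is_derive (fun u : R => Re (F (p + u * d)%C)) t (Re (d * l)%C) /\
  is_derive (fun u : R => Im (F (p + u * d)%C)) t (Im (d * l)%C).
Proof.
  intros H.
  assert (K : forall f : C -> R, (forall x y, f (x - y)%C = f x - f y) ->
     (forall (r : R) x, f (r * x)%C = r * f x) -> (forall x, Rabs (f x) <= Cmod x) ->
     is_derive (fun u : R => f (F (p + u * d)%C)) t (f (d * l)%C)).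
  { intros f Hf Hs Hb. apply is_derive_Reals. intros eps Heps.
    set (M := 1 + Cmod d). pose proof (Cmod_ge_0 d) as Pd. assert (HM : 0 < M) by (unfold M; lra).
    destruct (proj1 (cderive_eps _ _ _) H (eps / (2 * M))) as (dl & Hdl & KK); [apply Rdiv_lt_0_compat; lra|].
    assert (Hp : 0 < dl / M) by now apply Rdiv_lt_0_compat.
    exists (mkposreal _ Hp). intros h Hh0 Hh. simpl in Hh.
    specialize (KK (h * d)%C).
    rewrite Cmod_mult, Cmod_R in KK.
    assert (h1 : Rabs h * Cmod d < dl).
    { apply Rle_lt_trans with (Rabs h * M); [apply Rmult_le_compat_l; [apply Rabs_pos|unfold M; lra]|].
      apply Rmult_lt_compat_r with (r := M) in Hh; [|exact HM].
      unfold Rdiv in Hh. rewrite Rmult_assoc, Rinv_l, Rmult_1_r in Hh; lra. }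
    specialize (KK h1).
    replace (p + t * d + h * d)%C with (p + (t + h)%R * d)%C in KK by (rewrite RtoC_plus; ring).
    specialize (Hb (F (p + (t + h)%R * d) - F (p + t * d) - h * d * l)%C).
    replace (h * d * l)%C with (h * (d * l))%C in Hb by ring.
    rewrite !Hf, Hs in Hb.
    set (X := f (F (p + (t + h)%R * d)%C)) in *. set (Y := f (F (p + t * d)%C)) in *.
    replace ((X - Y) / h - f (d * l)%C) with ((X - Y - h * f (d * l)%C) / h) by (field; exact Hh0).
    unfold Rdiv. rewrite Rabs_mult, Rabs_inv.
    assert (Ph : 0 < Rabs h) by now apply Rabs_pos_lt.
    apply Rmult_lt_reg_r with (Rabs h); [exact Ph|].
    rewrite Rmult_assoc, Rinv_l, Rmult_1_r by lra.
    replace (h * d * l)%C with (h * (d * l))%C in KK by ring.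
    eapply Rle_lt_trans; [eapply Rle_trans; [exact Hb|exact KK]|].
    apply Rle_lt_trans with (eps / (2 * M) * (Rabs h * M)).
    - apply Rmult_le_compat_l; [apply Rlt_le, Rdiv_lt_0_compat; lra|].
      apply Rmult_le_compat_l; [lra|unfold M; lra].
    - replace (eps / (2 * M) * (Rabs h * M)) with (eps * Rabs h / 2) by (field; lra). nra. }
  split; apply K; try reflexivity;
    auto using re_scal_l, im_scal_l, re_le_Cmod, im_le_Cmod.
Qed.

(** On the segment from 0 to [w] the real and imaginary parts are functions of one real variable
    with derivative 0. Identities between analytic functions are later proved by applying this to a
    quotient. *)
Lemma cderive_zero_const (F : C -> C) (rho : R) (w : C) :
  (forall z, Cmod z < rho -> cderive F z (RtoC 0)) -> Cmod w < rho -> F w = F (RtoC 0).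
Proof.
  intros H Hw.
  assert (Ht : forall t : R, 0 <= t <= 1 -> cderive F (0 + t * w)%C (RtoC 0)).
  { intros t Ht. apply H. rewrite Cplus_0_l, Cmod_mult, Cmod_R, Rabs_pos_eq by lra.
    pose proof (Cmod_ge_0 w). nra. }
  assert (K : forall f : R -> R, (forall t, 0 <= t <= 1 -> is_derive f t 0) -> f 1 = f 0).
  { intros f Hf. destruct (MVT_cor2 f (fun _ => 0) 0 1) as (c & E & _); [lra| |lra].
    intros c Hc. apply is_derive_Reals, Hf, Hc. }
  assert (E1 : F w = F (0 + 1%R * w)%C) by (f_equal; ring).
  assert (E0 : F (RtoC 0) = F (0 + 0%R * w)%C) by (f_equal; ring).
  rewrite E1, E0.
  apply C_ext.
  - apply (K (fun t => Re (F (0 + t * w)%C))). intros t Htt.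
    destruct (cderive_line F 0 w 0 t (Ht t Htt)) as [D _]. now rewrite Cmult_0_r in D.
  - apply (K (fun t => Im (F (0 + t * w)%C))). intros t Htt.
    destruct (cderive_line F 0 w 0 t (Ht t Htt)) as [_ D]. now rewrite Cmult_0_r in D.
Qed.

(** * Power series and their derivatives *)

Definition CPS (c : nat -> C) (w : C) : C := CSer (fun k => c k * w ^ k)%C.

(** Says that the radius of convergence is at least [rho]. Keeping the radius as a parameter allows
    it to be enlarged later for the same coefficients. *)
Definition conv (c : nat -> C) (rho : R) : Prop :=
  forall r, 0 <= r < rho -> ex_series (fun k => Cmod (c k) * r ^ k).

Lemma asum_conv_le c r w : ex_series (fun k => Cmod (c k) * r ^ k) -> Cmod w <= r ->
  asum (fun k => c k * w ^ k)%C.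
Proof.
  intros H Hw. apply asum_le with (fun k => Cmod (c k) * r ^ k); [|exact H].
  intros k. rewrite Cmod_mult, Cmod_pow. apply Rmult_le_compat_l; [apply Cmod_ge_0|].
  apply pow_incr; split; [apply Cmod_ge_0|exact Hw].
Qed.

Lemma conv_asum c rho w : conv c rho -> Cmod w < rho -> asum (fun k => c k * w ^ k)%C.
Proof.
  intros H Hw. apply asum_conv_le with (Cmod w); [|lra].
  apply H. split; [apply Cmod_ge_0|exact Hw].
Qed.

Lemma asum_zero : asum (fun _ => RtoC 0).
Proof.
  exists 0. apply is_series_rsum. apply is_lim_seq_ext with (fun _ => 0); [|apply is_lim_seq_const].
  intros n; induction n as [|n IH]; simpl; [reflexivity|rewrite <- IH, Cmod_0; ring].
Qed.

Lemma CSer_zero : CSer (fun _ => RtoC 0) = RtoC 0.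
Proof.
  apply clim_unique with (csum (fun _ => RtoC 0)); [apply CSer_lim, asum_zero|].
  apply clim_ext with (fun _ => RtoC 0); [|apply clim_const].
  intros n; induction n as [|n IH]; simpl; [reflexivity|rewrite <- IH; ring].
Qed.

Lemma CPS_0 (c : nat -> C) : CPS c (RtoC 0) = c O.
Proof.
  assert (E : forall n, RtoC 0 = (c (S n) * RtoC 0 ^ S n)%C) by (intros; simpl; ring).
  unfold CPS. rewrite CSer_shift.
  - rewrite <- (CSer_ext _ _ E), CSer_zero. simpl. ring.
  - apply asum_shift. exact (asum_ext _ _ E asum_zero).
Qed.

Lemma conv_le c rho rho' : rho' <= rho -> conv c rho -> conv c rho'.
Proof. intros H Hc r Hr. apply Hc. lra. Qed.

Definition deriv_coef (c : nat -> C) : nat -> C := fun k => (INR (S k) * c (S k))%C.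

Lemma pow_diff_lower (r s : R) k : 0 <= r <= s -> INR (S k) * r ^ k * (s - r) <= s ^ S k - r ^ S k.
Proof.
  intros H. induction k as [|k IH]; [simpl; lra|].
  rewrite S_INR.
  assert (r ^ S k <= s ^ S k) by (apply pow_incr; lra).
  assert (0 <= r ^ S k) by (apply pow_le; lra).
  replace (s ^ S (S k) - r ^ S (S k)) with (s ^ S k * (s - r) + r * (s ^ S k - r ^ S k)) by (simpl; ring).
  replace ((INR (S k) + 1) * r ^ S k * (s - r)) with (r * (INR (S k) * r ^ k * (s - r)) + r ^ S k * (s - r)) by (simpl; ring).
  assert (r * (INR (S k) * r ^ k * (s - r)) <= r * (s ^ S k - r ^ S k)) by (apply Rmult_le_compat_l; lra).
  assert (r ^ S k * (s - r) <= s ^ S k * (s - r)) by (apply Rmult_le_compat_r; lra).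
  lra.
Qed.

(** A radius [s] strictly between [r] and [rho] absorbs the factor [INR (S k)], by the inequality of
    [pow_diff_lower]. *)
Lemma conv_deriv c rho : conv c rho -> conv (deriv_coef c) rho.
Proof.
  intros H r Hr. set (s := (r + rho) / 2).
  assert (Hs : 0 <= s < rho) by (unfold s; lra). assert (Hrs : r < s) by (unfold s; lra).
  pose proof (H s Hs) as Hsum. apply ex_series_incr_1 in Hsum.
  apply ex_series_comp with (fun k => / (s - r) * (Cmod (c (S k)) * s ^ S k)).
  - intros k. unfold deriv_coef. rewrite Cmod_mult, Cmod_R, Rabs_pos_eq by apply pos_INR.
    pose proof (Cmod_ge_0 (c (S k))) as P1. pose proof (pos_INR (S k)) as P2.
    assert (P3 : 0 <= r ^ k) by (apply pow_le; lra).
    split; [repeat apply Rmult_le_pos; assumption|].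
    replace (INR (S k) * Cmod (c (S k)) * r ^ k) with (Cmod (c (S k)) * (INR (S k) * r ^ k)) by ring.
    replace (/ (s - r) * (Cmod (c (S k)) * s ^ S k)) with (Cmod (c (S k)) * (s ^ S k / (s - r))) by (unfold Rdiv; ring).
    apply Rmult_le_compat_l; [exact P1|].
    apply Rmult_le_reg_r with (s - r); [lra|].
    unfold Rdiv. rewrite (Rmult_assoc (s ^ S k)), Rinv_l, Rmult_1_r by lra.
    pose proof (pow_diff_lower r s k) as D.
    assert (0 <= r ^ S k) by (apply pow_le; lra). lra.
  - exact (ex_series_scal_l (/ (s - r)) _ Hsum).
Qed.

Lemma Cpow_diff_1 (w h : C) (r : R) k : Cmod w <= r -> Cmod (w + h) <= r ->
  Cmod ((w + h) ^ S k - w ^ S k)%C <= INR (S k) * r ^ k * Cmod h.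
Proof.
  intros Hw Hwh. assert (Hr : 0 <= r) by (pose proof (Cmod_ge_0 w); lra).
  induction k as [|k IH].
  - simpl. replace ((w + h) * 1 - w * 1)%C with h by ring. lra.
  - replace ((w + h) ^ S (S k) - w ^ S (S k))%C
      with ((w + h) ^ S k * h + w * ((w + h) ^ S k - w ^ S k))%C by (simpl; ring).
    eapply Rle_trans; [apply Cmod_triangle|]. rewrite !Cmod_mult, Cmod_pow.
    assert (A : Cmod (w + h) ^ S k <= r ^ S k) by (apply pow_incr; split; [apply Cmod_ge_0|exact Hwh]).
    pose proof (Cmod_ge_0 h). pose proof (Cmod_ge_0 w).
    assert (B : Cmod w * Cmod ((w + h) ^ S k - w ^ S k) <= r * (INR (S k) * r ^ k * Cmod h)).
    { apply Rmult_le_compat; try assumption. apply Cmod_ge_0. }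
    assert (A' : Cmod (w + h) ^ S k * Cmod h <= r ^ S k * Cmod h) by now apply Rmult_le_compat_r.
    rewrite (S_INR (S k)).
    replace ((INR (S k) + 1) * r ^ S k * Cmod h) with (r ^ S k * Cmod h + r * (INR (S k) * r ^ k * Cmod h)) by (simpl; ring).
    lra.
Qed.

Lemma Cpow_diff_2 (w h : C) (r : R) k : Cmod w <= r -> Cmod (w + h) <= r ->
  Cmod ((w + h) ^ S (S k) - w ^ S (S k) - h * (INR (S (S k)) * w ^ S k))%C
    <= INR (S k) * INR (S (S k)) * r ^ k * (Cmod h) ^ 2.
Proof.
  intros Hw Hwh. assert (Hr : 0 <= r) by (pose proof (Cmod_ge_0 w); lra).
  pose proof (Cmod_ge_0 h) as Ph. pose proof (Cmod_ge_0 w) as Pw.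
  induction k as [|k IH].
  - replace ((w + h) ^ 2 - w ^ 2 - h * (INR 2 * w ^ 1))%C with (h * h)%C.
    + rewrite Cmod_mult. simpl. nra.
    + replace (RtoC (INR 2)) with (RtoC 1 + RtoC 1)%C by (rewrite <- RtoC_plus; reflexivity). simpl. ring.
  - set (P := ((w + h) ^ S (S k) - w ^ S (S k) - h * (INR (S (S k)) * w ^ S k))%C) in *.
    replace ((w + h) ^ S (S (S k)) - w ^ S (S (S k)) - h * (INR (S (S (S k))) * w ^ S (S k)))%C
      with (w * P + h * ((w + h) ^ S (S k) - w ^ S (S k)))%C.
    2:{ unfold P. rewrite (S_INR (S (S k))), RtoC_plus.
        change (w ^ S (S (S k)))%C with (w * w ^ S (S k))%C.
        change ((w + h) ^ S (S (S k)))%C with ((w + h) * (w + h) ^ S (S k))%C.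
        change (w ^ S (S k))%C with (w * w ^ S k)%C. ring. }
    eapply Rle_trans; [apply Cmod_triangle|]. rewrite !Cmod_mult.
    pose proof (Cpow_diff_1 w h r (S k) Hw Hwh) as D1.
    assert (A : Cmod w * Cmod P <= r * (INR (S k) * INR (S (S k)) * r ^ k * Cmod h ^ 2)).
    { apply Rmult_le_compat; try assumption. apply Cmod_ge_0. }
    assert (B : Cmod h * Cmod ((w + h) ^ S (S k) - w ^ S (S k)) <= Cmod h * (INR (S (S k)) * r ^ S k * Cmod h))
      by now apply Rmult_le_compat_l.
    eapply Rle_trans; [apply Rplus_le_compat; [exact A|exact B]|].
    rewrite (S_INR (S (S k))), (S_INR (S k)).
    assert (0 <= r ^ S k) by now apply pow_le.
    assert (0 <= Cmod h ^ 2) by (apply pow_le; lra).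
    pose proof (pos_INR (S k)).
    replace (r * (INR (S k) * (INR (S k) + 1) * r ^ k * Cmod h ^ 2) + Cmod h * ((INR (S k) + 1) * r ^ S k * Cmod h))
      with ((INR (S k) + 1) * (INR (S k) + 1) * (r ^ S k * Cmod h ^ 2)) by (simpl; ring).
    replace ((INR (S k) + 1) * (INR (S k) + 1 + 1) * r ^ S k * Cmod h ^ 2)
      with ((INR (S k) + 1) * (INR (S k) + 1 + 1) * (r ^ S k * Cmod h ^ 2)) by ring.
    apply Rmult_le_compat_r; [now apply Rmult_le_pos|]. nra.
Qed.

(** The second-order remainder is bounded termwise by [Cmod h ^ 2] times the twice differentiated
    series at a radius between [Cmod w] and [rho]. *)
Lemma CPS_derive c rho w : conv c rho -> Cmod w < rho -> cderive (CPS c) w (CPS (deriv_coef c) w).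
Proof.
  intros H Hw. pose proof (Cmod_ge_0 w) as Pw.
  set (r := (Cmod w + rho) / 2).
  assert (Hr : 0 <= r < rho) by (unfold r; lra).
  pose proof (conv_deriv _ _ H) as H1. pose proof (conv_deriv _ _ H1) as H2.
  set (b := fun k => Cmod (deriv_coef (deriv_coef c) k) * r ^ k).
  assert (Hb : ex_series b) by now apply H2.
  assert (Pb : forall k, 0 <= b k).
  { intros k; apply Rmult_le_pos; [apply Cmod_ge_0|apply pow_le; lra]. }
  set (M := 1 + Series b). assert (HM : 0 < M) by (unfold M; pose proof (Series_nonneg b Pb Hb); lra).
  apply cderive_eps. intros eps Heps.
  exists (Rmin (r - Cmod w) (eps / M)).
  split; [apply Rmin_glb_lt; [unfold r; lra|now apply Rdiv_lt_0_compat]|].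
  intros h Hh.
  assert (h1 : Cmod h < r - Cmod w) by (eapply Rlt_le_trans; [exact Hh|apply Rmin_l]).
  assert (h2 : Cmod h < eps / M) by (eapply Rlt_le_trans; [exact Hh|apply Rmin_r]).
  pose proof (Cmod_triangle w h) as T. pose proof (Cmod_ge_0 h) as Ph.
  assert (A0 : asum (fun k => c k * w ^ k)%C) by now apply conv_asum with rho.
  assert (A1 : asum (fun k => c k * (w + h) ^ k)%C) by (apply conv_asum with rho; [exact H|lra]).
  assert (A2 : asum (fun k => deriv_coef c k * w ^ k)%C) by now apply conv_asum with rho.
  set (e := fun k => (c k * (w + h) ^ k + -(1) * (c k * w ^ k))%C).
  assert (Ae : asum e) by (apply asum_plus; [exact A1|now apply asum_scal]).
  assert (Ee : (CPS c (w + h) - CPS c w)%C = CSer e).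
  { unfold e. rewrite CSer_plus by (try apply asum_scal; assumption).
    rewrite CSer_scal by assumption. unfold CPS. ring. }
  rewrite Ee, CSer_shift by exact Ae.
  replace (e O) with (RtoC 0) by (unfold e; simpl; ring). rewrite Cplus_0_l.
  assert (Ae' : asum (fun k => e (S k))) by now apply (proj1 (asum_shift e)).
  set (g := fun k => (e (S k) + (- h) * (deriv_coef c k * w ^ k))%C).
  assert (Ag : asum g) by (apply asum_plus; [exact Ae'|now apply asum_scal]).
  replace (CSer (fun k => e (S k)) - h * CPS (deriv_coef c) w)%C with (CSer g).
  2:{ unfold g. rewrite CSer_plus by (try apply asum_scal; assumption).
      rewrite CSer_scal by assumption. unfold CPS. ring. }
  rewrite CSer_shift by exact Ag.
  replace (g O) with (RtoC 0).
  2:{ unfold g, e, deriv_coef. simpl. ring. }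
  rewrite Cplus_0_l.
  apply Rle_trans with (Series (fun k => Cmod h ^ 2 * b k)).
  - apply CSer_bound; [|exact (ex_series_scal_l (Cmod h ^ 2) _ Hb)].
    intros k. unfold g, e, deriv_coef.
    replace (c (S (S k)) * (w + h) ^ S (S k) + - (1) * (c (S (S k)) * w ^ S (S k)) +
      - h * (INR (S (S k)) * c (S (S k)) * w ^ S k))%C
      with (c (S (S k)) * ((w + h) ^ S (S k) - w ^ S (S k) - h * (INR (S (S k)) * w ^ S k)))%C by ring.
    rewrite Cmod_mult. unfold b, deriv_coef. rewrite !Cmod_mult, !Cmod_R, !(Rabs_pos_eq (INR _)) by apply pos_INR.
    pose proof (Cpow_diff_2 w h r k) as D.
    replace (Cmod h ^ 2 * (INR (S k) * (INR (S (S k)) * Cmod (c (S (S k)))) * r ^ k))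
      with (Cmod (c (S (S k))) * (INR (S k) * INR (S (S k)) * r ^ k * Cmod h ^ 2)) by ring.
    apply Rmult_le_compat_l; [apply Cmod_ge_0|]. apply D; lra.
  - rewrite Series_scal_l.
    apply Rle_trans with (Cmod h ^ 2 * M).
    + apply Rmult_le_compat_l; [apply pow_le; exact Ph|unfold M; lra].
    + apply Rmult_lt_compat_r with (r := M) in h2; [|exact HM].
      unfold Rdiv in h2. rewrite Rmult_assoc, Rinv_l, Rmult_1_r in h2 by lra.
      simpl. nra.
Qed.

(** * The exponential, Dirichlet series and double series *)


Lemma ex_series_extR (a b : nat -> R) : (forall n, a n = b n) -> ex_series a -> ex_series b.
Proof. exact (ex_series_ext a b). Qed.

Lemma Cexp_plus (x y : C) : Cexp (x + y) = (Cexp x * Cexp y)%C.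
Proof.
  unfold Cexp. rewrite Re_plus, Im_plus, exp_plus, cos_plus, sin_plus.
  apply C_ext; simpl; ring.
Qed.

Lemma Cmod_polar (r t : R) : 0 <= r -> Cmod (r * cos t, r * sin t)%R = r.
Proof.
  intros Hr. unfold Cmod; simpl.
  replace (r * cos t * (r * cos t * 1) + r * sin t * (r * sin t * 1)) with (r ^ 2 * (Rsqr (sin t) + Rsqr (cos t)))
    by (unfold Rsqr; ring).
  rewrite sin2_cos2, Rmult_1_r. now apply sqrt_pow2.
Qed.

Lemma Cmod_Cexp (x : C) : Cmod (Cexp x) = exp (Re x).
Proof. apply Cmod_polar, Rlt_le, exp_pos. Qed.

Lemma Cexp_RtoC (x : R) : Cexp (RtoC x) = RtoC (exp x).
Proof. unfold Cexp. simpl. rewrite cos_0, sin_0. apply C_ext; simpl; ring. Qed.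

Lemma Cexp_0 : Cexp (RtoC 0) = RtoC 1.
Proof. now rewrite Cexp_RtoC, exp_0. Qed.

Lemma Cexp_nz (x : C) : Cexp x <> RtoC 0.
Proof. apply Cmod_gt_0. rewrite Cmod_Cexp. apply exp_pos. Qed.

Lemma Cexp_opp_r (x : C) : (Cexp x * Cexp (- x))%C = RtoC 1.
Proof. rewrite <- Cexp_plus. replace (x + - x)%C with (RtoC 0) by ring. apply Cexp_0. Qed.

Lemma Cexp_pow (x : C) n : (Cexp x ^ n)%C = Cexp (INR n * x).
Proof.
  induction n as [|n IH].
  - simpl. rewrite <- Cexp_0. f_equal. ring.
  - change (Cexp x ^ S n)%C with (Cexp x * Cexp x ^ n)%C.
    rewrite IH, <- Cexp_plus, S_INR, RtoC_plus. f_equal. ring.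
Qed.

Lemma derivable_0_bound (f : R -> R) (l eps : R) : derivable_pt_lim f 0 l -> 0 < eps ->
  exists delta, 0 < delta /\ forall h, Rabs h < delta -> Rabs (f h - f 0 - l * h) <= eps * Rabs h.
Proof.
  intros H Heps. destruct (H eps Heps) as [d K]. exists d; split; [apply cond_pos|].
  intros h Hh. destruct (Req_dec h 0) as [->|Hn].
  - replace (f 0 - f 0 - l * 0) with 0 by ring. rewrite Rabs_R0. lra.
  - specialize (K h Hn Hh). rewrite Rplus_0_l in K.
    replace (f h - f 0 - l * h) with (((f h - f 0) / h - l) * h) by (field; exact Hn).
    rewrite Rabs_mult. apply Rmult_le_compat_r; [apply Rabs_pos|lra].
Qed.

Lemma Cexp_derive_0 : cderive Cexp (RtoC 0) (RtoC 1).
Proof.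
  apply cderive_eps. intros eps Heps.
  (* The four error terms [A1] to [A4] add up to at most [9 * e * m], as [m < e]; 20 leaves a
     margin. *)
  set (e := Rmin 1 (eps / 20)).
  assert (He : 0 < e) by (apply Rmin_glb_lt; lra).
  assert (He1 : e <= 1) by apply Rmin_l. assert (He2 : e <= eps / 20) by apply Rmin_r.
  destruct (derivable_0_bound exp 1 e) as (d1 & Hd1 & K1); [|exact He|].
  { pose proof (derivable_pt_lim_exp 0) as D. now rewrite exp_0 in D. }
  destruct (derivable_0_bound sin 1 e) as (d2 & Hd2 & K2); [|exact He|].
  { pose proof (derivable_pt_lim_sin 0) as D. now rewrite cos_0 in D. }
  destruct (derivable_0_bound cos 0 e) as (d3 & Hd3 & K3); [|exact He|].
  { pose proof (derivable_pt_lim_cos 0) as D. now rewrite sin_0, Ropp_0 in D. }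
  exists (Rmin (Rmin e d1) (Rmin d2 d3)). split; [apply Rmin_glb_lt; apply Rmin_glb_lt; assumption|].
  intros h Hh.
  assert (M1 : Cmod h < e) by (eapply Rlt_le_trans; [exact Hh|eapply Rle_trans; [apply Rmin_l|apply Rmin_l]]).
  assert (M2 : Cmod h < d1) by (eapply Rlt_le_trans; [exact Hh|eapply Rle_trans; [apply Rmin_l|apply Rmin_r]]).
  assert (M3 : Cmod h < d2) by (eapply Rlt_le_trans; [exact Hh|eapply Rle_trans; [apply Rmin_r|apply Rmin_l]]).
  assert (M4 : Cmod h < d3) by (eapply Rlt_le_trans; [exact Hh|eapply Rle_trans; [apply Rmin_r|apply Rmin_r]]).
  pose proof (re_le_Cmod h) as Bx. pose proof (im_le_Cmod h) as By.
  set (m := Cmod h) in *.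
  specialize (K1 (Re h) ltac:(lra)). specialize (K2 (Im h) ltac:(lra)). specialize (K3 (Im h) ltac:(lra)).
  rewrite exp_0 in K1. rewrite sin_0 in K2. rewrite cos_0 in K3.
  replace (Cexp (0 + h) - Cexp 0 - h * 1)%C with (Cexp h - 1 - h)%C
    by (rewrite Cplus_0_l, Cexp_0; ring).
  eapply Rle_trans; [apply Cmod_le_sum|].
  set (x := Re h) in *. set (y := Im h) in *.
  assert (ER : Re (Cexp h - 1 - h)%C = (exp x - 1 - 1 * x) + exp x * (cos y - 1 - 0 * y))
    by (unfold Cexp; fold x y; simpl; fold x y; unfold x, Re; ring).
  assert (EI : Im (Cexp h - 1 - h)%C = exp x * (sin y - 0 - 1 * y) + (exp x - 1) * y)
    by (unfold Cexp; fold x y; simpl; unfold y, Im; ring).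
  rewrite ER, EI.
  assert (Ex : Rabs (exp x - 1) <= 2 * m).
  { replace (exp x - 1) with ((exp x - 1 - 1 * x) + x) by ring.
    eapply Rle_trans; [apply Rabs_triang|]. pose proof (Rabs_pos x). nra. }
  assert (Ex3 : Rabs (exp x) <= 3).
  { replace (exp x) with ((exp x - 1) + 1) by ring. eapply Rle_trans; [apply Rabs_triang|]. rewrite Rabs_R1. lra. }
  assert (Pm : 0 <= m) by (unfold m; apply Cmod_ge_0).
  pose proof (Rabs_pos x); pose proof (Rabs_pos y).
  assert (A1 : Rabs (exp x - 1 - 1 * x) <= e * m) by nra.
  assert (A2 : Rabs (exp x * (cos y - 1 - 0 * y)) <= 3 * (e * m)).
  { rewrite Rabs_mult. apply Rmult_le_compat; try apply Rabs_pos; [lra|nra]. }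
  assert (A3 : Rabs (exp x * (sin y - 0 - 1 * y)) <= 3 * (e * m)).
  { rewrite Rabs_mult. apply Rmult_le_compat; try apply Rabs_pos; [lra|nra]. }
  assert (A4 : Rabs ((exp x - 1) * y) <= 2 * m * m).
  { rewrite Rabs_mult. apply Rmult_le_compat; try apply Rabs_pos; lra. }
  pose proof (Rabs_triang (exp x - 1 - 1 * x) (exp x * (cos y - 1 - 0 * y))).
  pose proof (Rabs_triang (exp x * (sin y - 0 - 1 * y)) ((exp x - 1) * y)).
  nra.
Qed.

Lemma cderive_Cexp (z : C) : cderive Cexp z (Cexp z).
Proof.
  apply cderive_eps. intros eps Heps.
  pose proof (exp_pos (Re z)) as Pe.
  destruct (proj1 (cderive_eps _ _ _) Cexp_derive_0 (eps / exp (Re z))) as (d & Hd & K);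
    [now apply Rdiv_lt_0_compat|].
  exists d; split; [exact Hd|]. intros h Hh. specialize (K h Hh).
  replace (Cexp (z + h) - Cexp z - h * Cexp z)%C with (Cexp z * (Cexp (0 + h) - Cexp 0 - h * 1))%C
    by (rewrite Cplus_0_l, Cexp_0, Cexp_plus; ring).
  rewrite Cmod_mult, Cmod_Cexp.
  apply Rmult_le_compat_l with (r := exp (Re z)) in K; [|lra].
  replace (exp (Re z) * (eps / exp (Re z) * Cmod h)) with (eps * Cmod h) in K by (field; lra).
  exact K.
Qed.

Lemma cderive_Cexp_comp (F : C -> C) (z l : C) :
  cderive F z l -> cderive (fun w => Cexp (F w)) z (l * Cexp (F z))%C.
Proof. intros H. exact (cderive_comp Cexp F z _ l (cderive_Cexp _) H). Qed.

Definition expcoef (k : nat) : C := RtoC (/ INR (Factorial.fact k)).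

Lemma exp_series (x : R) : is_series (fun k => / INR (Factorial.fact k) * x ^ k) (exp x).
Proof. apply is_pseries_R, is_exp_Reals. Qed.

Lemma Cmod_expcoef k : Cmod (expcoef k) = / INR (Factorial.fact k).
Proof.
  unfold expcoef. rewrite Cmod_R. apply Rabs_pos_eq, Rlt_le, Rinv_0_lt_compat, INR_fact_lt_0.
Qed.

Lemma conv_expcoef rho : conv expcoef rho.
Proof.
  intros r _. apply ex_series_extR with (fun k => / INR (Factorial.fact k) * r ^ k).
  - intros k. now rewrite Cmod_expcoef.
  - exists (exp r). apply exp_series.
Qed.

Lemma deriv_expcoef : deriv_coef expcoef = expcoef.
Proof.
  apply functional_extensionality; intros k. unfold deriv_coef, expcoef.
  rewrite <- RtoC_mult. f_equal. change (Factorial.fact (S k)) with (S k * Factorial.fact k)%nat.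
  rewrite mult_INR. field. split; [apply INR_fact_neq_0|apply not_0_INR; lia].
Qed.

Lemma Cexp_CPS (z : C) : Cexp z = CPS expcoef z.
Proof.
  assert (E : (CPS expcoef z * Cexp (- z))%C = RtoC 1).
  { rewrite (cderive_zero_const (fun w => CPS expcoef w * Cexp (- w))%C (Cmod z + 1) z).
    - rewrite CPS_0. unfold expcoef. simpl. rewrite Rinv_1.
      replace (- RtoC 0)%C with (RtoC 0) by ring. rewrite Cexp_0. ring.
    - intros w Hw.
      eapply cderive_eq.
      + apply cderive_mult.
        * apply CPS_derive with (Cmod z + 1); [apply conv_expcoef|exact Hw].
        * apply cderive_Cexp_comp.
          apply (cderive_ext_loc (fun u => (-(1)) * u)%C _ _ _ 1 Rlt_0_1); [intros; ring|].
          apply cderive_mult; [apply cderive_const|apply cderive_id].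
      + rewrite deriv_expcoef. ring.
    - lra. }
  rewrite <- (Cmult_1_l (Cexp z)), <- E, <- Cmult_assoc, (Cmult_comm (Cexp (- z))), Cexp_opp_r. ring.
Qed.

(** Taylor coefficients of [- log (1 - z)], the logarithm of a local factor of an Euler product. *)
Definition logcoef (k : nat) : C := match k with O => RtoC 0 | S _ => RtoC (/ INR k) end.

Lemma Cmod_logcoef k : Cmod (logcoef k) <= 1.
Proof.
  destruct k as [|k]; unfold logcoef.
  - rewrite Cmod_0. lra.
  - rewrite Cmod_R. assert (1 <= INR (S k)) by (rewrite S_INR; pose proof (pos_INR k); lra).
    rewrite Rabs_pos_eq; [|apply Rlt_le, Rinv_0_lt_compat; lra].
    rewrite <- Rinv_1. apply Rinv_le_contravar; lra.
Qed.

Lemma conv_bounded (c : nat -> C) (M : R) : (forall k, Cmod (c k) <= M) -> conv c 1.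
Proof.
  intros H r Hr.
  assert (G : ex_series (fun k => r ^ k)) by (exists (/ (1 - r)); apply is_series_geom; rewrite Rabs_pos_eq; lra).
  apply ex_series_comp with (fun k => M * r ^ k).
  - intros k. assert (0 <= r ^ k) by (apply pow_le; lra).
    split; [apply Rmult_le_pos; [apply Cmod_ge_0|assumption]|now apply Rmult_le_compat_r].
  - exact (ex_series_scal_l M _ G).
Qed.

Lemma conv_logcoef : conv logcoef 1.
Proof. exact (conv_bounded logcoef 1 Cmod_logcoef). Qed.

Lemma CPS_geom (z : C) : Cmod z < 1 -> (CPS (fun _ => RtoC 1) z * (1 - z))%C = RtoC 1.
Proof.
  intros Hz.
  assert (A : asum (fun k => RtoC 1 * z ^ k)%C).
  { apply conv_asum with 1; [|exact Hz]. apply (conv_bounded _ 1). intros; rewrite Cmod_1; lra. }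
  pose proof (CSer_shift _ A) as E. cbv beta in E.
  rewrite (CSer_ext (fun k => 1 * z ^ S k)%C (fun k => z * (1 * z ^ k))%C) in E by (intros; simpl; ring).
  rewrite (CSer_scal z _ A) in E. fold (CPS (fun _ => RtoC 1) z) in E.
  set (X := CPS (fun _ => RtoC 1) z) in *. simpl in E.
  replace (X * (1 - z))%C with (X - z * X)%C by ring. rewrite E at 1. ring.
Qed.

Lemma Cexp_log (z : C) : Cmod z < 1 -> (Cexp (CPS logcoef z) * (1 - z))%C = RtoC 1.
Proof.
  intros Hz.
  replace (1 - z)%C with (1 + (-(1)) * z)%C by ring.
  rewrite (cderive_zero_const (fun w => Cexp (CPS logcoef w) * (1 + (-(1)) * w))%C 1 z).
  - rewrite CPS_0. simpl. rewrite Cexp_0. ring.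
  - intros w Hw. eapply cderive_eq.
    + apply cderive_mult.
      * apply cderive_Cexp_comp, CPS_derive with 1; [apply conv_logcoef|exact Hw].
      * apply cderive_plus; [apply cderive_const|]. apply cderive_mult; [apply cderive_const|apply cderive_id].
    + replace (deriv_coef logcoef) with (fun _ : nat => RtoC 1).
      * pose proof (CPS_geom w Hw) as G. set (X := CPS (fun _ => RtoC 1) w) in *.
        set (Y := Cexp (CPS logcoef w)).
        replace (X * Y * (1 + - (1) * w) + Y * (0 + (0 * w + - (1) * 1)))%C with (Y * (X * (1 - w) - 1))%C by ring.
        rewrite G. ring.
      * apply functional_extensionality; intros k. unfold deriv_coef, logcoef.
        rewrite <- RtoC_mult. f_equal. field. apply not_0_INR; lia.
  - exact Hz.
Qed.

(* Taylor expansion at [s0] of the generalized Dirichlet series [sum_n alpha n * exp (- s * lam n)]. *)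
Definition dterm (alpha : nat -> C) (lam : nat -> R) (s0 : C) (j n : nat) : C :=
  (alpha n * Cexp (- s0 * lam n) * (expcoef j * (- lam n) ^ j))%C.

Definition dcoef alpha lam s0 (j : nat) : C := CSer (dterm alpha lam s0 j).

Section DirichletTaylor.

Variables (alpha : nat -> C) (lam : nat -> R) (s0 : C) (r : R).
Hypothesis Hlam : forall n, 0 <= lam n.
Hypothesis Hr : 0 <= r.
Hypothesis Hsum : ex_series (fun n => Cmod (alpha n) * exp (- lam n * (Re s0 - r))).

Lemma Cmod_dterm j n :
  Cmod (dterm alpha lam s0 j n) =
  Cmod (alpha n) * exp (- lam n * Re s0) * (/ INR (Factorial.fact j) * lam n ^ j).
Proof.
  unfold dterm. rewrite !Cmod_mult, Cmod_Cexp, Cmod_expcoef, Cmod_pow, Cmod_opp, Cmod_R.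
  rewrite (Rabs_pos_eq (lam n)) by apply Hlam.
  rewrite re_scal_r. change (Re (- s0)%C) with (- Re s0).
  now replace (- Re s0 * lam n) with (- lam n * Re s0) by ring.
Qed.

(** Summing over the degree gives the exponential series of [lam n * r], which moves the abscissa
    left by [r]. Hence [Hsum], taken at [Re s0 - r], is exactly what the interchange of sums
    requires. *)
Lemma dterm_row n :
  is_series (fun j => Cmod (dterm alpha lam s0 j n) * r ^ j) (Cmod (alpha n) * exp (- lam n * (Re s0 - r))).
Proof.
  replace (Cmod (alpha n) * exp (- lam n * (Re s0 - r)))
    with ((Cmod (alpha n) * exp (- lam n * Re s0)) * exp (lam n * r)).
  2:{ rewrite Rmult_assoc, <- exp_plus. do 2 f_equal. ring. }
  apply is_series_ext with
    (fun j => scal (Cmod (alpha n) * exp (- lam n * Re s0)) (/ INR (Factorial.fact j) * (lam n * r) ^ j)).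
  - intros j. rewrite Cmod_dterm, Rpow_mult_distr. unfold scal; simpl; unfold mult; simpl. ring.
  - apply (is_series_scal_l (K := R_AbsRing) (V := R_NormedModule)), exp_series.
Qed.

Lemma dterm_fubini :
  (forall j, ex_series (fun n => Cmod (dterm alpha lam s0 j n) * r ^ j)) /\
  ex_series (fun j => Series (fun n => Cmod (dterm alpha lam s0 j n) * r ^ j)).
Proof.
  destruct (fubini_nonneg (fun n j => Cmod (dterm alpha lam s0 j n) * r ^ j)) as (F1 & F2 & _).
  - intros. apply Rmult_le_pos; [apply Cmod_ge_0|now apply pow_le].
  - intros n. eexists. apply dterm_row.
  - apply ex_series_extR with (fun n => Cmod (alpha n) * exp (- lam n * (Re s0 - r))); [|exact Hsum].
    intros n. symmetry. apply is_series_unique, dterm_row.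
  - split; assumption.
Qed.

Lemma dcoef_conv : 0 < r -> ex_series (fun j => Cmod (dcoef alpha lam s0 j) * r ^ j).
Proof.
  intros Hr'. destruct dterm_fubini as [F1 F2].
  apply ex_series_comp with (fun j => Series (fun n => Cmod (dterm alpha lam s0 j n) * r ^ j)); [|exact F2].
  intros j. assert (P : 0 < r ^ j) by now apply pow_lt.
  split; [apply Rmult_le_pos; [apply Cmod_ge_0|lra]|].
  rewrite Series_scal_r. apply Rmult_le_compat_r; [lra|]. apply CSer_norm.
  unfold asum. apply ex_series_extR with (fun n => / r ^ j * (Cmod (dterm alpha lam s0 j n) * r ^ j)).
  - intros n. field. lra.
  - exact (ex_series_scal_l _ _ (F1 j)).
Qed.

Lemma dterm_asum j : 0 < r -> asum (dterm alpha lam s0 j).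
Proof.
  intros Hr'. destruct dterm_fubini as [F1 _]. assert (P : 0 < r ^ j) by now apply pow_lt.
  unfold asum. apply ex_series_extR with (fun n => / r ^ j * (Cmod (dterm alpha lam s0 j n) * r ^ j)).
  - intros n. field. lra.
  - exact (ex_series_scal_l _ _ (F1 j)).
Qed.

Lemma dirichlet_asum (w : C) : Cmod w <= r -> asum (fun n => alpha n * Cexp (- (s0 + w) * lam n))%C.
Proof.
  intros Hw. apply asum_le with (fun n => Cmod (alpha n) * exp (- lam n * (Re s0 - r))); [|exact Hsum].
  intros n. rewrite Cmod_mult, Cmod_Cexp. apply Rmult_le_compat_l; [apply Cmod_ge_0|].
  assert (E : Re (- (s0 + w) * lam n)%C <= - lam n * (Re s0 - r)).
  { rewrite re_scal_r. change (Re (- (s0 + w))%C) with (- (Re s0 + Re w)).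
    specialize (Hlam n). pose proof (re_le_Cmod w) as B. apply Rabs_le_between in B. nra. }
  destruct E as [E|E]; [left; now apply exp_increasing|rewrite E; lra].
Qed.

Lemma dirichlet_taylor (w : C) : 0 < r -> Cmod w <= r ->
  CPS (dcoef alpha lam s0) w = CSer (fun n => alpha n * Cexp (- (s0 + w) * lam n))%C.
Proof.
  intros Hr' Hw.
  destruct (fubini_C (fun n j => dterm alpha lam s0 j n * w ^ j)%C) as (F1 & F2 & F3).
  - intros n. apply asum_le with (fun j => Cmod (dterm alpha lam s0 j n) * r ^ j).
    + intros j. rewrite Cmod_mult, Cmod_pow. apply Rmult_le_compat_l; [apply Cmod_ge_0|].
      apply pow_incr; split; [apply Cmod_ge_0|exact Hw].
    + eexists; apply dterm_row.
  - apply ex_series_comp with (fun n => Cmod (alpha n) * exp (- lam n * (Re s0 - r))); [|exact Hsum].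
    intros n. assert (Hrow : ex_series (fun j => Cmod (dterm alpha lam s0 j n) * r ^ j)) by (eexists; apply dterm_row).
    assert (Hle : forall j, Cmod (dterm alpha lam s0 j n * w ^ j) <= Cmod (dterm alpha lam s0 j n) * r ^ j).
    { intros j. rewrite Cmod_mult, Cmod_pow. apply Rmult_le_compat_l; [apply Cmod_ge_0|].
      apply pow_incr; split; [apply Cmod_ge_0|exact Hw]. }
    split.
    + apply Series_nonneg; [intros; apply Cmod_ge_0|].
      apply ex_series_comp with (fun j => Cmod (dterm alpha lam s0 j n) * r ^ j); [|exact Hrow].
      intros j; split; [apply Cmod_ge_0|apply Hle].
    + rewrite <- (is_series_unique _ _ (dterm_row n)). apply Series_le; [|exact Hrow].
      intros j; split; [apply Cmod_ge_0|apply Hle].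
  - transitivity (CSer (fun j => CSer (fun n => dterm alpha lam s0 j n * w ^ j)%C)).
    + unfold CPS. apply CSer_ext. intros j. unfold dcoef. rewrite Cmult_comm.
      rewrite <- CSer_scal by now apply dterm_asum. apply CSer_ext. intros n. ring.
    + rewrite F3. apply CSer_ext. intros n.
      transitivity (CSer (fun j => (alpha n * Cexp (- s0 * lam n)) * (expcoef j * (- lam n * w) ^ j))%C).
      * apply CSer_ext. intros j. unfold dterm. rewrite Cpow_mult_l. ring.
      * rewrite CSer_scal.
        -- fold (CPS expcoef (- lam n * w)). rewrite <- Cexp_CPS, <- Cmult_assoc, <- Cexp_plus. do 2 f_equal. ring.
        -- apply conv_asum with (Cmod (- lam n * w) + 1); [apply conv_expcoef|lra].
Qed.

End DirichletTaylor.

(** * Double series listed by Cantor's pairing *)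

Lemma is_series_single (j : nat) (x : R) : is_series (fun i => if Nat.eqb i j then x else 0) x.
Proof.
  apply is_series_rsum.
  assert (Z : forall f m, (forall k, (k < m)%nat -> f k = 0) -> rsum f m = 0).
  { intros f m. induction m as [|m IH]; intros Hf; simpl; [reflexivity|].
    rewrite IH by (intros; apply Hf; lia). rewrite Hf by lia. ring. }
  apply is_lim_seq_incr_n with (S j).
  apply is_lim_seq_ext with (fun _ => x); [|apply is_lim_seq_const].
  assert (E : forall n, rsum (fun i => if Nat.eqb i j then x else 0) (n + S j) = x); [|intros n; now rewrite E].
  intros n. induction n as [|n IH].
  - cbn [rsum Nat.add]. rewrite Nat.eqb_refl, Z; [ring|]. intros k Hk. destruct (Nat.eqb_spec k j); [lia|reflexivity].
  - change (S n + S j)%nat with (S (n + S j)). cbn [rsum]. destruct (Nat.eqb_spec (n + S j) j); [lia|]. rewrite IH. ring.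
Qed.

Lemma asum_single (j : nat) (x : C) :
  asum (fun i => if Nat.eqb i j then x else RtoC 0) /\
  Series (fun i => Cmod (if Nat.eqb i j then x else RtoC 0)) = Cmod x /\
  CSer (fun i => if Nat.eqb i j then x else RtoC 0) = x.
Proof.
  assert (E : forall (f : C -> R), f (RtoC 0) = 0 ->
    is_series (fun i => f (if Nat.eqb i j then x else RtoC 0)) (f x)).
  { intros f Hf. apply is_series_ext with (fun i => if Nat.eqb i j then f x else 0); [|apply is_series_single].
    intros i. destruct (Nat.eqb i j); congruence. }
  split; [eexists; apply (E Cmod), Cmod_0|]. split; [apply is_series_unique, (E Cmod), Cmod_0|].
  unfold CSer. apply C_ext; simpl; apply is_series_unique; [apply (E Re)|apply (E Im)]; reflexivity.
Qed.

(** The array [B] distributes the listed series over the first component of the pair, and [A]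
    distributes each row of [B] over the second. Every column has a single possibly nonzero entry,
    so the rearrangement is two applications of Fubini. *)
Lemma flatten_C (b : nat -> nat -> C) :
  (forall p, asum (b p)) -> ex_series (fun p => Series (fun k => Cmod (b p k))) ->
  asum (fun i => b (fst (Cantor.of_nat i)) (snd (Cantor.of_nat i))) /\
  CSer (fun i => b (fst (Cantor.of_nat i)) (snd (Cantor.of_nat i))) = CSer (fun p => CSer (b p)).
Proof.
  intros H1 H2.
  set (g := fun i => b (fst (Cantor.of_nat i)) (snd (Cantor.of_nat i))).
  set (B := fun p i => if Nat.eqb p (fst (Cantor.of_nat i)) then g i else RtoC 0).
  assert (SB : forall p, asum (B p) /\ Series (fun i => Cmod (B p i)) = Series (fun k => Cmod (b p k)) /\
     CSer (B p) = CSer (b p)).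
  { intros p.
    set (A := fun k i => if Nat.eqb i (Cantor.to_nat (p, k)) then b p k else RtoC 0).
    assert (EA : forall k i, A k i = if Nat.eqb k (snd (Cantor.of_nat i)) then B p i else RtoC 0).
    { intros k i. unfold A, B, g.
      destruct (Cantor.of_nat i) as [p' k'] eqn:E.
      assert (Ei : i = Cantor.to_nat (p', k')) by (rewrite <- E; symmetry; apply Cantor.cancel_to_of).
      cbn [fst snd]. destruct (Nat.eqb_spec p p') as [->|Hp]; destruct (Nat.eqb_spec k k') as [->|Hk].
      - now rewrite Ei, Nat.eqb_refl.
      - destruct (Nat.eqb_spec i (Cantor.to_nat (p', k))) as [Hi|]; [|reflexivity].
        rewrite Hi, Cantor.cancel_of_to in E. congruence.
      - destruct (Nat.eqb_spec i (Cantor.to_nat (p, k'))) as [Hi|]; [|reflexivity].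
        rewrite Hi, Cantor.cancel_of_to in E. congruence.
      - destruct (Nat.eqb_spec i (Cantor.to_nat (p, k))) as [Hi|]; [|reflexivity].
        rewrite Hi, Cantor.cancel_of_to in E. congruence. }
    assert (R1 : forall k, asum (A k)) by (intros k; apply asum_single).
    assert (R2 : forall k, Series (fun i => Cmod (A k i)) = Cmod (b p k)) by (intros k; apply asum_single).
    assert (R3 : forall k, CSer (A k) = b p k) by (intros k; apply asum_single).
    assert (C2 : forall i, Series (fun k => Cmod (A k i)) = Cmod (B p i)).
    { intros i. rewrite <- (proj1 (proj2 (asum_single (snd (Cantor.of_nat i)) (B p i)))).
      apply Series_ext. intros k. now rewrite EA. }
    assert (C3 : forall i, CSer (fun k => A k i) = B p i).
    { intros i. rewrite <- (proj2 (proj2 (asum_single (snd (Cantor.of_nat i)) (B p i)))).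
      apply CSer_ext. intros k. now rewrite EA. }
    assert (X : ex_series (fun k => Series (fun i => Cmod (A k i)))).
    { apply ex_series_extR with (fun k => Cmod (b p k)); [intros; now rewrite R2|apply H1]. }
    destruct (fubini_C A R1 X) as (_ & F2 & F3).
    split; [|split].
    - unfold asum. exact (ex_series_ext _ _ C2 F2).
    - rewrite <- (Series_ext _ _ C2).
      rewrite (fubini_nonneg_eq (fun k i => Cmod (A k i)) (fun k i => Cmod_ge_0 _) R1 X).
      apply Series_ext, R2.
    - rewrite <- (CSer_ext _ _ C3), F3. apply CSer_ext, R3. }
  assert (X : ex_series (fun p => Series (fun i => Cmod (B p i)))).
  { apply ex_series_extR with (fun p => Series (fun k => Cmod (b p k))); [|exact H2].
    intros p. symmetry. apply SB. }
  destruct (fubini_C B (fun p => proj1 (SB p)) X) as (_ & F2 & F3).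
  assert (D : forall i, asum (fun p => B p i) /\ Series (fun p => Cmod (B p i)) = Cmod (g i) /\ CSer (fun p => B p i) = g i).
  { intros i. apply asum_single. }
  split.
  - unfold asum. apply (ex_series_ext _ _ (fun i => proj1 (proj2 (D i))) F2).
  - rewrite <- (CSer_ext _ _ (fun i => proj2 (proj2 (D i)))), F3.
    apply CSer_ext. intros p. apply SB.
Qed.

(** * Goursat's theorem *)


(** The integral of [P dx + Q dy], counterclockwise around the rectangle with lower left corner
    [(x, y)]. *)
Definition bdry (P Q : R -> R -> R) (x y w h : R) : R :=
  RInt (fun t => P t y) x (x + w) - RInt (fun t => P t (y + h)) x (x + w)
  + RInt (fun t => Q (x + w) t) y (y + h) - RInt (fun t => Q x t) y (y + h).

(** Total differentiability at one point. Continuity of the partial derivatives is not part of it,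
    so the closed-form theorem below has to proceed by bisection. *)
Definition diff2 (P : R -> R -> R) (x y px py : R) : Prop :=
  forall eps, 0 < eps -> exists delta, 0 < delta /\
    forall x' y', Rabs (x' - x) < delta -> Rabs (y' - y) < delta ->
      Rabs (P x' y' - P x y - px * (x' - x) - py * (y' - y)) <= eps * (Rabs (x' - x) + Rabs (y' - y)).

Lemma diff2_bound P x y px py : diff2 P x y px py ->
  exists delta, 0 < delta /\ forall x' y', Rabs (x' - x) < delta -> Rabs (y' - y) < delta ->
    Rabs (P x' y' - P x y) <= (1 + Rabs px + Rabs py) * (Rabs (x' - x) + Rabs (y' - y)).
Proof.
  intros H. destruct (H 1 Rlt_0_1) as (d & Hd & K). exists d; split; [exact Hd|].
  intros x' y' H1 H2. specialize (K x' y' H1 H2).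
  replace (P x' y' - P x y) with
    ((P x' y' - P x y - px * (x' - x) - py * (y' - y)) + (px * (x' - x) + py * (y' - y))) by ring.
  eapply Rle_trans; [apply Rabs_triang|].
  pose proof (Rabs_triang (px * (x' - x)) (py * (y' - y))) as T. rewrite !Rabs_mult in T.
  pose proof (Rabs_pos px). pose proof (Rabs_pos py).
  pose proof (Rabs_pos (x' - x)). pose proof (Rabs_pos (y' - y)). nra.
Qed.

Lemma continuous_of_bound (f : R -> R) (x M d : R) : 0 < d -> 0 < M ->
  (forall t, Rabs (t - x) < d -> Rabs (f t - f x) <= M * Rabs (t - x)) -> continuous f x.
Proof.
  intros Hd HM H. apply continuity_pt_filterlim. intros eps Heps.
  exists (Rmin d (eps / M)). split.
  - apply Rmin_glb_lt; [exact Hd|now apply Rdiv_lt_0_compat].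
  - intros t [_ Ht]. simpl in Ht. unfold R_dist in *. simpl. unfold R_dist.
    assert (h1 : Rabs (t - x) < d) by (eapply Rlt_le_trans; [exact Ht|apply Rmin_l]).
    assert (h2 : Rabs (t - x) < eps / M) by (eapply Rlt_le_trans; [exact Ht|apply Rmin_r]).
    eapply Rle_lt_trans; [now apply H|].
    apply Rmult_lt_compat_l with (r := M) in h2; [|exact HM].
    replace (M * (eps / M)) with eps in h2 by (field; lra). exact h2.
Qed.

Lemma diff2_cont_x P x y px py : diff2 P x y px py -> continuous (fun t => P t y) x.
Proof.
  intros H. destruct (diff2_bound _ _ _ _ _ H) as (d & Hd & K).
  apply (continuous_of_bound _ _ (1 + Rabs px + Rabs py) d Hd).
  - pose proof (Rabs_pos px); pose proof (Rabs_pos py); lra.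
  - intros t Ht. specialize (K t y Ht). rewrite Rminus_diag, Rabs_R0, Rplus_0_r in K. now apply K.
Qed.

Lemma diff2_cont_y P x y px py : diff2 P x y px py -> continuous (fun t => P x t) y.
Proof.
  intros H. destruct (diff2_bound _ _ _ _ _ H) as (d & Hd & K).
  apply (continuous_of_bound _ _ (1 + Rabs px + Rabs py) d Hd).
  - pose proof (Rabs_pos px); pose proof (Rabs_pos py); lra.
  - intros t Ht. specialize (K x t). rewrite Rminus_diag, Rabs_R0, Rplus_0_l in K. now apply K.
Qed.

Lemma RInt_minus_R (f g : R -> R) (a b : R) : ex_RInt f a b -> ex_RInt g a b ->
  RInt (fun t => f t - g t) a b = RInt f a b - RInt g a b.
Proof. exact (RInt_minus (V := R_CompleteNormedModule) f g a b). Qed.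

Lemma RInt_near_const (f : R -> R) (a b c m : R) : a <= b -> ex_RInt f a b ->
  (forall t, a <= t <= b -> Rabs (f t - c) <= m) -> Rabs (RInt f a b - c * (b - a)) <= m * (b - a).
Proof.
  intros Hab Hex H.
  assert (E : RInt f a b - c * (b - a) = RInt (fun t => f t - c) a b).
  { rewrite (RInt_minus_R f (fun _ => c)); [|exact Hex|apply ex_RInt_const].
    rewrite RInt_const. unfold scal; simpl. unfold mult; simpl. ring. }
  rewrite E. rewrite (Rmult_comm m).
  apply (abs_RInt_le_const (fun t => f t - c)); [exact Hab| |exact H].
  apply (ex_RInt_minus (V := R_NormedModule) f (fun _ => c)); [exact Hex|apply ex_RInt_const].
Qed.

Section Goursat.

Variables (P Q : R -> R -> R) (a b W H : R).
Hypothesis HW : 0 <= W.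
Hypothesis HH : 0 <= H.
Hypothesis HPQ : forall x y, a <= x <= a + W -> b <= y <= b + H ->
  exists px py qy, diff2 P x y px py /\ diff2 Q x y py qy.

Let inrect x y w h := 0 <= w /\ 0 <= h /\ a <= x /\ x + w <= a + W /\ b <= y /\ y + h <= b + H.

Lemma exP x1 x2 y : a <= x1 <= a + W -> a <= x2 <= a + W -> b <= y <= b + H ->
  ex_RInt (fun t => P t y) x1 x2.
Proof.
  intros H1 H2 H3. apply (ex_RInt_continuous (V := R_CompleteNormedModule)). intros z Hz.
  assert (Hz' : a <= z <= a + W).
  { revert Hz. unfold Rmin, Rmax. destruct (Rle_dec x1 x2); lra. }
  destruct (HPQ z y Hz' H3) as (px & py & qy & D & _). exact (diff2_cont_x _ _ _ _ _ D).
Qed.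

Lemma exQ y1 y2 x : b <= y1 <= b + H -> b <= y2 <= b + H -> a <= x <= a + W ->
  ex_RInt (fun t => Q x t) y1 y2.
Proof.
  intros H1 H2 H3. apply (ex_RInt_continuous (V := R_CompleteNormedModule)). intros z Hz.
  assert (Hz' : b <= z <= b + H).
  { revert Hz. unfold Rmin, Rmax. destruct (Rle_dec y1 y2); lra. }
  destruct (HPQ x z H3 Hz') as (px & py & qy & _ & D). exact (diff2_cont_y _ _ _ _ _ D).
Qed.

Lemma bdry_split x y w h : inrect x y w h ->
  bdry P Q x y w h = bdry P Q x y (w / 2) (h / 2) + bdry P Q (x + w / 2) y (w / 2) (h / 2)
   + bdry P Q x (y + h / 2) (w / 2) (h / 2) + bdry P Q (x + w / 2) (y + h / 2) (w / 2) (h / 2).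
Proof.
  intros (h1 & h2 & h3 & h4 & h5 & h6). unfold bdry.
  replace (x + w / 2 + w / 2) with (x + w) by field.
  replace (y + h / 2 + h / 2) with (y + h) by field.
  assert (EP : forall z, b <= z <= b + H ->
    RInt (fun t => P t z) x (x + w) = RInt (fun t => P t z) x (x + w / 2) + RInt (fun t => P t z) (x + w / 2) (x + w)).
  { intros z Hz. symmetry. apply (RInt_Chasles (V := R_CompleteNormedModule)); apply exP; lra. }
  assert (EQ : forall z, a <= z <= a + W ->
    RInt (fun t => Q z t) y (y + h) = RInt (fun t => Q z t) y (y + h / 2) + RInt (fun t => Q z t) (y + h / 2) (y + h)).
  { intros z Hz. symmetry. apply (RInt_Chasles (V := R_CompleteNormedModule)); apply exQ; lra. }
  rewrite (EP y), (EP (y + h)), (EQ x), (EQ (x + w)) by lra. ring.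
Qed.

(** The affine approximations contribute [- py * h * w + py * w * h = 0]. This is where closedness
    enters: [py] is at once the [y]-derivative of [P] and the [x]-derivative of [Q]. *)
Lemma bdry_small x y w h u v px py qy eta : inrect x y w h ->
  (forall x' y', x <= x' <= x + w -> y <= y' <= y + h ->
     Rabs (P x' y' - P u v - px * (x' - u) - py * (y' - v)) <= eta /\
     Rabs (Q x' y' - Q u v - py * (x' - u) - qy * (y' - v)) <= eta) ->
  Rabs (bdry P Q x y w h) <= 2 * eta * (w + h).
Proof.
  intros (h1 & h2 & h3 & h4 & h5 & h6) K. unfold bdry.
  assert (E1 : Rabs (RInt (fun t => P t y - P t (y + h)) x (x + w) - (- py * h) * (x + w - x)) <= 2 * eta * (x + w - x)).
  { apply RInt_near_const; [lra| |].
    - apply (ex_RInt_minus (V := R_NormedModule) (fun t => P t y) (fun t => P t (y + h))); apply exP; lra.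
    - intros t Ht.
      destruct (K t y Ht ltac:(lra)) as [K1 _]. destruct (K t (y + h) Ht ltac:(lra)) as [K2 _].
      apply Rabs_le_between in K1. apply Rabs_le_between in K2. apply Rabs_le_between. nra. }
  assert (E2 : Rabs (RInt (fun t => Q (x + w) t - Q x t) y (y + h) - (py * w) * (y + h - y)) <= 2 * eta * (y + h - y)).
  { apply RInt_near_const; [lra| |].
    - apply (ex_RInt_minus (V := R_NormedModule) (fun t => Q (x + w) t) (fun t => Q x t)); apply exQ; lra.
    - intros t Ht.
      destruct (K (x + w) t ltac:(lra) Ht) as [_ K1]. destruct (K x t ltac:(lra) Ht) as [_ K2].
      apply Rabs_le_between in K1. apply Rabs_le_between in K2. apply Rabs_le_between. nra. }
  rewrite (RInt_minus_R (fun t => P t y) (fun t => P t (y + h))) in E1 by (apply exP; lra).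
  rewrite (RInt_minus_R (fun t => Q (x + w) t) (fun t => Q x t)) in E2 by (apply exQ; lra).
  apply Rabs_le_between in E1. apply Rabs_le_between in E2. apply Rabs_le_between. nra.
Qed.

Let quarter (x y w h : R) : R * R :=
  let A := Rabs (bdry P Q x y w h) / 4 in
  if Rle_dec A (Rabs (bdry P Q x y (w / 2) (h / 2))) then (x, y)
  else if Rle_dec A (Rabs (bdry P Q (x + w / 2) y (w / 2) (h / 2))) then (x + w / 2, y)
  else if Rle_dec A (Rabs (bdry P Q x (y + h / 2) (w / 2) (h / 2))) then (x, y + h / 2)
  else (x + w / 2, y + h / 2).

Lemma quarter_spec x y w h : inrect x y w h ->
  let p := quarter x y w h in
  x <= fst p <= x + w / 2 /\ y <= snd p <= y + h / 2 /\
  Rabs (bdry P Q x y w h) / 4 <= Rabs (bdry P Q (fst p) (snd p) (w / 2) (h / 2)).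
Proof.
  intros Hr. pose proof (bdry_split x y w h Hr) as E. destruct Hr as (h1 & h2 & _).
  unfold quarter.
  destruct Rle_dec as [d|d]; simpl; [lra|].
  destruct Rle_dec as [d'|d']; simpl; [lra|].
  destruct Rle_dec as [d''|d'']; simpl; [lra|].
  split; [lra|split; [lra|]].
  apply Rnot_le_lt in d, d', d''.
  set (A1 := bdry P Q x y (w / 2) (h / 2)) in *.
  set (A2 := bdry P Q (x + w / 2) y (w / 2) (h / 2)) in *.
  set (A3 := bdry P Q x (y + h / 2) (w / 2) (h / 2)) in *.
  set (A4 := bdry P Q (x + w / 2) (y + h / 2) (w / 2) (h / 2)) in *.
  pose proof (Rabs_triang (A1 + A2 + A3) A4) as T1.
  pose proof (Rabs_triang (A1 + A2) A3) as T2. pose proof (Rabs_triang A1 A2) as T3.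
  rewrite <- E in T1. lra.
Qed.

Let corner : nat -> R * R :=
  fix corner n := match n with
  | O => (a, b)
  | S m => quarter (fst (corner m)) (snd (corner m)) (W / 2 ^ m) (H / 2 ^ m)
  end.

Lemma half_pow (z : R) m : z / 2 ^ m / 2 = z / 2 ^ S m.
Proof. simpl. field. apply pow_nonzero; lra. Qed.

Lemma div_pow2_nonneg (z : R) m : 0 <= z -> 0 <= z / 2 ^ m.
Proof. intros. apply Rmult_le_pos; [assumption|]. apply Rlt_le, Rinv_0_lt_compat, pow_lt. lra. Qed.

Lemma corner_spec n :
  inrect (fst (corner n)) (snd (corner n)) (W / 2 ^ n) (H / 2 ^ n) /\
  Rabs (bdry P Q a b W H) / 4 ^ n <= Rabs (bdry P Q (fst (corner n)) (snd (corner n)) (W / 2 ^ n) (H / 2 ^ n)).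
Proof.
  induction n as [|n [I1 I2]].
  - simpl. rewrite !Rdiv_1_r. split; [unfold inrect; lra|lra].
  - pose proof (quarter_spec _ _ _ _ I1) as (q1 & q2 & q3).
    change (corner (S n)) with (quarter (fst (corner n)) (snd (corner n)) (W / 2 ^ n) (H / 2 ^ n)).
    rewrite !half_pow in q3.
    pose proof (half_pow W n) as eW. pose proof (half_pow H n) as eH.
    destruct I1 as (i1 & i2 & i3 & i4 & i5 & i6).
    set (p := quarter (fst (corner n)) (snd (corner n)) (W / 2 ^ n) (H / 2 ^ n)) in *.
    pose proof (div_pow2_nonneg W (S n) HW). pose proof (div_pow2_nonneg H (S n) HH).
    split.
    + unfold inrect. repeat split; lra.
    + eapply Rle_trans; [|exact q3].
      replace (Rabs (bdry P Q a b W H) / 4 ^ S n) with (Rabs (bdry P Q a b W H) / 4 ^ n / 4); [lra|].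
      simpl. field. apply pow_nonzero; lra.
Qed.

Lemma lim_div_pow2 (z : R) : is_lim_seq (fun n => z / 2 ^ n) 0.
Proof.
  apply is_lim_seq_ext with (fun n => z * (/ 2) ^ n).
  - intros n. unfold Rdiv. now rewrite pow_inv.
  - replace (Finite 0) with (Rbar_mult z 0) by (simpl; f_equal; ring).
    apply is_lim_seq_scal_l. apply is_lim_seq_geom. rewrite Rabs_pos_eq; lra.
Qed.

Lemma nested_point (u : nat -> R) (z M : R) : (forall n, u n <= M) ->
  (forall n, u n <= u (S n) <= u n + z / 2 ^ n / 2) ->
  exists l, forall n, u n <= l <= u n + z / 2 ^ n.
Proof.
  intros HM Hu.
  destruct (ex_finite_lim_seq_incr u M) as [l Hl]; [intros; apply Hu|exact HM|].
  exists l. intros n; split.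
  - apply (is_lim_seq_incr_compare u l Hl). intros; apply Hu.
  - apply (is_lim_seq_decr_compare (fun k => u k + z / 2 ^ k) l).
    + replace (Finite l) with (Finite (l + 0)) by (f_equal; ring).
      apply is_lim_seq_plus'; [exact Hl|apply lim_div_pow2].
    + intros k. specialize (Hu k). rewrite <- half_pow. lra.
Qed.

(** Repeated quartering keeps a rectangle carrying at least the fraction [/ 4 ^ n] of the integral.
    Differentiability at the common point of these rectangles makes their integrals [o(4 ^ - n)]. *)
Theorem goursat : bdry P Q a b W H = 0.
Proof.
  destruct (nested_point (fun n => fst (corner n)) W (a + W)) as [x Hx].
  { intros n. destruct (corner_spec n) as [(i1 & i2 & i3 & i4 & i5 & i6) _]. lra. }
  { intros n. exact (proj1 (quarter_spec _ _ _ _ (proj1 (corner_spec n)))). }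
  destruct (nested_point (fun n => snd (corner n)) H (b + H)) as [y Hy].
  { intros n. destruct (corner_spec n) as [(i1 & i2 & i3 & i4 & i5 & i6) _]. lra. }
  { intros n. exact (proj1 (proj2 (quarter_spec _ _ _ _ (proj1 (corner_spec n))))). }
  destruct (HPQ x y) as (px & py & qy & DP & DQ).
  { specialize (Hx O). simpl in Hx. lra. }
  { specialize (Hy O). simpl in Hy. lra. }
  apply NNPP. intros Hne. apply Rabs_pos_lt in Hne.
  set (J := Rabs (bdry P Q a b W H)) in *.
  (* Chosen so that [J = 2 * eps * S2] contradicts the bound [J <= 2 * eps * (W + H) ^ 2] extracted
     from [F]; the summand 1 covers a degenerate rectangle. *)
  set (S2 := 2 * (W + H) * (W + H) + 1). assert (HS : 0 < S2) by (unfold S2; nra).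
  set (eps := J / (2 * S2)). assert (Heps : 0 < eps) by (apply Rdiv_lt_0_compat; lra).
  destruct (DP eps Heps) as (d1 & Hd1 & K1). destruct (DQ eps Heps) as (d2 & Hd2 & K2).
  set (d := Rmin d1 d2). assert (Hd : 0 < d) by now apply Rmin_glb_lt.
  pose proof (lim_div_pow2 (W + H)) as Hlim.
  apply is_lim_seq_spec in Hlim. destruct (Hlim (mkposreal d Hd)) as [n Hn].
  specialize (Hn n (le_n n)). simpl in Hn. rewrite Rminus_0_r in Hn.
  assert (Psum : 0 <= (W + H) / 2 ^ n) by (apply div_pow2_nonneg; lra).
  rewrite Rabs_pos_eq in Hn by exact Psum.
  destruct (corner_spec n) as [I1 I2]. specialize (Hx n). specialize (Hy n). fold J in I2.
  set (w := W / 2 ^ n) in *. set (h := H / 2 ^ n) in *.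
  assert (Ewh : (W + H) / 2 ^ n = w + h) by (unfold w, h; field; apply pow_nonzero; lra).
  rewrite Ewh in *.
  pose proof (div_pow2_nonneg W n HW) as Pw. fold w in Pw.
  pose proof (div_pow2_nonneg H n HH) as Ph. fold h in Ph.
  assert (B : Rabs (bdry P Q (fst (corner n)) (snd (corner n)) w h) <= 2 * (eps * (w + h)) * (w + h)).
  { apply (bdry_small _ _ _ _ x y px py qy); [exact I1|]. intros x' y' Hx' Hy'.
    assert (Ax : Rabs (x' - x) <= w) by (apply Rabs_le; lra).
    assert (Ay : Rabs (y' - y) <= h) by (apply Rabs_le; lra).
    assert (dd1 : d <= d1) by apply Rmin_l. assert (dd2 : d <= d2) by apply Rmin_r.
    split.
    - eapply Rle_trans; [apply K1; lra|]. apply Rmult_le_compat_l; lra.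
    - eapply Rle_trans; [apply K2; lra|]. apply Rmult_le_compat_l; lra. }
  assert (F : J / 4 ^ n <= 2 * eps * ((W + H) * (W + H)) / 4 ^ n).
  { eapply Rle_trans; [exact I2|]. eapply Rle_trans; [exact B|]. right.
    rewrite <- Ewh. replace 4 with (2 * 2) by ring. rewrite Rpow_mult_distr. field. apply pow_nonzero; lra. }
  assert (P4 : 0 < 4 ^ n) by (apply pow_lt; lra).
  apply Rmult_le_compat_r with (r := 4 ^ n) in F; [|lra].
  unfold Rdiv in F. rewrite !Rmult_assoc, !Rinv_l, !Rmult_1_r in F by lra.
  assert (EJ : eps * (2 * S2) = J) by (unfold eps; field; lra).
  unfold S2 in EJ. nra.
Qed.

End Goursat.

(** * Circle integrals and the identity theorem *)


Definition circ (r t : R) : C := (r * cos t, r * sin t).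

Lemma Cmod_circ r t : 0 <= r -> Cmod (circ r t) = r.
Proof. apply Cmod_polar. Qed.

Lemma circ_Cexp r t : 0 < r -> circ r t = Cexp (ln r, t).
Proof. intros Hr. unfold circ, Cexp. simpl. now rewrite exp_ln. Qed.

Definition CInt (f : R -> C) : C :=
  (RInt (fun t => Re (f t)) (- PI) PI, RInt (fun t => Im (f t)) (- PI) PI).

Lemma Re_CInt f : Re (CInt f) = RInt (fun t => Re (f t)) (- PI) PI.
Proof. reflexivity. Qed.

Lemma Im_CInt f : Im (CInt f) = RInt (fun t => Im (f t)) (- PI) PI.
Proof. reflexivity. Qed.

Lemma cderive_diff2 (h : C -> C) (x y : R) (l : C) : cderive h (x, y) l ->
  diff2 (fun s t => Re (h (s, t))) x y (Re l) (- Im l) /\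
  diff2 (fun s t => Im (h (s, t))) x y (Im l) (Re l).
Proof.
  intros H.
  assert (G : forall eps, 0 < eps -> exists delta, 0 < delta /\ forall x' y',
     Rabs (x' - x) < delta -> Rabs (y' - y) < delta ->
     Cmod (h (x', y') - h (x, y) - ((x' - x)%R, (y' - y)%R) * l)%C <= eps * (Rabs (x' - x) + Rabs (y' - y))).
  { intros eps Heps. destruct (proj1 (cderive_eps _ _ _) H eps Heps) as (d & Hd & K).
    exists (d / 2). split; [lra|]. intros x' y' Hx Hy.
    pose proof (Cmod_le_sum (x' - x, y' - y)) as B. simpl in B.
    specialize (K (x' - x, y' - y) ltac:(lra)).
    replace ((x, y) + ((x' - x)%R, (y' - y)%R))%C with (x', y') in K by (apply C_ext; simpl; ring).
    eapply Rle_trans; [exact K|]. apply Rmult_le_compat_l; lra. }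
  split; intros eps Heps; destruct (G eps Heps) as (d & Hd & K); exists d; (split; [exact Hd|]);
    intros x' y' Hx Hy; specialize (K x' y' Hx Hy).
  - eapply Rle_trans; [|exact K]. eapply Rle_trans; [|apply re_le_Cmod].
    right. f_equal. simpl. unfold Re, Im. ring.
  - eapply Rle_trans; [|exact K]. eapply Rle_trans; [|apply im_le_Cmod].
    right. f_equal. simpl. unfold Re, Im. ring.
Qed.

Lemma diff2_opp P x y px py : diff2 P x y px py -> diff2 (fun s t => - P s t) x y (- px) (- py).
Proof.
  intros H eps Heps. destruct (H eps Heps) as (d & Hd & K). exists d; split; [exact Hd|].
  intros x' y' Hx Hy. rewrite <- Rabs_Ropp. eapply Rle_trans; [|exact (K x' y' Hx Hy)].
  right. f_equal. ring.
Qed.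

Lemma diff2_eq P x y px py px' py' : diff2 P x y px py -> px = px' -> py = py' -> diff2 P x y px' py'.
Proof. now intros H <- <-. Qed.

Lemma ex_cderive_Cexp_comp (E : C -> C) (z : C) :
  ex_cderive E (Cexp z) -> ex_cderive (fun w => E (Cexp w)) z.
Proof.
  intros [l Hl]. eexists. exact (cderive_comp E Cexp z l _ Hl (cderive_Cexp z)).
Qed.

Lemma circ_continuous (E : C -> C) (r t : R) : 0 < r -> ex_cderive E (circ r t) ->
  continuous (fun s => Re (E (circ r s))) t /\ continuous (fun s => Im (E (circ r s))) t.
Proof.
  intros Hr H. rewrite circ_Cexp in H by exact Hr.
  destruct (ex_cderive_Cexp_comp E _ H) as [l Hl].
  destruct (cderive_diff2 _ _ _ _ Hl) as [D1 D2].
  apply diff2_cont_y in D1. apply diff2_cont_y in D2.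
  split; [eapply continuous_ext; [|exact D1]|eapply continuous_ext; [|exact D2]];
    intros s; simpl; now rewrite circ_Cexp.
Qed.

(** Composition with [Cexp] turns the annulus into a rectangle of height [2 * PI], whose horizontal
    sides cancel by periodicity. For [h = u + i v], the two closed forms are the imaginary part and
    minus the real part of [h dz]. Nothing is asked of [E] inside the smaller circle, so negative
    powers of the variable may occur. *)
Lemma circle_integral_const_le (E : C -> C) (r1 r2 : R) : 0 < r1 <= r2 ->
  (forall w, r1 <= Cmod w <= r2 -> ex_cderive E w) ->
  CInt (fun t => E (circ r2 t)) = CInt (fun t => E (circ r1 t)).
Proof.
  intros Hr HE. pose proof PI_RGT_0 as Hpi.
  set (h := fun z => E (Cexp z)).
  set (u := fun s t : R => Re (h (s, t))). set (v := fun s t : R => Im (h (s, t))).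
  set (W := ln r2 - ln r1).
  assert (HW : 0 <= W).
  { unfold W. destruct (proj2 Hr) as [L|L]; [apply ln_increasing in L; lra|rewrite L; lra]. }
  assert (HD : forall x y, ln r1 <= x <= ln r1 + W -> exists l, cderive h (x, y) l).
  { intros x y Hx. apply (ex_cderive_Cexp_comp E (x, y)), HE. rewrite Cmod_Cexp. simpl.
    assert (M : forall a b, a <= b -> exp a <= exp b).
    { intros a b [L|L]; [left; now apply exp_increasing|rewrite L; lra]. }
    unfold W in Hx. split.
    - apply Rle_trans with (exp (ln r1)); [rewrite exp_ln; lra|apply M; lra].
    - apply Rle_trans with (exp (ln r2)); [apply M; lra|rewrite exp_ln; lra]. }
  assert (Per : forall s : R, h (s, - PI + 2 * PI) = h (s, - PI)).
  { intros s. unfold h, Cexp. simpl. replace (- PI + 2 * PI) with PI by ring.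
    rewrite cos_neg, sin_neg, sin_PI, Ropp_0. reflexivity. }
  assert (E1 : bdry v u (ln r1) (- PI) W (2 * PI) = 0).
  { apply goursat; [exact HW|lra|]. intros x y Hx _.
    destruct (HD x y Hx) as [l Hl]. destruct (cderive_diff2 _ _ _ _ Hl) as [D1 D2].
    exists (Im l), (Re l), (- Im l). split; assumption. }
  assert (E2 : bdry (fun s t => - u s t) v (ln r1) (- PI) W (2 * PI) = 0).
  { apply goursat; [exact HW|lra|]. intros x y Hx _.
    destruct (HD x y Hx) as [l Hl]. destruct (cderive_diff2 _ _ _ _ Hl) as [D1 D2].
    exists (- Re l), (Im l), (Re l). split; [|exact D2].
    apply diff2_opp in D1. eapply diff2_eq; [exact D1| |]; simpl; ring. }
  unfold bdry in E1, E2.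
  replace (- PI + 2 * PI) with PI in * by ring.
  replace (ln r1 + W) with (ln r2) in * by (unfold W; ring).
  rewrite (RInt_ext (fun t => v t PI) (fun t => v t (- PI))) in E1.
  2:{ intros s _. unfold v. now rewrite Per. }
  rewrite (RInt_ext (fun t => - u t PI) (fun t => - u t (- PI))) in E2.
  2:{ intros s _. unfold u. now rewrite Per. }
  assert (C1 : forall r, 0 < r -> CInt (fun t => E (circ r t)) = (RInt (u (ln r)) (- PI) PI, RInt (v (ln r)) (- PI) PI)).
  { intros r Hr0. unfold CInt. f_equal; apply RInt_ext; intros t _; rewrite circ_Cexp by exact Hr0; reflexivity. }
  rewrite !C1 by lra.
  apply C_ext.
  - change (RInt (fun t => u (ln r2) t) (- PI) PI = RInt (fun t => u (ln r1) t) (- PI) PI). lra.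
  - change (RInt (fun t => v (ln r2) t) (- PI) PI = RInt (fun t => v (ln r1) t) (- PI) PI). lra.
Qed.

Lemma circle_integral_const (E : C -> C) (rho r1 r2 : R) : 0 < r1 < rho -> 0 < r2 < rho ->
  (forall w, 0 < Cmod w < rho -> ex_cderive E w) ->
  CInt (fun t => E (circ r2 t)) = CInt (fun t => E (circ r1 t)).
Proof.
  intros H1 H2 HE. destruct (Rle_dec r1 r2) as [L|L].
  - apply circle_integral_const_le; [lra|]. intros w Hw; apply HE; lra.
  - symmetry. apply circle_integral_const_le; [lra|]. intros w Hw; apply HE; lra.
Qed.

Lemma bounded_on_segment (f : R -> R) (a b : R) : a <= b ->
  (forall t, a <= t <= b -> continuous f t) -> exists M, forall t, a <= t <= b -> Rabs (f t) <= M.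
Proof.
  intros Hab H.
  destruct (continuity_ab_maj f a b Hab) as (x & Hx & _).
  { intros t Ht. apply continuity_pt_filterlim, H, Ht. }
  destruct (continuity_ab_min f a b Hab) as (y & Hy & _).
  { intros t Ht. apply continuity_pt_filterlim, H, Ht. }
  exists (Rabs (f x) + Rabs (f y)). intros t Ht. specialize (Hx t Ht). specialize (Hy t Ht).
  pose proof (Rle_abs (f x)). pose proof (Rle_abs (- f y)). rewrite Rabs_Ropp in H1.
  pose proof (Rabs_pos (f x)). pose proof (Rabs_pos (f y)).
  apply Rabs_le. lra.
Qed.

Lemma circle_bounded (E : C -> C) (r : R) : 0 < r -> (forall w, Cmod w = r -> ex_cderive E w) ->
  exists M, 0 <= M /\ forall t, - PI <= t <= PI -> Cmod (E (circ r t)) <= M.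
Proof.
  intros Hr HE. pose proof PI_RGT_0 as Hpi.
  assert (Hc : forall t, ex_cderive E (circ r t)) by (intros t; apply HE, Cmod_circ; lra).
  destruct (bounded_on_segment (fun t => Re (E (circ r t))) (- PI) PI) as [M1 HM1]; [lra| |].
  { intros t _. apply (circ_continuous E r t Hr (Hc t)). }
  destruct (bounded_on_segment (fun t => Im (E (circ r t))) (- PI) PI) as [M2 HM2]; [lra| |].
  { intros t _. apply (circ_continuous E r t Hr (Hc t)). }
  assert (K : forall t, - PI <= t <= PI -> Cmod (E (circ r t)) <= M1 + M2).
  { intros t Ht. eapply Rle_trans; [apply Cmod_le_sum|]. apply Rplus_le_compat; auto. }
  exists (M1 + M2). split; [|exact K].
  eapply Rle_trans; [apply Cmod_ge_0|apply (K 0); lra].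
Qed.

(** On [[- PI, PI]] it reaches its maximum 1 only at 0, so its powers concentrate there; on a circle
    it is a Laurent polynomial of the variable, by [circ_peak]. *)
Definition peak (t : R) : R := (1 + cos t) / 2.

Lemma peak_bound t : 0 <= peak t <= 1.
Proof. unfold peak. pose proof (COS_bound t). lra. Qed.

Lemma peak_decr s t : 0 <= s <= PI -> 0 <= t <= PI -> s <= t -> peak t <= peak s.
Proof.
  intros Hs Ht [L|L]; [|rewrite L; lra].
  unfold peak. assert (cos t < cos s) by (apply cos_decreasing_1; lra). lra.
Qed.

Lemma peak_abs t : peak (Rabs t) = peak t.
Proof. unfold peak. unfold Rabs. destruct Rcase_abs; [now rewrite cos_neg|reflexivity]. Qed.

Lemma RInt_ge_const (f : R -> R) (a b m : R) : a <= b -> ex_RInt f a b ->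
  (forall t, a < t < b -> m <= f t) -> m * (b - a) <= RInt f a b.
Proof.
  intros Hab Hex H.
  replace (m * (b - a)) with (RInt (fun _ => m) a b).
  - apply RInt_le; [exact Hab|apply ex_RInt_const|exact Hex|exact H].
  - rewrite RInt_const. unfold scal; simpl; unfold mult; simpl. ring.
Qed.

Lemma continuous_pow (f : R -> R) (n : nat) (t : R) : continuous f t -> continuous (fun s => f s ^ n) t.
Proof.
  intros H. induction n as [|n IH]; simpl; [apply continuous_const|].
  apply (continuous_mult (K := R_AbsRing)); assumption.
Qed.

Lemma continuous_peak t : continuous peak t.
Proof.
  assert (E : forall t, (/ 2) * (1 + cos t) = peak t) by (intros; unfold peak; field).
  apply (continuous_ext _ _ t E).
  apply (continuous_mult (K := R_AbsRing)); [apply continuous_const|].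
  apply (continuous_plus (V := R_NormedModule)); [apply continuous_const|apply continuous_cos].
Qed.

(** If [f 0 > 0], then [f] is bounded below by a positive number on [[- d, d]]. The part with
    [Rabs t <= d / 2] contributes at least a multiple of [peak (d / 2) ^ n], the part beyond [d] at
    worst a multiple of the exponentially smaller [peak d ^ n], and the part between is
    nonnegative. *)
Lemma peak_kernel_nonpos (f : R -> R) :
  (forall t, continuous f t) ->
  (forall n, RInt (fun t => f t * peak t ^ n) (- PI) PI = 0) -> f 0 <= 0.
Proof.
  intros Hf H. apply Rnot_lt_le. intros Hc. pose proof PI_RGT_0 as Hpi.
  set (c := f 0) in *.
  destruct (bounded_on_segment f (- PI) PI) as [M HM]; [lra|auto|].
  assert (PM : 0 <= M) by (eapply Rle_trans; [apply Rabs_pos|apply (HM 0); lra]).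
  pose proof (Hf 0) as H0. apply continuity_pt_filterlim in H0.
  assert (Hc2 : c / 2 > 0) by lra.
  destruct (H0 (c / 2) Hc2) as (d0 & Hd0 & K0).
  set (d := Rmin (d0 / 2) PI).
  assert (Hd : 0 < d <= PI) by (split; [apply Rmin_glb_lt; lra|apply Rmin_r]).
  assert (Hdd : d <= d0 / 2) by apply Rmin_l.
  assert (Kd : forall t, Rabs t <= d -> c / 2 <= f t).
  { intros t Ht. destruct (Req_dec t 0) as [->|Hn]; [fold c; lra|].
    specialize (K0 t). simpl in K0. unfold R_dist in K0.
    rewrite Rminus_0_r in K0.
    assert (B : Rabs (f t - f 0) < c / 2).
    { apply K0. split; [|lra]. split; [exact I|auto]. }
    apply Rabs_lt_between in B. unfold c in *. lra. }
  set (A := peak (d / 2)). set (B := peak d).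
  assert (HAB : B < A).
  { unfold A, B, peak. assert (cos d < cos (d / 2)) by (apply cos_decreasing_1; lra). lra. }
  pose proof (peak_bound d) as HB. fold B in HB.
  assert (Hex : forall n a b, ex_RInt (fun t => f t * peak t ^ n) a b).
  { intros n a b. apply (ex_RInt_continuous (V := R_CompleteNormedModule)). intros t _.
    apply (continuous_mult (K := R_AbsRing)); [apply Hf|apply continuous_pow, continuous_peak]. }
  assert (Main : forall n, (c / 2 * d) * A ^ n <= (2 * PI * M) * B ^ n).
  { intros n.
    assert (PA : 0 <= A ^ n) by (apply pow_le; lra). assert (PB : 0 <= B ^ n) by (apply pow_le; lra).
    assert (Outer : forall t, - PI <= t <= PI -> d / 2 <= Rabs t -> - (M * B ^ n) <= f t * peak t ^ n).
    { intros t Ht Ht2. pose proof (peak_bound t) as Pt. assert (0 <= peak t ^ n) by (apply pow_le; lra).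
      destruct (Rle_dec (Rabs t) d) as [L|L].
      - specialize (Kd t L). nra.
      - assert (Rabs t <= PI) by (apply Rabs_le; lra).
        assert (peak t ^ n <= B ^ n).
        { apply pow_incr. split; [lra|]. rewrite <- (peak_abs t). apply peak_decr; [lra| |lra].
          split; [apply Rabs_pos|assumption]. }
        specialize (HM t Ht). apply Rabs_le_between in HM.
        assert (M * peak t ^ n <= M * B ^ n) by (apply Rmult_le_compat_l; lra).
        assert (- M * peak t ^ n <= f t * peak t ^ n) by (apply Rmult_le_compat_r; lra). lra. }
    assert (I1 : - (M * B ^ n) * (- (d / 2) - - PI) <= RInt (fun t => f t * peak t ^ n) (- PI) (- (d / 2))).
    { apply RInt_ge_const; [lra|apply Hex|]. intros t Ht. apply Outer; [lra|].
      rewrite Rabs_left1; lra. }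
    assert (I3 : - (M * B ^ n) * (PI - d / 2) <= RInt (fun t => f t * peak t ^ n) (d / 2) PI).
    { apply RInt_ge_const; [lra|apply Hex|]. intros t Ht. apply Outer; [lra|].
      rewrite Rabs_pos_eq; lra. }
    assert (I2 : (c / 2 * A ^ n) * (d / 2 - - (d / 2)) <= RInt (fun t => f t * peak t ^ n) (- (d / 2)) (d / 2)).
    { apply RInt_ge_const; [lra|apply Hex|]. intros t Ht.
      assert (Rabs t <= d / 2) by (apply Rabs_le; lra).
      specialize (Kd t ltac:(lra)).
      assert (A ^ n <= peak t ^ n).
      { apply pow_incr. split; [lra|]. rewrite <- (peak_abs t). apply peak_decr; [|lra|lra].
        split; [apply Rabs_pos|lra]. }
      apply Rmult_le_compat; lra. }
    pose proof (RInt_Chasles (V := R_CompleteNormedModule) (fun t => f t * peak t ^ n) (- PI) (- (d / 2)) (d / 2) (Hex _ _ _) (Hex _ _ _)) as Ch1.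
    pose proof (RInt_Chasles (V := R_CompleteNormedModule) (fun t => f t * peak t ^ n) (- PI) (d / 2) PI (Hex _ _ _) (Hex _ _ _)) as Ch2.
    rewrite H in Ch2. rewrite <- Ch1 in Ch2. unfold plus in Ch2; simpl in Ch2.
    set (X := M * B ^ n) in *. assert (0 <= X) by (apply Rmult_le_pos; lra).
    replace (2 * PI * M * B ^ n) with (2 * PI * X) by (unfold X; ring).
    assert (0 <= d * X) by (apply Rmult_le_pos; lra).
    lra. }
  assert (HA : 0 < A) by lra.
  assert (L : is_lim_seq (fun n => (2 * PI * M) * (B / A) ^ n) 0).
  { replace (Finite 0) with (Rbar_mult (2 * PI * M) 0) by (simpl; f_equal; ring).
    apply is_lim_seq_scal_l, is_lim_seq_geom. rewrite Rabs_pos_eq.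
    - apply Rmult_lt_reg_r with A; [exact HA|]. unfold Rdiv. rewrite Rmult_assoc, Rinv_l, Rmult_1_r; lra.
    - apply Rmult_le_pos; [lra|]. apply Rlt_le, Rinv_0_lt_compat, HA. }
  assert (F : Rbar_le (c / 2 * d) 0).
  { refine (is_lim_seq_le (fun _ => c / 2 * d) _ _ _ _ (is_lim_seq_const _) L).
    intros n. specialize (Main n). assert (PA : 0 < A ^ n) by now apply pow_lt.
    apply Rmult_le_reg_r with (A ^ n); [exact PA|].
    unfold Rdiv at 2. rewrite Rpow_mult_distr, pow_inv.
    replace (2 * PI * M * (B ^ n * / A ^ n) * A ^ n) with (2 * PI * M * B ^ n) by (field; lra). exact Main. }
  simpl in F. nra.
Qed.

Lemma peak_kernel_zero (f : R -> R) :
  (forall t, continuous f t) ->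
  (forall n, RInt (fun t => f t * peak t ^ n) (- PI) PI = 0) -> f 0 = 0.
Proof.
  intros Hf H. apply Rle_antisym; [now apply peak_kernel_nonpos|].
  assert (G : - f 0 <= 0); [|lra].
  apply (peak_kernel_nonpos (fun t => - f t)).
  - intros t. now apply (continuous_opp (V := R_NormedModule)).
  - intros n. rewrite (RInt_ext _ (fun t => scal (-1) (f t * peak t ^ n))).
    + rewrite (RInt_scal (V := R_CompleteNormedModule)).
      * rewrite H. unfold scal; simpl; unfold mult; simpl. ring.
      * apply (ex_RInt_continuous (V := R_CompleteNormedModule)). intros t _.
        apply (continuous_mult (K := R_AbsRing)); [apply Hf|apply continuous_pow, continuous_peak].
    + intros t _. unfold scal; simpl; unfold mult; simpl. ring.
Qed.

Lemma ex_cderive_mult (F G : C -> C) (z : C) :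
  ex_cderive F z -> ex_cderive G z -> ex_cderive (fun w => F w * G w)%C z.
Proof. intros [l Hl] [m Hm]. eexists. exact (cderive_mult F G z l m Hl Hm). Qed.

Lemma ex_cderive_plus (F G : C -> C) (z : C) :
  ex_cderive F z -> ex_cderive G z -> ex_cderive (fun w => F w + G w)%C z.
Proof. intros [l Hl] [m Hm]. eexists. exact (cderive_plus F G z l m Hl Hm). Qed.

Lemma ex_cderive_const (c z : C) : ex_cderive (fun _ => c) z.
Proof. eexists. apply cderive_const. Qed.

Lemma ex_cderive_id (z : C) : ex_cderive (fun w => w) z.
Proof. eexists. apply cderive_id. Qed.

Lemma ex_cderive_pow (F : C -> C) (n : nat) (z : C) :
  ex_cderive F z -> ex_cderive (fun w => F w ^ n)%C z.
Proof.
  intros H. induction n as [|n IH]; [exact (ex_cderive_const (RtoC 1) z)|].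
  exact (ex_cderive_mult F (fun w => F w ^ n)%C z H IH).
Qed.

Lemma ex_cderive_inv (F : C -> C) (z : C) : ex_cderive F z -> F z <> RtoC 0 -> ex_cderive (fun w => / F w)%C z.
Proof. intros [l Hl] Hz. eexists. exact (cderive_inv F z l Hl Hz). Qed.

Lemma ex_cderive_comp (F G : C -> C) (z : C) :
  ex_cderive F (G z) -> ex_cderive G z -> ex_cderive (fun w => F (G w)) z.
Proof. intros [l Hl] [m Hm]. eexists. exact (cderive_comp F G z l m Hl Hm). Qed.

Lemma circ_peak (r t : R) : 0 < r ->
  (RtoC (/ 2) + RtoC (/ 4) * (circ r t * / r + r * / circ r t))%C = RtoC (peak t).
Proof.
  intros Hr.
  assert (Hn : circ r t <> RtoC 0) by (apply Cmod_gt_0; rewrite Cmod_circ; lra).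
  assert (Hr' : RtoC r <> RtoC 0) by (intros E; apply RtoC_inj in E; lra).
  assert (E : circ r t = (r * circ 1 t)%C) by (apply C_ext; simpl; ring).
  assert (E' : (/ circ r t)%C = (/ r * circ 1 (- t))%C).
  { assert (M : (circ r t * (/ r * circ 1 (- t)))%C = RtoC 1).
    { rewrite E. transitivity ((r * / r) * (circ 1 t * circ 1 (- t)))%C; [ring|].
      rewrite Cinv_r by exact Hr'. rewrite Cmult_1_l.
      unfold circ. rewrite cos_neg, sin_neg. apply C_ext; simpl.
      - pose proof (sin2_cos2 t) as S. unfold Rsqr in S. lra.
      - ring. }
    rewrite <- (Cmult_1_r (/ circ r t)), <- M, Cmult_assoc, Cinv_l by exact Hn. ring. }
  rewrite E', E.
  transitivity (RtoC (/ 2) + RtoC (/ 4) * ((r * / r) * (circ 1 t + circ 1 (- t))))%C; [ring|].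
  rewrite Cinv_r by exact Hr'. unfold circ, peak. rewrite cos_neg, sin_neg.
  apply C_ext; simpl; field.
Qed.

(** The function [T] is analytic off 0 and equals [peak] on the circle of radius [r]. The circle
    integrals of [D * T ^ n] do not depend on the radius and vanish on a small circle, so [D] on the
    large circle is orthogonal to all powers of [peak] and must vanish at angle 0. *)
Lemma identity_on_ray (D : C -> C) (rho eps r : R) : 0 < eps -> 0 < r < rho ->
  (forall w, Cmod w < rho -> ex_cderive D w) -> (forall w, Cmod w < eps -> D w = RtoC 0) ->
  D (RtoC r) = RtoC 0.
Proof.
  intros Heps Hr HD Hz. pose proof PI_RGT_0 as Hpi.
  set (T := fun w => (RtoC (/ 2) + RtoC (/ 4) * (w * / r + r * / w))%C).
  assert (HT : forall w, 0 < Cmod w -> ex_cderive T w).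
  { intros w Hw. apply Cmod_gt_0 in Hw.
    apply ex_cderive_plus; [apply ex_cderive_const|]. apply ex_cderive_mult; [apply ex_cderive_const|].
    apply ex_cderive_plus.
    - apply ex_cderive_mult; [apply ex_cderive_id|apply ex_cderive_const].
    - apply ex_cderive_mult; [apply ex_cderive_const|].
      apply (ex_cderive_inv (fun w => w)); [apply ex_cderive_id|exact Hw]. }
  set (r0 := Rmin (eps / 2) r). assert (Hr0 : 0 < r0) by (apply Rmin_glb_lt; lra).
  assert (Hr0e : r0 <= eps / 2) by apply Rmin_l. assert (Hr0r : r0 <= r) by apply Rmin_r.
  assert (I : forall n, CInt (fun t => D (circ r t) * T (circ r t) ^ n)%C = RtoC 0).
  { intros n.
    rewrite (circle_integral_const (fun w => D w * T w ^ n)%C rho r0 r); [| lra | lra |].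
    - apply C_ext; rewrite ?Re_CInt, ?Im_CInt.
      + rewrite (RInt_ext _ (fun _ => 0)); [rewrite RInt_const; unfold scal; simpl; unfold mult; simpl; ring|].
        intros t _. rewrite Hz by (rewrite Cmod_circ; lra). rewrite Cmult_0_l. reflexivity.
      + rewrite (RInt_ext _ (fun _ => 0)); [rewrite RInt_const; unfold scal; simpl; unfold mult; simpl; ring|].
        intros t _. rewrite Hz by (rewrite Cmod_circ; lra). rewrite Cmult_0_l. reflexivity.
    - intros w Hw. apply ex_cderive_mult; [apply HD; lra|]. apply ex_cderive_pow, HT; lra. }
  assert (Dc : forall t, ex_cderive D (circ r t)) by (intros t; apply HD; rewrite Cmod_circ; lra).
  assert (ET : forall t n, (D (circ r t) * T (circ r t) ^ n)%C = (D (circ r t) * RtoC (peak t ^ n))%C).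
  { intros t n. unfold T. rewrite circ_peak by lra. now rewrite RtoC_pow. }
  assert (E0 : circ r 0 = RtoC r).
  { unfold circ. rewrite cos_0, sin_0. apply C_ext; simpl; ring. }
  rewrite <- E0. apply C_ext.
  - apply (peak_kernel_zero (fun t => Re (D (circ r t)))).
    + intros t. apply (circ_continuous D r t); [lra|apply Dc].
    + intros n. pose proof (f_equal Re (I n)) as In. rewrite Re_CInt in In. change (Re (RtoC 0)) with 0 in In. rewrite <- In.
      apply RInt_ext. intros t _. rewrite ET. now rewrite re_scal_r.
  - apply (peak_kernel_zero (fun t => Im (D (circ r t)))).
    + intros t. apply (circ_continuous D r t); [lra|apply Dc].
    + intros n. pose proof (f_equal Im (I n)) as In. rewrite Im_CInt in In. change (Im (RtoC 0)) with 0 in In. rewrite <- In.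
      apply RInt_ext. intros t _. rewrite ET. now rewrite im_scal_r.
Qed.

Lemma identity_theorem (F G : C -> C) (rho eps : R) (w : C) : 0 < eps ->
  (forall z, Cmod z < rho -> ex_cderive F z) -> (forall z, Cmod z < rho -> ex_cderive G z) ->
  (forall z, Cmod z < eps -> F z = G z) -> Cmod w < rho -> F w = G w.
Proof.
  intros Heps HF HG HE Hw. destruct (Req_dec (Cmod w) 0) as [E|E].
  { apply HE. lra. }
  pose proof (Cmod_ge_0 w) as Pw. set (r := Cmod w) in *.
  assert (Hr : RtoC r <> RtoC 0) by (intros X; apply RtoC_inj in X; lra).
  set (u := (w * / r)%C).
  assert (Hu : Cmod u = 1).
  { unfold u. rewrite Cmod_mult, Cmod_inv, Cmod_R, Rabs_pos_eq by (assumption || lra). fold r. field. lra. }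
  assert (Mu : forall z, Cmod (u * z) = Cmod z) by (intros z; rewrite Cmod_mult, Hu; ring).
  assert (Eu : (u * r)%C = w) by (unfold u; rewrite <- Cmult_assoc, Cinv_l by exact Hr; ring).
  assert (Z : (F (u * r) + -(1) * G (u * r))%C = RtoC 0).
  { apply (identity_on_ray (fun z => F (u * z) + -(1) * G (u * z))%C rho eps r Heps); [lra| |].
    - intros z Hz. apply ex_cderive_plus.
      + apply (ex_cderive_comp F (fun z => u * z)%C); [apply HF; now rewrite Mu|].
        apply ex_cderive_mult; [apply ex_cderive_const|apply ex_cderive_id].
      + apply ex_cderive_mult; [apply ex_cderive_const|].
        apply (ex_cderive_comp G (fun z => u * z)%C); [apply HG; now rewrite Mu|].
        apply ex_cderive_mult; [apply ex_cderive_const|apply ex_cderive_id].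
    - intros z Hz. rewrite HE by now rewrite Mu. ring. }
  rewrite Eu in Z. replace (F w) with ((F w + - (1) * G w) + G w)%C by ring. rewrite Z. ring.
Qed.

(** * Taylor coefficients and analytic logarithms *)


(* Lemmas about Coquelicot's hierarchy leave equations typed in a structure that [ring] does not see through. *)
Ltac Rring := match goal with |- @eq _ ?a ?b => change (@eq R a b) end; ring.

Lemma RInt_scal_R (x : R) (f : R -> R) (a b : R) : ex_RInt f a b ->
  RInt (fun t => x * f t) a b = x * RInt f a b.
Proof. exact (RInt_scal (V := R_CompleteNormedModule) f a b x). Qed.

Lemma RInt_series (g : nat -> R -> R) (b : nat -> R) (f : R -> R) (x y : R) : x <= y ->
  (forall j, ex_RInt (g j) x y) -> ex_RInt f x y ->
  (forall j t, Rabs (g j t) <= b j) -> ex_series b ->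
  (forall t, f t = Series (fun j => g j t)) ->
  is_lim_seq (rsum (fun j => RInt (g j) x y)) (RInt f x y).
Proof.
  intros Hxy Hg Hf Hb Hs Ef.
  assert (Ex : forall n, ex_RInt (fun t => rsum (fun j => g j t) n) x y).
  { intros n; induction n as [|n IH]; simpl; [apply ex_RInt_const|].
    apply (ex_RInt_plus (V := R_NormedModule) (fun t => rsum (fun j => g j t) n) (g n)); [exact IH|apply Hg]. }
  assert (Es : forall n, rsum (fun j => RInt (g j) x y) n = RInt (fun t => rsum (fun j => g j t) n) x y).
  { intros n; induction n as [|n IH]; simpl.
    - rewrite RInt_const. unfold scal; simpl; unfold mult; simpl. ring.
    - rewrite IH. symmetry.
      exact (RInt_plus (V := R_CompleteNormedModule) (fun t => rsum (fun j => g j t) n) (g n) x y (Ex n) (Hg n)). }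
  assert (Tail : forall n t, Rabs (f t - rsum (fun j => g j t) n) <= Series b - rsum b n).
  { intros n t. rewrite Ef.
    assert (Hgs : ex_series (fun j => g j t)) by (apply (ex_series_le (fun j => g j t) b); [intros; apply Hb|exact Hs]).
    assert (L : is_lim_seq (fun m => Rabs (rsum (fun j => g j t) (m + n) - rsum (fun j => g j t) n))
                  (Rabs (Series (fun j => g j t) - rsum (fun j => g j t) n))).
    { apply (is_lim_seq_abs _ (Finite _)). apply is_lim_seq_minus'; [|apply is_lim_seq_const].
      apply (is_lim_seq_incr_n (rsum (fun j => g j t)) n). now apply Series_lim. }
    assert (L2 : is_lim_seq (fun m => rsum b (m + n) - rsum b n) (Series b - rsum b n)).
    { apply is_lim_seq_minus'; [|apply is_lim_seq_const].
      apply (is_lim_seq_incr_n (rsum b) n). now apply Series_lim. }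
    refine (is_lim_seq_le _ _ (Finite _) (Finite _) _ L L2).
    intros m. induction m as [|m IH].
    - simpl. rewrite !Rminus_diag, Rabs_R0. lra.
    - cbn [rsum Nat.add].
      replace (rsum (fun j => g j t) (m + n) + g (m + n)%nat t - rsum (fun j => g j t) n)
        with ((rsum (fun j => g j t) (m + n) - rsum (fun j => g j t) n) + g (m + n)%nat t) by ring.
      eapply Rle_trans; [apply Rabs_triang|]. specialize (Hb (m + n)%nat t). lra. }
  assert (L0 : is_lim_seq (fun n => (y - x) * (Series b - rsum b n)) 0).
  { replace (Finite 0) with (Rbar_mult (y - x) (Series b - Series b)) by (simpl; f_equal; ring).
    apply is_lim_seq_scal_l. apply is_lim_seq_minus'; [apply is_lim_seq_const|now apply Series_lim]. }
  assert (L1 : is_lim_seq (fun n => rsum (fun j => RInt (g j) x y) n - RInt f x y) 0).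
  { apply is_lim_seq_abs_0.
    apply is_lim_seq_le_le with (fun _ => 0) (fun n => (y - x) * (Series b - rsum b n)); [|apply is_lim_seq_const|exact L0].
    intros n; split; [apply Rabs_pos|]. rewrite Es, <- Rabs_Ropp, Ropp_minus_distr, <- RInt_minus_R by auto.
    apply (abs_RInt_le_const (fun t => f t - rsum (fun j => g j t) n)); [exact Hxy| |intros; apply Tail].
    apply (ex_RInt_minus (V := R_NormedModule) f (fun t => rsum (fun j => g j t) n)); auto. }
  apply is_lim_seq_ext with (fun n => (rsum (fun j => RInt (g j) x y) n - RInt f x y) + RInt f x y); [intros; ring|].
  replace (Finite (RInt f x y)) with (Finite (0 + RInt f x y)) by (f_equal; ring).
  apply is_lim_seq_plus'; [exact L1|apply is_lim_seq_const].
Qed.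

Lemma CInt_series (g : nat -> R -> C) (b : nat -> R) (f : R -> C) :
  (forall j t, continuous (fun s => Re (g j s)) t /\ continuous (fun s => Im (g j s)) t) ->
  (forall t, continuous (fun s => Re (f s)) t /\ continuous (fun s => Im (f s)) t) ->
  (forall j t, Cmod (g j t) <= b j) -> ex_series b ->
  (forall t, f t = CSer (fun j => g j t)) ->
  clim (csum (fun j => CInt (g j))) (CInt f).
Proof.
  intros Hg Hf Hb Hs Ef. pose proof PI_RGT_0.
  assert (X : forall h : R -> R, (forall t, continuous h t) -> ex_RInt h (- PI) PI).
  { intros h Hh. apply (ex_RInt_continuous (V := R_CompleteNormedModule)). intros; apply Hh. }
  split.
  - apply is_lim_seq_ext with (rsum (fun j => RInt (fun t => Re (g j t)) (- PI) PI)); [intros; now rewrite Re_csum|].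
    apply (RInt_series (fun j t => Re (g j t)) b); [lra| | | |exact Hs|].
    + intros j; apply X. intros t; exact (proj1 (Hg j t)).
    + apply X. intros t; exact (proj1 (Hf t)).
    + intros j t. eapply Rle_trans; [apply re_le_Cmod|apply Hb].
    + intros t. now rewrite Ef.
  - apply is_lim_seq_ext with (rsum (fun j => RInt (fun t => Im (g j t)) (- PI) PI)); [intros; now rewrite Im_csum|].
    apply (RInt_series (fun j t => Im (g j t)) b); [lra| | | |exact Hs|].
    + intros j; apply X. intros t; exact (proj2 (Hg j t)).
    + apply X. intros t; exact (proj2 (Hf t)).
    + intros j t. eapply Rle_trans; [apply im_le_Cmod|apply Hb].
    + intros t. now rewrite Ef.
Qed.

Definition cis (t : R) : C := circ 1 t.

Lemma cis_plus s t : cis (s + t) = (cis s * cis t)%C.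
Proof. unfold cis, circ. rewrite cos_plus, sin_plus. apply C_ext; simpl; ring. Qed.

Lemma cis_0 : cis 0 = RtoC 1.
Proof. unfold cis, circ. rewrite cos_0, sin_0. apply C_ext; simpl; ring. Qed.

Lemma Cmod_cis t : Cmod (cis t) = 1.
Proof. apply Cmod_circ; lra. Qed.

Lemma circ_cis r t : circ r t = (r * cis t)%C.
Proof. apply C_ext; simpl; ring. Qed.

Lemma circ_pow r t n : (circ r t ^ n)%C = (r ^ n * cis (INR n * t))%C.
Proof.
  induction n as [|n IH].
  - simpl. rewrite Rmult_0_l, cis_0. ring.
  - change (circ r t ^ S n)%C with (circ r t * circ r t ^ n)%C. rewrite IH, circ_cis.
    rewrite S_INR, Rmult_plus_distr_r, Rmult_1_l, cis_plus. simpl. ring.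
Qed.

Lemma Re_mult (x y : C) : Re (x * y) = Re x * Re y - Im x * Im y. Proof. reflexivity. Qed.
Lemma Im_mult (x y : C) : Im (x * y) = Re x * Im y + Im x * Re y. Proof. reflexivity. Qed.
Lemma Re_cis t : Re (cis t) = cos t. Proof. unfold cis, circ; simpl; ring. Qed.
Lemma Im_cis t : Im (cis t) = sin t. Proof. unfold cis, circ; simpl; ring. Qed.

Lemma continuous_cis (m : R) (c : C) t :
  continuous (fun s => Re (c * cis (m * s))%C) t /\ continuous (fun s => Im (c * cis (m * s))%C) t.
Proof.
  assert (H : forall p q : R, continuous (fun s => p * cos (m * s) + q * sin (m * s)) t).
  { intros p q. apply (ex_derive_continuous (V := R_NormedModule)). auto_derive. auto. }
  split; [eapply continuous_ext; [|apply (H (Re c) (- Im c))]|eapply continuous_ext; [|apply (H (Im c) (Re c))]];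
    intros s; unfold cis, circ; simpl; unfold Re, Im.
  - change (fst c * cos (m * s) + - snd c * sin (m * s) = fst c * (1 * cos (m * s)) - snd c * (1 * sin (m * s))). ring.
  - change (snd c * cos (m * s) + fst c * sin (m * s) = fst c * (1 * sin (m * s)) + snd c * (1 * cos (m * s))). ring.
Qed.

Lemma RInt_trig (p q : R) (z : Z) : z <> 0%Z ->
  RInt (fun t => p * cos (IZR z * t) + q * sin (IZR z * t)) (- PI) PI = 0.
Proof.
  intros Hz. assert (Hm : IZR z <> 0) by now apply not_0_IZR.
  set (m := IZR z) in *.
  set (F := fun t => (p * sin (m * t) - q * cos (m * t)) / m).
  assert (D : is_RInt (fun t => p * cos (m * t) + q * sin (m * t)) (- PI) PI (minus (F PI) (F (- PI)))).
  { apply (is_RInt_derive F).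
    - intros t _. unfold F. auto_derive; [auto|field; exact Hm].
    - intros t _. apply (ex_derive_continuous (V := R_NormedModule)). auto_derive. auto. }
  rewrite (is_RInt_unique _ _ _ _ D). unfold minus, plus, opp; simpl. unfold F.
  replace (m * - PI) with (- (m * PI)) by ring. rewrite cos_neg, sin_neg.
  rewrite (sin_eq_0_1 (m * PI)) by now exists z. field. exact Hm.
Qed.

Lemma CInt_cis (c : C) (z : Z) :
  CInt (fun t => c * cis (IZR z * t))%C = if Z.eqb z 0 then (2 * PI * c)%C else RtoC 0.
Proof.
  apply C_ext; rewrite ?Re_CInt, ?Im_CInt.
  - rewrite (RInt_ext _ (fun t => Re c * cos (IZR z * t) + (- Im c) * sin (IZR z * t))).
    2:{ intros t _. unfold cis, circ. simpl. unfold Re, Im. Rring. }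
    destruct (Z.eqb_spec z 0) as [->|Hz]; [|now apply RInt_trig].
    rewrite (RInt_ext _ (fun t => Re c)).
    + rewrite RInt_const. unfold scal; simpl; unfold mult; simpl. unfold Re. ring.
    + intros t _. rewrite Rmult_0_l, cos_0, sin_0. Rring.
  - rewrite (RInt_ext _ (fun t => Im c * cos (IZR z * t) + Re c * sin (IZR z * t))).
    2:{ intros t _. unfold cis, circ. simpl. unfold Re, Im. Rring. }
    destruct (Z.eqb_spec z 0) as [->|Hz]; [|now apply RInt_trig].
    rewrite (RInt_ext _ (fun t => Im c)).
    + rewrite RInt_const. unfold scal; simpl; unfold mult; simpl. unfold Im. ring.
    + intros t _. rewrite Rmult_0_l, cos_0, sin_0. Rring.
Qed.

Lemma continuous_Cmult_cis (f : R -> C) (m : R) t :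
  continuous (fun s => Re (f s)) t /\ continuous (fun s => Im (f s)) t ->
  continuous (fun s => Re (f s * cis (m * s))%C) t /\ continuous (fun s => Im (f s * cis (m * s))%C) t.
Proof.
  intros [H1 H2]. destruct (continuous_cis m (RtoC 1) t) as [H3 H4].
  assert (E : forall s, (1 * cis (m * s))%C = cis (m * s)) by (intros; ring).
  apply (continuous_ext _ _ t (fun s => f_equal Re (E s))) in H3.
  apply (continuous_ext _ _ t (fun s => f_equal Im (E s))) in H4.
  split.
  - exact (continuous_minus (V := R_NormedModule) _ _ _
      (continuous_mult (K := R_AbsRing) _ _ _ H1 H3) (continuous_mult (K := R_AbsRing) _ _ _ H2 H4)).
  - exact (continuous_plus (V := R_NormedModule) _ _ _
      (continuous_mult (K := R_AbsRing) _ _ _ H1 H4) (continuous_mult (K := R_AbsRing) _ _ _ H2 H3)).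
Qed.

Lemma ex_cderive_CPS c rho w : conv c rho -> Cmod w < rho -> ex_cderive (CPS c) w.
Proof. intros H Hw. eexists. exact (CPS_derive c rho w H Hw). Qed.

(** One statement covers all integer frequencies: nonnegative ones read off a coefficient, and
    negative ones, for which no index [j] qualifies, give 0. *)
Lemma circle_coef (c : nat -> C) (rho r : R) (z : Z) : conv c rho -> 0 < r < rho ->
  clim (csum (fun j => if Z.eqb (Z.of_nat j - z) 0 then (2 * PI * (c j * r ^ j))%C else RtoC 0))
    (CInt (fun t => CPS c (circ r t) * cis (- IZR z * t))%C).
Proof.
  intros Hc Hr.
  set (g := fun j t => (c j * r ^ j * cis (IZR (Z.of_nat j - z) * t))%C).
  apply clim_ext with (csum (fun j => CInt (g j))).
  { intros n. apply csum_ext. intros j _. unfold g. now rewrite CInt_cis. }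
  apply CInt_series with (fun j => Cmod (c j) * r ^ j).
  - intros j t. apply continuous_cis.
  - intros t. apply (continuous_Cmult_cis (fun t => CPS c (circ r t))), circ_continuous; [lra|].
    apply ex_cderive_CPS with rho; [exact Hc|]. rewrite Cmod_circ; lra.
  - intros j t. unfold g. rewrite !Cmod_mult, Cmod_cis, Cmod_pow, Cmod_R, Rabs_pos_eq by lra. lra.
  - apply Hc. lra.
  - intros t. unfold CPS, g.
    rewrite Cmult_comm, <- CSer_scal by (apply conv_asum with rho; [exact Hc|rewrite Cmod_circ; lra]).
    apply CSer_ext. intros j. rewrite circ_pow.
    replace (IZR (Z.of_nat j - z) * t) with (INR j * t + - IZR z * t)
      by (rewrite minus_IZR, <- INR_IZR_INZ; ring).
    rewrite cis_plus. ring.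
Qed.

Lemma circle_coef_nonneg (c : nat -> C) (rho r : R) (k : nat) : conv c rho -> 0 < r < rho ->
  CInt (fun t => CPS c (circ r t) * cis (- INR k * t))%C = (2 * PI * (c k * r ^ k))%C.
Proof.
  intros Hc Hr. pose proof (circle_coef c rho r (Z.of_nat k) Hc Hr) as H.
  rewrite <- INR_IZR_INZ in H. refine (clim_unique _ _ _ H _).
  destruct (asum_single k (2 * PI * (c k * r ^ k))%C) as (S1 & _ & S3).
  rewrite <- S3. apply clim_ext with (csum (fun i => if Nat.eqb i k then (2 * PI * (c k * r ^ k))%C else RtoC 0)).
  - intros n. apply csum_ext. intros j _.
    destruct (Nat.eqb_spec j k) as [->|Hj]; [now rewrite Z.sub_diag|].
    destruct (Z.eqb_spec (Z.of_nat j - Z.of_nat k) 0); [lia|reflexivity].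
  - now apply CSer_lim.
Qed.

Lemma circle_coef_neg (c : nat -> C) (rho r : R) (k : nat) : conv c rho -> 0 < r < rho ->
  CInt (fun t => CPS c (circ r t) * cis (INR (S k) * t))%C = RtoC 0.
Proof.
  intros Hc Hr. pose proof (circle_coef c rho r (- Z.of_nat (S k)) Hc Hr) as H.
  rewrite opp_IZR, Ropp_involutive, <- INR_IZR_INZ in H. refine (clim_unique _ _ _ H _).
  apply clim_ext with (fun _ => RtoC 0); [|apply clim_const].
  intros n. induction n as [|n IH]; [reflexivity|]. cbn [csum]. rewrite <- IH.
  destruct (Z.eqb_spec (Z.of_nat n - - Z.of_nat (S k)) 0); [lia|ring].
Qed.

(* Borel-Caratheodory: [A - Re f >= 0], so the Fourier coefficients of its real part are bounded by its mean. *)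
Lemma coef_bound_of_Re (e : nat -> C) (rho A : R) (k : nat) : conv e rho -> 0 < rho ->
  (forall w, Cmod w < rho -> Re (CPS e w) <= A) -> Cmod (e (S k)) * rho ^ S k <= 4 * (A - Re (e O)).
Proof.
  intros He Hrho HA. pose proof PI_RGT_0 as Hpi.
  assert (Main : forall r, 0 < r < rho -> Cmod (e (S k)) * r ^ S k <= 4 * (A - Re (e O))).
  { intros r Hr. set (u := fun t => Re (CPS e (circ r t))). set (v := fun t => Im (CPS e (circ r t))).
    assert (Hex : forall t, ex_cderive (CPS e) (circ r t)).
    { intros t. apply ex_cderive_CPS with rho; [exact He|rewrite Cmod_circ; lra]. }
    assert (Cu : forall t, continuous u t) by (intros t; exact (proj1 (circ_continuous (CPS e) r t (proj1 Hr) (Hex t)))).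
    assert (Cv : forall t, continuous v t) by (intros t; exact (proj2 (circ_continuous (CPS e) r t (proj1 Hr) (Hex t)))).
    assert (X : forall h : R -> R, (forall t, continuous h t) -> ex_RInt h (- PI) PI).
    { intros h Hh. apply (ex_RInt_continuous (V := R_CompleteNormedModule)). intros; apply Hh. }
    set (m := INR (S k)).
    assert (Cc : forall t, continuous (fun t => cos (m * t)) t).
    { intros t. apply (ex_derive_continuous (V := R_NormedModule)). auto_derive. auto. }
    assert (Cs : forall t, continuous (fun t => sin (m * t)) t).
    { intros t. apply (ex_derive_continuous (V := R_NormedModule)). auto_derive. auto. }
    assert (M : forall f g : R -> R, (forall t, continuous f t) -> (forall t, continuous g t) ->
       ex_RInt (fun t => f t * g t) (- PI) PI).
    { intros f g Hf Hg. apply X. intros t. now apply (continuous_mult (K := R_AbsRing)). }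
    set (uc := RInt (fun t => u t * cos (m * t)) (- PI) PI). set (us := RInt (fun t => u t * sin (m * t)) (- PI) PI).
    set (vc := RInt (fun t => v t * cos (m * t)) (- PI) PI). set (vs := RInt (fun t => v t * sin (m * t)) (- PI) PI).
    assert (Plus : forall f g : R -> R, ex_RInt f (- PI) PI -> ex_RInt g (- PI) PI ->
       RInt (fun t => f t + g t) (- PI) PI = RInt f (- PI) PI + RInt g (- PI) PI).
    { intros f g Hf Hg. exact (RInt_plus (V := R_CompleteNormedModule) f g _ _ Hf Hg). }
    pose proof (circle_coef_nonneg e rho r (S k) He Hr) as P1. fold m in P1.
    pose proof (circle_coef_neg e rho r k He Hr) as P2. fold m in P2.
    set (E := (e (S k) * r ^ S k)%C) in *.
    (* The coefficient of frequency [S k] gives [Q1] and [Q2]; that of frequency [- S k], which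
       vanishes, gives [Q3] and [Q4]. Together they express [E] through the real part [u] alone. *)
    assert (Q1 : uc + vs = 2 * PI * Re E).
    { apply (f_equal Re) in P1. rewrite Re_CInt in P1.
      rewrite <- RtoC_mult, re_scal_l in P1.
      rewrite <- P1. unfold uc, vs. rewrite <- Plus by (apply M; assumption). apply RInt_ext. intros t _.
      rewrite ?Re_mult, ?Im_mult, Re_cis, Im_cis. replace (- m * t) with (- (m * t)) by ring.
      rewrite cos_neg, sin_neg. fold (u t) (v t). Rring. }
    assert (Q2 : vc - us = 2 * PI * Im E).
    { apply (f_equal Im) in P1. rewrite Im_CInt in P1.
      rewrite <- RtoC_mult, im_scal_l in P1.
      rewrite <- P1. unfold us, vc. rewrite <- RInt_minus_R by (apply M; assumption). apply RInt_ext. intros t _.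
      rewrite ?Re_mult, ?Im_mult, Re_cis, Im_cis. replace (- m * t) with (- (m * t)) by ring.
      rewrite cos_neg, sin_neg. fold (u t) (v t). Rring. }
    assert (Q3 : uc - vs = 0).
    { apply (f_equal Re) in P2. rewrite Re_CInt in P2. change (Re (RtoC 0)) with 0 in P2.
      rewrite <- P2. unfold uc, vs. rewrite <- RInt_minus_R by (apply M; assumption). apply RInt_ext. intros t _.
      rewrite ?Re_mult, ?Im_mult, Re_cis, Im_cis. fold (u t) (v t). Rring. }
    assert (Q4 : vc + us = 0).
    { apply (f_equal Im) in P2. rewrite Im_CInt in P2. change (Im (RtoC 0)) with 0 in P2.
      rewrite <- P2. unfold us, vc. rewrite <- Plus by (apply M; assumption). apply RInt_ext. intros t _.
      rewrite ?Re_mult, ?Im_mult, Re_cis, Im_cis. fold (u t) (v t). Rring. }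
    assert (Q5 : RInt u (- PI) PI = 2 * PI * Re (e O)).
    { pose proof (circle_coef_nonneg e rho r 0 He Hr) as P0. apply (f_equal Re) in P0. rewrite Re_CInt in P0.
      rewrite <- RtoC_mult, re_scal_l in P0. change (r ^ 0)%C with (RtoC 1) in P0. rewrite Cmult_1_r in P0.
      rewrite <- P0. apply RInt_ext. intros t _. rewrite Re_mult, Re_cis, Im_cis. change (INR 0) with 0.
      replace (- 0 * t) with 0 by ring. rewrite cos_0, sin_0. fold (u t). Rring. }
    assert (HuA : forall t, u t <= A) by (intros t; apply HA; rewrite Cmod_circ; lra).
    assert (Bd : forall g : R -> R, (forall t, continuous g t) -> (forall t, Rabs (g t) <= 1) ->
       RInt g (- PI) PI = 0 -> Rabs (RInt (fun t => u t * g t) (- PI) PI) <= 2 * PI * (A - Re (e O))).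
    { intros g Cg Hg Ig.
      assert (Eg : RInt (fun t => (A - u t) * g t) (- PI) PI = - RInt (fun t => u t * g t) (- PI) PI).
      { rewrite (RInt_ext _ (fun t => scal A (g t) - u t * g t)).
        2:{ intros t _. unfold scal; simpl; unfold mult; simpl. Rring. }
        rewrite RInt_minus_R; [|apply (ex_RInt_scal (V := R_NormedModule) g), X, Cg|apply M; assumption].
        rewrite (RInt_scal (V := R_CompleteNormedModule)) by (apply X, Cg). rewrite Ig.
        unfold scal; simpl; unfold mult; simpl. ring. }
      rewrite <- Rabs_Ropp, <- Eg.
      assert (CAu : forall t, continuous (fun t => A - u t) t).
      { intros t. apply (continuous_minus (V := R_NormedModule)); [apply continuous_const|apply Cu]. }
      assert (IAu : RInt (fun t => A - u t) (- PI) PI = 2 * PI * (A - Re (e O))).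
      { rewrite RInt_minus_R; [|apply ex_RInt_const|apply X, Cu]. rewrite Q5, RInt_const.
        unfold scal; simpl; unfold mult; simpl. ring. }
      rewrite <- IAu.
      eapply Rle_trans; [apply abs_RInt_le; [lra|apply M; assumption]|].
      apply RInt_le; [lra| |apply X, CAu|].
      - apply X. intros t. apply (continuous_comp (fun t => (A - u t) * g t) Rabs).
        + now apply (continuous_mult (K := R_AbsRing)).
        + apply continuous_Rabs.
      - intros t _. rewrite Rabs_mult. specialize (HuA t). specialize (Hg t).
        rewrite (Rabs_pos_eq (A - u t)) by lra. pose proof (Rabs_pos (g t)). nra. }
    assert (B1 : Rabs uc <= 2 * PI * (A - Re (e O))).
    { apply Bd; [exact Cc|intros t; apply Rabs_le, COS_bound|].
      rewrite <- (RInt_trig 1 0 (Z.of_nat (S k))) by lia. apply RInt_ext. intros t _.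
      rewrite <- INR_IZR_INZ. fold m. Rring. }
    assert (B2 : Rabs us <= 2 * PI * (A - Re (e O))).
    { apply Bd; [exact Cs|intros t; apply Rabs_le, SIN_bound|].
      rewrite <- (RInt_trig 0 1 (Z.of_nat (S k))) by lia. apply RInt_ext. intros t _.
      rewrite <- INR_IZR_INZ. fold m. Rring. }
    assert (R1 : uc = PI * Re E) by lra. assert (R2 : us = - (PI * Im E)) by lra.
    rewrite R1, Rabs_mult, (Rabs_pos_eq PI) in B1 by lra.
    rewrite R2, Rabs_Ropp, Rabs_mult, (Rabs_pos_eq PI) in B2 by lra.
    (* The constant 4 is the sum of the constants 2 for the real and the imaginary part. *)
    assert (B1' : Rabs (Re E) <= 2 * (A - Re (e O))) by (apply Rmult_le_reg_l with PI; lra).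
    assert (B2' : Rabs (Im E) <= 2 * (A - Re (e O))) by (apply Rmult_le_reg_l with PI; lra).
    replace (Cmod (e (S k)) * r ^ S k) with (Cmod E).
    - eapply Rle_trans; [apply Cmod_le_sum|lra].
    - unfold E. rewrite Cmod_mult, Cmod_pow, Cmod_R, Rabs_pos_eq by lra. reflexivity. }
  assert (L : is_lim_seq (fun n => Cmod (e (S k)) * (rho * (1 - (/ 2) ^ S n)) ^ S k) (Cmod (e (S k)) * rho ^ S k)).
  { apply (is_lim_seq_scal_l _ _ (Finite _)).
    assert (L1 : is_lim_seq (fun n => rho * (1 - (/ 2) ^ S n)) rho).
    { replace (Finite rho) with (Rbar_mult rho (1 - 0)) by (simpl; f_equal; ring).
      apply is_lim_seq_scal_l. apply is_lim_seq_minus'; [apply is_lim_seq_const|].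
      apply (is_lim_seq_incr_1 (fun n => (/ 2) ^ n)). apply is_lim_seq_geom. rewrite Rabs_pos_eq; lra. }
    generalize (S k). intros j. induction j as [|j IH]; simpl; [apply is_lim_seq_const|].
    now apply is_lim_seq_mult'. }
  refine (is_lim_seq_le _ (fun _ => 4 * (A - Re (e O))) (Finite _) (Finite _) _ L (is_lim_seq_const _)).
  intros n. apply Main.
  assert (0 < (/ 2) ^ S n) by (apply pow_lt; lra).
  assert ((/ 2) ^ S n < 1) by (apply pow_lt_1_compat; [lra|lia]).
  split; nra.
Qed.

(** The logarithmic derivative [H] is analytic in the whole disc because the function has no zeros
    there. On a small circle its coefficient integrals are the coefficients of the derivative of
    [e]; moved to a circle of any radius below [R0], the same integrals bound these coefficients and
    so enlarge the radius of convergence of [e]. The exponential identity then spreads by the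
    identity theorem. *)
Lemma analytic_log (c e : nat -> C) (R0 eps : R) : 0 < eps <= R0 -> conv c R0 -> conv e eps ->
  (forall w, Cmod w < eps -> CPS c w = Cexp (CPS e w)) ->
  (forall w, Cmod w < R0 -> CPS c w <> RtoC 0) ->
  conv e R0 /\ forall w, Cmod w < R0 -> CPS c w = Cexp (CPS e w).
Proof.
  intros Heps Hc He Hexp Hnz. pose proof PI_RGT_0 as Hpi.
  set (F := CPS c). set (H := fun w => (CPS (deriv_coef c) w * / F w)%C).
  assert (DH : forall w, Cmod w < R0 -> ex_cderive H w).
  { intros w Hw. apply ex_cderive_mult.
    - apply ex_cderive_CPS with R0; [now apply conv_deriv|exact Hw].
    - apply ex_cderive_inv; [now apply ex_cderive_CPS with R0|now apply Hnz]. }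
  assert (Heq : forall w, Cmod w < eps -> H w = CPS (deriv_coef e) w).
  { intros w Hw.
    assert (D1 : cderive F w (CPS (deriv_coef c) w)) by (apply CPS_derive with R0; [exact Hc|lra]).
    assert (D2 : cderive F w (CPS (deriv_coef e) w * Cexp (CPS e w))%C).
    { apply (cderive_ext_loc (fun u => Cexp (CPS e u)) F w _ (eps - Cmod w)); [lra| |].
      - intros u Hu. symmetry. apply Hexp. pose proof (Cmod_triangle (u - w) w).
        replace (u - w + w)%C with u in H0 by ring. lra.
      - apply cderive_Cexp_comp, CPS_derive with eps; assumption. }
    unfold H. rewrite (cderive_unique F w _ _ D1 D2). unfold F. rewrite <- Hexp by exact Hw.
    rewrite <- Cmult_assoc, Cinv_r by (apply Hnz; lra). ring. }
  (* Cauchy's estimate. The bound on [H] over the circle is doubled because real and imaginary parts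
     are integrated separately. *)
  assert (Bound : forall r, 0 < r < R0 -> exists M, 0 <= M /\ forall k, Cmod (deriv_coef e k) * r ^ k <= M).
  { intros r Hr. destruct (circle_bounded H r) as (M & HM & KM); [lra|intros w Hw; apply DH; lra|].
    exists (2 * M). split; [lra|]. intros k.
    set (r0 := Rmin (eps / 2) r). assert (Hr0 : 0 < r0) by (apply Rmin_glb_lt; lra).
    assert (Hr0e : r0 <= eps / 2) by apply Rmin_l. assert (Hr0r : r0 <= r) by apply Rmin_r.
    assert (Hpow : forall s t, 0 < s -> (/ (circ s t ^ k))%C = (/ s ^ k * cis (- INR k * t))%C).
    { intros s t Hs.
      assert (N1 : RtoC s <> RtoC 0) by (intros X; apply RtoC_inj in X; lra).
      assert (N2 : (circ s t ^ k)%C <> RtoC 0).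
      { apply Cpow_nz. apply Cmod_gt_0. rewrite Cmod_circ; lra. }
      assert (X : (circ s t ^ k * (/ s ^ k * cis (- INR k * t)))%C = RtoC 1).
      { rewrite circ_pow.
        transitivity ((s ^ k * / s ^ k) * (cis (INR k * t) * cis (- INR k * t)))%C; [ring|].
        rewrite Cinv_r by now apply Cpow_nz. rewrite <- cis_plus.
        replace (INR k * t + - INR k * t) with 0 by ring. rewrite cis_0. ring. }
      rewrite <- (Cmult_1_r (/ (circ s t ^ k))), <- X, Cmult_assoc, Cinv_l by exact N2. ring. }
    assert (I : CInt (fun t => H (circ r t) * / (circ r t ^ k))%C = (2 * PI * deriv_coef e k)%C).
    { rewrite (circle_integral_const (fun w => H w * / (w ^ k))%C R0 r0 r); [|lra|lra|].
      - assert (N1 : RtoC r0 <> RtoC 0) by (intros X; apply RtoC_inj in X; lra).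
        pose proof (circle_coef_nonneg (deriv_coef e) eps r0 k (conv_deriv _ _ He) ltac:(lra)) as P.
        assert (Q : forall f, (forall t, continuous (fun s => Re (f s)) t /\ continuous (fun s => Im (f s)) t) ->
          forall x : R, CInt (fun t => x * f t)%C = (x * CInt f)%C).
        { intros f Hf x. apply C_ext.
          - rewrite re_scal_l, !Re_CInt.
            rewrite <- RInt_scal_R.
            + apply RInt_ext. intros t _. apply re_scal_l.
            + apply (ex_RInt_continuous (V := R_CompleteNormedModule)). intros t _; exact (proj1 (Hf t)).
          - rewrite im_scal_l, !Im_CInt.
            rewrite <- RInt_scal_R.
            + apply RInt_ext. intros t _. apply im_scal_l.
            + apply (ex_RInt_continuous (V := R_CompleteNormedModule)). intros t _; exact (proj2 (Hf t)). }
        transitivity (CInt (fun t => RtoC (/ r0 ^ k) * (CPS (deriv_coef e) (circ r0 t) * cis (- INR k * t)))%C).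
        + f_equal. apply functional_extensionality. intros t.
          rewrite Heq by (rewrite Cmod_circ; lra). rewrite Hpow by lra.
          rewrite RtoC_inv, RtoC_pow by (apply pow_nonzero; lra). ring.
        + rewrite Q, P.
          * rewrite RtoC_inv, RtoC_pow by (apply pow_nonzero; lra). field. now apply Cpow_nz.
          * intros t. apply (continuous_Cmult_cis (fun t => CPS (deriv_coef e) (circ r0 t))), circ_continuous; [lra|].
            apply ex_cderive_CPS with eps; [now apply conv_deriv|rewrite Cmod_circ; lra].
      - intros w Hw. apply ex_cderive_mult; [apply DH; lra|].
        apply (ex_cderive_inv (fun w => w ^ k)%C); [apply (ex_cderive_pow (fun w => w)), ex_cderive_id|].
        apply Cpow_nz, Cmod_gt_0. lra. }
    assert (Prk : 0 < r ^ k) by (apply pow_lt; lra).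
    assert (Hb : forall t, - PI <= t <= PI -> Cmod (H (circ r t) * / (circ r t ^ k))%C <= M / r ^ k).
    { intros t Ht. rewrite Cmod_mult, Cmod_inv by (apply Cpow_nz, Cmod_gt_0; rewrite Cmod_circ; lra).
      rewrite Cmod_pow, Cmod_circ by lra. apply Rmult_le_compat_r; [apply Rlt_le, Rinv_0_lt_compat, Prk|auto]. }
    assert (Hc2 : forall t, continuous (fun s => Re (H (circ r s) * / (circ r s ^ k))%C) t /\
                            continuous (fun s => Im (H (circ r s) * / (circ r s ^ k))%C) t).
    { intros t. apply (circ_continuous (fun w => H w * / (w ^ k))%C); [lra|].
      apply ex_cderive_mult; [apply DH; rewrite Cmod_circ; lra|].
      apply (ex_cderive_inv (fun w => w ^ k)%C); [apply (ex_cderive_pow (fun w => w)), ex_cderive_id|].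
      apply Cpow_nz, Cmod_gt_0. rewrite Cmod_circ; lra. }
    assert (B : Cmod (2 * PI * deriv_coef e k)%C <= (2 * PI) * (2 * M / r ^ k)).
    { rewrite <- I. eapply Rle_trans; [apply Cmod_le_sum|]. rewrite Re_CInt, Im_CInt.
      assert (B1 : Rabs (RInt (fun t => Re (H (circ r t) * / (circ r t ^ k))%C) (- PI) PI) <= (PI - - PI) * (M / r ^ k)).
      { apply (abs_RInt_le_const (fun t => Re (H (circ r t) * / (circ r t ^ k))%C)); [lra| |].
        - apply (ex_RInt_continuous (V := R_CompleteNormedModule)). intros t _; exact (proj1 (Hc2 t)).
        - intros t Ht. eapply Rle_trans; [apply re_le_Cmod|auto]. }
      assert (B2 : Rabs (RInt (fun t => Im (H (circ r t) * / (circ r t ^ k))%C) (- PI) PI) <= (PI - - PI) * (M / r ^ k)).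
      { apply (abs_RInt_le_const (fun t => Im (H (circ r t) * / (circ r t ^ k))%C)); [lra| |].
        - apply (ex_RInt_continuous (V := R_CompleteNormedModule)). intros t _; exact (proj2 (Hc2 t)).
        - intros t Ht. eapply Rle_trans; [apply im_le_Cmod|auto]. }
      unfold Rdiv in *. lra. }
    rewrite <- RtoC_mult, Cmod_mult, Cmod_R, Rabs_pos_eq in B by lra.
    apply Rmult_le_reg_l in B; [|lra].
    apply Rmult_le_compat_r with (r := r ^ k) in B; [|lra].
    unfold Rdiv in B. rewrite !Rmult_assoc, Rinv_l, Rmult_1_r in B by lra. exact B. }
  assert (Ce : conv e R0).
  { intros r Hr. set (s := (r + R0) / 2). assert (Hs : 0 < s < R0) by (unfold s; lra).
    assert (Hrs : r < s) by (unfold s; lra).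
    destruct (Bound s Hs) as (M & HM & KM).
    apply ex_series_incr_1.
    assert (G : ex_series (fun k => (r / s) ^ k)).
    { exists (/ (1 - r / s)). apply is_series_geom. rewrite Rabs_pos_eq.
      - apply Rmult_lt_reg_r with s; [lra|]. unfold Rdiv. rewrite Rmult_assoc, Rinv_l, Rmult_1_r; lra.
      - apply Rmult_le_pos; [lra|]. apply Rlt_le, Rinv_0_lt_compat; lra. }
    apply ex_series_comp with (fun k => (r * M) * (r / s) ^ k); [|exact (ex_series_scal_l (r * M) _ G)].
    intros k. assert (P1 : 0 <= r ^ k) by (apply pow_le; lra). assert (P2 : 0 < s ^ k) by (apply pow_lt; lra).
    pose proof (Cmod_ge_0 (e (S k))) as P3.
    split; [apply Rmult_le_pos; [exact P3|apply pow_le; lra]|].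
    specialize (KM k).
    assert (E1 : Cmod (e (S k)) <= Cmod (deriv_coef e k)).
    { unfold deriv_coef. rewrite Cmod_mult, Cmod_R, Rabs_pos_eq by apply pos_INR.
      assert (1 <= INR (S k)) by (rewrite S_INR; pose proof (pos_INR k); lra). nra. }
    assert (E2 : Cmod (e (S k)) * s ^ k <= M).
    { eapply Rle_trans; [|exact KM]. apply Rmult_le_compat_r; [lra|exact E1]. }
    assert (E3 : Cmod (e (S k)) <= M / s ^ k).
    { apply Rmult_le_reg_r with (s ^ k); [exact P2|]. unfold Rdiv. rewrite Rmult_assoc, Rinv_l, Rmult_1_r; lra. }
    unfold Rdiv at 1. rewrite Rpow_mult_distr, pow_inv. simpl.
    apply Rle_trans with (M / s ^ k * (r * r ^ k)).
    - apply Rmult_le_compat_r; [apply Rmult_le_pos; lra|exact E3].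
    - right. unfold Rdiv. ring. }
  split; [exact Ce|].
  intros w Hw. apply (identity_theorem (CPS c) (fun w => Cexp (CPS e w)) R0 eps); try assumption; try lra.
  - intros z Hz. now apply ex_cderive_CPS with R0.
  - intros z Hz. apply (ex_cderive_comp Cexp (CPS e)); [eexists; apply cderive_Cexp|].
    now apply ex_cderive_CPS with R0.
Qed.

(** * The Euler product *)


Notation isprime p := (prime.prime p).

Lemma dvdn_mod (p n : nat) : p <> 0%nat -> div.dvdn p n = Nat.eqb (n mod p) 0.
Proof.
  intros Hp. apply eq_true_iff_eq. rewrite Nat.eqb_eq, Nat.Div0.mod_divides. split.
  - intros H. destruct (ssrbool.elimT div.dvdnP H) as [k Hk]. exists k.
    rewrite Hk. change (ssrnat.muln k p) with (k * p)%nat. lia.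
  - intros [k Hk]. apply (ssrbool.introT div.dvdnP). exists k.
    change (ssrnat.muln k p) with (k * p)%nat. lia.
Qed.

Lemma prime_ge_2 p : isprime p = true -> (2 <= p)%nat.
Proof.
  intros H. destruct p as [|[|p]]; [discriminate H|discriminate H|lia].
Qed.

Lemma leq_le m n : ssrnat.leq m n = true <-> (m <= n)%nat.
Proof.
  split; intros H; [now apply (ssrbool.elimT ssrnat.leP)|now apply (ssrbool.introT ssrnat.leP)].
Qed.

Lemma has_prime_divisor n : (2 <= n)%nat -> exists p, isprime p = true /\ div.dvdn p n = true /\ (p <= n)%nat.
Proof.
  intros Hn. exists (prime.pdiv n). split; [|split].
  - apply prime.pdiv_prime. apply leq_le. lia.
  - apply prime.pdiv_dvd.
  - apply leq_le. apply prime.pdiv_leq. apply leq_le. lia.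
Qed.

Lemma prime_divides_mul p m n : isprime p = true -> div.dvdn p (m * n) = div.dvdn p m || div.dvdn p n.
Proof. intros H. exact (prime.Euclid_dvdM m n H). Qed.

Lemma distinct_primes_not_dvd p l : isprime p = true -> isprime l = true -> p <> l -> div.dvdn p l = false.
Proof.
  intros Hp Hl Hne. rewrite prime.dvdn_prime2 by assumption.
  apply not_true_iff_false. intros H. apply Hne. exact (ssrbool.elimT eqtype.eqP H).
Qed.

Fixpoint rough (P n : nat) : bool :=
  match P with O => true | S Q => rough Q n && negb (isprime Q && div.dvdn Q n) end.

Lemma rough_prime_mul P l n : isprime l = true -> (P <= l)%nat -> rough P (l * n) = rough P n.
Proof.
  intros Hl. induction P as [|P IH]; intros HP; [reflexivity|]. simpl.
  rewrite IH by lia. f_equal. f_equal.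
  destruct (isprime P) eqn:E; [|reflexivity]. simpl.
  rewrite prime_divides_mul, distinct_primes_not_dvd by (assumption || lia). reflexivity.
Qed.

Lemma rough_small P n : (2 <= n < P)%nat -> rough P n = false.
Proof.
  intros [Hn HP]. destruct (has_prime_divisor n Hn) as (p & Hp & Hd & Hle).
  assert (G : forall Q, (p < Q)%nat -> rough Q n = false); [|apply G; lia].
  intros Q. induction Q as [|Q IH]; intros HQ; [lia|]. simpl.
  destruct (Nat.eq_dec Q p) as [->|].
  - rewrite Hp, Hd. simpl. apply andb_false_r.
  - rewrite IH by lia. reflexivity.
Qed.

Lemma rough_1 P : rough P 1 = true.
Proof.
  induction P as [|P IH]; [reflexivity|]. simpl. rewrite IH. simpl.
  destruct (isprime P) eqn:E; [|reflexivity]. pose proof (prime_ge_2 P E). simpl.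
  rewrite dvdn_mod by lia. rewrite Nat.mod_small by lia. reflexivity.
Qed.

Lemma multiples_sum (g : nat -> C) (P : nat) : (0 < P)%nat -> asum g ->
  asum (fun m => g (P * m)%nat) /\
  CSer (fun m => g (P * m)%nat) = CSer (fun n => if Nat.eqb (n mod P) 0 then g n else RtoC 0).
Proof.
  intros HP Hg.
  set (A := fun n m => if Nat.eqb n (P * m) then g (P * m)%nat else RtoC 0).
  set (h := fun n => if Nat.eqb (n mod P) 0 then g n else RtoC 0).
  assert (EA : forall n m, A n m = if Nat.eqb m (n / P) then h n else RtoC 0).
  { intros n m. unfold A, h. destruct (Nat.eqb_spec n (P * m)) as [E|E].
    - rewrite <- E. replace (n / P)%nat with m.
      + rewrite Nat.eqb_refl. replace (n mod P)%nat with 0%nat; [reflexivity|].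
        rewrite E, Nat.mul_comm, Nat.Div0.mod_mul. reflexivity.
      + rewrite E, Nat.mul_comm, Nat.div_mul by lia. reflexivity.
    - destruct (Nat.eqb_spec m (n / P)) as [Hm|]; [|reflexivity].
      destruct (Nat.eqb_spec (n mod P) 0) as [Hn|]; [|reflexivity].
      exfalso. apply E. rewrite Hm. pose proof (Nat.div_mod_eq n P). lia. }
  assert (D : forall n, asum (A n) /\ Series (fun m => Cmod (A n m)) = Cmod (h n) /\ CSer (A n) = h n).
  { intros n. replace (A n) with (fun m => if Nat.eqb m (n / P) then h n else RtoC 0).
    - apply asum_single.
    - apply functional_extensionality. intros m. now rewrite EA. }
  assert (Hh : asum h).
  { apply asum_le with (fun n => Cmod (g n)); [|exact Hg]. intros n. unfold h.
    destruct Nat.eqb; [lra|rewrite Cmod_0; apply Cmod_ge_0]. }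
  destruct (fubini_C A (fun n => proj1 (D n))) as (_ & F2 & F3).
  { apply (ex_series_extR _ _ (fun n => eq_sym (proj1 (proj2 (D n))))). exact Hh. }
  assert (D2 : forall m, Series (fun n => Cmod (A n m)) = Cmod (g (P * m)%nat) /\ CSer (fun n => A n m) = g (P * m)%nat).
  { intros m. apply (asum_single (P * m)%nat (g (P * m)%nat)). }
  split.
  - exact (ex_series_extR _ _ (fun m => proj1 (D2 m)) F2).
  - rewrite <- (CSer_ext _ _ (fun m => proj2 (D2 m))), F3. apply CSer_ext. intros n. apply D.
Qed.

(** Needed to pass from finite products of local factors to the exponential of the full prime
    sum. *)
Lemma clim_Cexp (u : nat -> C) (l : C) : clim u l -> clim (fun n => Cexp (u n)) (Cexp l).
Proof.
  intros H. apply clim_Cmod in H. apply clim_Cmod. apply is_lim_seq_spec. intros eps.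
  apply is_lim_seq_spec in H.
  destruct (cderive_continuous Cexp l _ (cderive_Cexp l) eps (cond_pos eps)) as (d & Hd & K).
  destruct (H (mkposreal d Hd)) as [N HN]. exists N. intros n Hn. specialize (HN n Hn). simpl in HN.
  rewrite Rminus_0_r, Rabs_pos_eq in * by apply Cmod_ge_0.
  specialize (K (u n - l)%C HN). now replace (l + (u n - l))%C with (u n) in K by ring.
Qed.

Definition prime_log (t : nat -> C) (p k : nat) : C :=
  if isprime p then (logcoef k * t p ^ k)%C else RtoC 0.

Section EulerProduct.

Variable t : nat -> C.
Hypothesis t0 : t 0%nat = RtoC 0.
Hypothesis t1 : t 1%nat = RtoC 1.
Hypothesis tmul : forall m n, t (m * n)%nat = (t m * t n)%C.
Hypothesis thalf : forall p, isprime p = true -> Cmod (t p) <= / 2.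
Hypothesis tsum : asum t.

Let g P n := if rough P n then t n else RtoC 0.

Lemma g_asum P : asum (g P).
Proof.
  apply asum_le with (fun n => Cmod (t n)); [|exact tsum]. intros n. unfold g.
  destruct rough; [lra|rewrite Cmod_0; apply Cmod_ge_0].
Qed.

(** Among the numbers without prime factors below the prime [P], the multiples of [P] are [P] times
    the numbers of the same kind. Removing them multiplies the sum by [1 - t P]. *)
Lemma sieve_step P : CSer (g (S P)) = (CSer (g P) * (1 - (if isprime P then t P else 0)))%C.
Proof.
  destruct (isprime P) eqn:E.
  - pose proof (prime_ge_2 P E) as HP.
    destruct (multiples_sum (g P) P ltac:(lia) (g_asum P)) as [M1 M2].
    assert (Eg : forall m, g P (P * m) = (t P * g P m)%C).
    { intros m. unfold g. rewrite rough_prime_mul by (assumption || lia).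
      destruct (rough P m); [apply tmul|ring]. }
    rewrite (CSer_ext _ _ Eg), CSer_scal in M2 by apply g_asum.
    assert (Es : CSer (g P) = (CSer (g (S P)) + CSer (fun n => if Nat.eqb (n mod P) 0 then g P n else RtoC 0))%C).
    { rewrite <- CSer_plus.
      - apply CSer_ext. intros n. unfold g. simpl. rewrite E. simpl. rewrite dvdn_mod by lia.
        destruct (rough P n), (Nat.eqb (n mod P) 0); simpl; ring.
      - apply g_asum.
      - apply asum_le with (fun n => Cmod (g P n)); [|apply g_asum]. intros n.
        destruct Nat.eqb; [lra|rewrite Cmod_0; apply Cmod_ge_0]. }
    rewrite <- M2 in Es. replace (CSer (g (S P))) with (CSer (g P) - t P * CSer (g P))%C; [ring|].
    rewrite Es at 1. ring.
  - replace (CSer (g (S P))) with (CSer (g P)); [ring|]. apply CSer_ext. intros n. unfold g. simpl.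
    rewrite E. simpl. now rewrite andb_true_r.
Qed.

(** Apart from 0 and 1, a number without prime factors below [P] is at least [P]. The deviation from
    [t 1 = 1] is therefore at most a tail of the series. *)
Lemma sieve_limit : clim (fun P => CSer (g P)) (RtoC 1).
Proof.
  apply clim_Cmod.
  assert (Sv : is_lim_seq (fun P => Series (fun n => Cmod (t n)) - rsum (fun n => Cmod (t n)) P) 0).
  { replace (Finite 0) with (Finite (Series (fun n => Cmod (t n)) - Series (fun n => Cmod (t n)))) by (f_equal; ring).
    apply is_lim_seq_minus'; [apply is_lim_seq_const|now apply Series_lim]. }
  apply is_lim_seq_incr_n with 2%nat. apply (is_lim_seq_incr_n _ 2) in Sv.
  refine (is_lim_seq_le_le (fun _ => 0) _ _ _ _ (is_lim_seq_const 0) Sv).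
  intros n. set (P := (n + 2)%nat). split; [apply Cmod_ge_0|].
  set (d := fun n => (g P n + -(1) * (if Nat.eqb n 1 then RtoC 1 else RtoC 0))%C).
  destruct (asum_single 1 (RtoC 1)) as (S1 & _ & S3).
  assert (Ed : (CSer (g P) - 1)%C = CSer d).
  { unfold d. rewrite CSer_plus by (apply g_asum || now apply asum_scal).
    rewrite CSer_scal, S3 by exact S1. ring. }
  rewrite Ed.
  set (b := fun n => if Nat.ltb n P then 0 else Cmod (t n)).
  assert (Hb0 : forall n, 0 <= b n) by (intros m; unfold b; destruct Nat.ltb; [lra|apply Cmod_ge_0]).
  assert (Hb : forall m, rsum b m <= Series (fun n => Cmod (t n)) - rsum (fun n => Cmod (t n)) P).
  { intros m.
    (* The maximum with 0 covers [m < P], where the difference of partial sums is not positive. *)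
    assert (X : rsum b m <= Rmax 0 (rsum (fun n => Cmod (t n)) m - rsum (fun n => Cmod (t n)) P)).
    { induction m as [|m IH]; [apply Rmax_l|]. cbn [rsum]. unfold b at 2.
      destruct (Nat.ltb_spec m P) as [L|L].
      - rewrite Rplus_0_r. eapply Rle_trans; [exact IH|]. apply Rmax_case; [apply Rmax_l|].
        eapply Rle_trans; [|apply Rmax_r]. pose proof (Cmod_ge_0 (t m)). lra.
      - pose proof (rsum_mono (fun n => Cmod (t n)) P m (fun n => Cmod_ge_0 _) L) as Mo.
        rewrite Rmax_right in IH by lra. eapply Rle_trans; [|apply Rmax_r]. lra. }
    eapply Rle_trans; [exact X|]. apply Rmax_case.
    - pose proof (rsum_le_Series (fun n => Cmod (t n)) P (fun n => Cmod_ge_0 _) tsum). lra.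
    - pose proof (rsum_le_Series (fun n => Cmod (t n)) m (fun n => Cmod_ge_0 _) tsum). lra. }
  destruct (nonneg_summable b _ Hb0 Hb) as [Sb1 Sb2].
  eapply Rle_trans; [|exact Sb2]. apply CSer_bound; [|exact Sb1].
  intros m. unfold d, b, g.
  destruct (Nat.eqb_spec m 1) as [->|H1].
  - rewrite rough_1, t1. replace (1 + - (1) * 1)%C with (RtoC 0) by ring. rewrite Cmod_0.
    destruct Nat.ltb; [lra|apply Cmod_ge_0].
  - replace (- (1) * 0)%C with (RtoC 0) by ring. rewrite Cplus_0_r.
    destruct (Nat.ltb_spec m P) as [L|L].
    + destruct (Nat.eq_dec m 0) as [->|H0].
      * rewrite t0. destruct rough; rewrite Cmod_0; lra.
      * rewrite rough_small by lia. rewrite Cmod_0. lra.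
    + destruct rough; [lra|rewrite Cmod_0; apply Cmod_ge_0].
Qed.

Lemma prime_log_row p : asum (prime_log t p) /\ Series (fun k => Cmod (prime_log t p k)) <= 2 * Cmod (t p) /\
  (CSer (prime_log t p) = if isprime p then CPS logcoef (t p) else RtoC 0).
Proof.
  unfold prime_log. destruct (isprime p) eqn:E.
  - specialize (thalf p E). pose proof (Cmod_ge_0 (t p)) as P0.
    assert (A : asum (fun k => logcoef k * t p ^ k)%C) by (apply conv_asum with 1; [apply conv_logcoef|lra]).
    split; [exact A|]. split; [|reflexivity].
    rewrite Series_incr_1 by exact A. simpl (Cmod (logcoef 0 * _)). rewrite Cmult_0_l, Cmod_0, Rplus_0_l.
    assert (G : is_series (fun k => Cmod (t p) * Cmod (t p) ^ k) (Cmod (t p) * / (1 - Cmod (t p)))).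
    { apply (is_series_scal_l (K := R_AbsRing) (V := R_NormedModule) (Cmod (t p))), is_series_geom. rewrite Rabs_pos_eq; lra. }
    apply Rle_trans with (Series (fun k => Cmod (t p) * Cmod (t p) ^ k)).
    + apply Series_le; [|eexists; exact G]. intros k. split; [apply Cmod_ge_0|].
      rewrite Cmod_mult, Cmod_pow. pose proof (Cmod_logcoef (S k)). pose proof (Cmod_ge_0 (logcoef (S k))).
      assert (0 <= Cmod (t p) ^ S k) by (apply pow_le; lra). simpl in *. nra.
    + rewrite (is_series_unique _ _ G). rewrite (Rmult_comm 2). apply Rmult_le_compat_l; [lra|].
      replace 2 with (/ (1 - / 2)) by field. apply Rinv_le_contravar; lra.
  - split; [apply asum_zero|]. split; [|apply CSer_zero].
    pose proof (Cmod_ge_0 (t p)).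
    destruct (nonneg_summable (fun _ => Cmod (RtoC 0)) 0) as [_ X]; [intros; apply Cmod_ge_0| |lra].
    intros n. induction n as [|n IH]; simpl; [lra|rewrite Cmod_0; rewrite Cmod_0 in IH; lra].
Qed.

Lemma prime_log_summable : ex_series (fun p => Series (fun k => Cmod (prime_log t p k))).
Proof.
  apply ex_series_comp with (fun p => 2 * Cmod (t p)).
  - intros p. destruct (prime_log_row p) as (A & B & _). split; [|exact B].
    apply Series_nonneg; [intros; apply Cmod_ge_0|exact A].
  - exact (ex_series_scal_l 2 _ tsum).
Qed.

(** The sieved sum times the exponential of the logarithms already removed is constant, which is
    [Inv], and the first factor tends to 1. Listing the logarithms by Cantor's pairing makes the
    exponent a generalized Dirichlet series in one index, to which the Taylor expansion applies. *)
Theorem euler_product :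
  asum (fun i => prime_log t (fst (Cantor.of_nat i)) (snd (Cantor.of_nat i))) /\
  CSer t = Cexp (CSer (fun i => prime_log t (fst (Cantor.of_nat i)) (snd (Cantor.of_nat i)))).
Proof.
  destruct (flatten_C (prime_log t) (fun p => proj1 (prime_log_row p)) prime_log_summable) as [F1 F2].
  split; [exact F1|]. rewrite F2.
  set (l := fun p => CSer (prime_log t p)).
  assert (Al : asum l).
  { apply asum_le with (fun p => Series (fun k => Cmod (prime_log t p k))); [|apply prime_log_summable].
    intros p. apply CSer_norm, prime_log_row. }
  assert (Inv : forall P, (CSer (g P) * Cexp (csum l P))%C = CSer t).
  { intros P. induction P as [|P IH].
    - simpl. rewrite Cexp_0, Cmult_1_r. apply CSer_ext. reflexivity.
    - rewrite sieve_step. cbn [csum]. rewrite Cexp_plus, <- IH.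
      assert (X : ((1 - (if isprime P then t P else 0)) * Cexp (l P))%C = RtoC 1).
      { unfold l. rewrite (proj2 (proj2 (prime_log_row P))). destruct (isprime P) eqn:E.
        - rewrite Cmult_comm. apply Cexp_log. specialize (thalf P E). lra.
        - rewrite Cexp_0. ring. }
      transitivity (CSer (g P) * Cexp (csum l P) * ((1 - (if isprime P then t P else 0)) * Cexp (l P)))%C; [ring|].
      rewrite X. ring. }
  apply clim_unique with (fun P => CSer (g P) * Cexp (csum l P))%C.
  - apply clim_ext with (fun _ => CSer t); [intros; now rewrite Inv|apply clim_const].
  - rewrite <- (Cmult_1_l (Cexp (CSer l))). apply clim_mult; [apply sieve_limit|].
    now apply clim_Cexp, CSer_lim.
Qed.

End EulerProduct.

(** * Partial summation *)


(** Index [n] stands for the integer [S n], so every Dirichlet series starts at index 0 and all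
    frequencies are nonnegative. *)
Definition lnS (n : nat) : R := ln (INR (S n)).

Lemma INR_S_pos n : 0 < INR (S n).
Proof. apply lt_0_INR. lia. Qed.

Lemma lnS_nonneg n : 0 <= lnS n.
Proof.
  unfold lnS. rewrite <- ln_1. apply Rcomplements.ln_le; [lra|].
  rewrite S_INR. pose proof (pos_INR n). lra.
Qed.

Lemma exp_lnS n : exp (lnS n) = INR (S n).
Proof. apply exp_ln, INR_S_pos. Qed.

Lemma exp_opp_lnS n : exp (- lnS n) = / INR (S n).
Proof. now rewrite exp_Ropp, exp_lnS. Qed.

Lemma exp_ge_1_plus x : 1 + x <= exp x.
Proof.
  destruct (Req_dec x 0) as [->|H]; [rewrite exp_0; lra|]. left. now apply exp_ineq1.
Qed.

Lemma exp_le_compat x y : x <= y -> exp x <= exp y.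
Proof. intros [H|H]; [left; now apply exp_increasing|rewrite H; lra]. Qed.

Lemma lnS_step n : lnS (S n) - lnS n <= exp (- lnS n) /\ exp (- lnS (S n)) <= lnS (S n) - lnS n.
Proof.
  split.
  - pose proof (exp_ge_1_plus (lnS (S n) - lnS n)) as H.
    unfold Rminus in H at 2. rewrite exp_plus, exp_opp_lnS, exp_lnS in H.
    rewrite exp_opp_lnS. rewrite (S_INR (S n)) in H. pose proof (INR_S_pos n).
    replace ((INR (S n) + 1) * / INR (S n)) with (1 + / INR (S n)) in H by (field; lra). lra.
  - pose proof (exp_ge_1_plus (lnS n - lnS (S n))) as H.
    unfold Rminus in H at 2. rewrite exp_plus, exp_opp_lnS, exp_lnS in H.
    rewrite exp_opp_lnS. rewrite (S_INR (S n)) in *. pose proof (INR_S_pos n).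
    replace (INR (S n) * / (INR (S n) + 1)) with (1 - / (INR (S n) + 1)) in H by (field; lra). lra.
Qed.

Lemma lnS_incr n : lnS n <= lnS (S n).
Proof. destruct (lnS_step n) as [_ H]. pose proof (exp_pos (- lnS (S n))). lra. Qed.

Lemma zeta_partial (sigma : R) n : 1 < sigma -> rsum (fun k => exp (- sigma * lnS k)) n <= 1 + / (sigma - 1).
Proof.
  intros Hs.
  assert (G : forall n, rsum (fun k => exp (- sigma * lnS k)) (S n) <=
     1 + / (sigma - 1) * (1 - exp (- (sigma - 1) * lnS n))).
  { clear n. induction n as [|n IH].
    - simpl. unfold lnS. simpl. rewrite ln_1, !Rmult_0_r, exp_0. lra.
    - cbn [rsum] in *. destruct (lnS_step n) as [_ H].
      set (u := lnS n) in *. set (v := lnS (S n)) in *.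
      (* Comparison with the integral of [x ^ - sigma], in a form that telescopes;
         [exp (- v) <= v - u] is the arithmetic input. *)
      assert (K : exp (- sigma * v) <= / (sigma - 1) * (exp (- (sigma - 1) * u) - exp (- (sigma - 1) * v))).
      { apply Rmult_le_reg_l with (sigma - 1); [lra|]. rewrite <- Rmult_assoc, Rinv_r, Rmult_1_l by lra.
        replace (- (sigma - 1) * u) with ((sigma - 1) * (v - u) + - (sigma - 1) * v) by ring.
        replace (- sigma * v) with (- v + - (sigma - 1) * v) by ring. rewrite !exp_plus.
        pose proof (exp_ge_1_plus ((sigma - 1) * (v - u))).
        pose proof (exp_pos (- (sigma - 1) * v)) as Pz. set (z := exp (- (sigma - 1) * v)) in *.
        assert ((sigma - 1) * exp (- v) <= exp ((sigma - 1) * (v - u)) - 1) by nra.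
        nra. }
      lra. }
  assert (Hi : 0 < / (sigma - 1)) by (apply Rinv_0_lt_compat; lra).
  destruct n as [|n]; [simpl; lra|]. eapply Rle_trans; [apply G|].
  pose proof (exp_pos (- (sigma - 1) * lnS n)). nra.
Qed.

Lemma zeta_summable (sigma : R) : 1 < sigma ->
  ex_series (fun k => exp (- sigma * lnS k)) /\ Series (fun k => exp (- sigma * lnS k)) <= 1 + / (sigma - 1).
Proof.
  intros Hs. apply nonneg_summable; [intros; apply Rlt_le, exp_pos|]. intros n; now apply zeta_partial.
Qed.

Lemma bounded_dirichlet_summable (a : nat -> C) (A sigma : R) : 1 < sigma -> (forall n, Cmod (a n) <= A) ->
  ex_series (fun n => Cmod (a n) * exp (- lnS n * sigma)).
Proof.
  intros Hs Ha. apply ex_series_comp with (fun n => A * exp (- sigma * lnS n)).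
  - intros n. replace (- lnS n * sigma) with (- sigma * lnS n) by ring.
    pose proof (exp_pos (- sigma * lnS n)).
    split; [apply Rmult_le_pos; [apply Cmod_ge_0|lra]|apply Rmult_le_compat_r; [lra|apply Ha]].
  - exact (ex_series_scal_l A _ (proj1 (zeta_summable sigma Hs))).
Qed.


Lemma abel_bound (a d : nat -> C) (Q : R) N : (forall n, Cmod (csum a n) <= Q) ->
  Cmod (csum (fun n => a n * d n)%C N) <= Q * (Cmod (d N) + rsum (fun n => Cmod (d n - d (S n))) N).
Proof.
  intros HQ.
  assert (E : csum (fun n => a n * d n)%C N = (csum a N * d N + csum (fun n => csum a (S n) * (d n - d (S n))) N)%C).
  { induction N as [|N IH]; [simpl; ring|]. cbn [csum] in *. rewrite IH. ring. }
  rewrite E. eapply Rle_trans; [apply Cmod_triangle|]. rewrite Rmult_plus_distr_l. apply Rplus_le_compat.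
  - rewrite Cmod_mult. apply Rmult_le_compat_r; [apply Cmod_ge_0|apply HQ].
  - eapply Rle_trans; [apply Cmod_csum_le|]. rewrite <- rsum_scal. apply rsum_le. intros n _.
    rewrite Cmod_mult. apply Rmult_le_compat_r; [apply Cmod_ge_0|apply HQ].
Qed.

Lemma exp_opp_diff_bound x : 0 <= x -> 0 <= 1 - exp (- x) <= x.
Proof.
  intros Hx. pose proof (exp_ge_1_plus (- x)).
  assert (exp (- x) <= exp 0) by (apply exp_le_compat; lra). rewrite exp_0 in *. lra.
Qed.

Lemma Rabs_sin_le x : Rabs (sin x) <= Rabs x.
Proof.
  destruct (MVT_abs sin cos 0 x) as (c & Hc & _); [intros; apply derivable_pt_lim_sin|].
  rewrite sin_0, !Rminus_0_r in Hc. rewrite Hc. rewrite <- (Rmult_1_l (Rabs x)) at 2.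
  apply Rmult_le_compat_r; [apply Rabs_pos|apply Rabs_le, COS_bound].
Qed.

Lemma Rabs_cos_sub_1_le x : Rabs (cos x - 1) <= Rabs x.
Proof.
  destruct (MVT_abs cos (fun t => - sin t) 0 x) as (c & Hc & _); [intros; apply derivable_pt_lim_cos|].
  rewrite cos_0, !Rminus_0_r in Hc. rewrite Hc. rewrite <- (Rmult_1_l (Rabs x)) at 2.
  apply Rmult_le_compat_r; [apply Rabs_pos|]. rewrite Rabs_Ropp. apply Rabs_le, SIN_bound.
Qed.

Lemma Cexp_opp_sub_1_le (z : C) : 0 <= Re z -> Cmod (1 - Cexp (- z)) <= 4 * Cmod z.
Proof.
  intros Hz. eapply Rle_trans; [apply Cmod_le_sum|].
  pose proof (re_le_Cmod z) as Bx. pose proof (im_le_Cmod z) as By.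
  destruct (exp_opp_diff_bound (Re z) Hz) as [E1 E2].
  rewrite Rabs_pos_eq in Bx by exact Hz. pose proof (exp_pos (- Re z)) as Pe.
  pose proof (Rabs_sin_le (- Im z)) as S1. pose proof (Rabs_cos_sub_1_le (- Im z)) as S2. rewrite !Rabs_Ropp in S1, S2.
  assert (R1 : Re (1 - Cexp (- z))%C = (1 - exp (- Re z)) - exp (- Re z) * (cos (- Im z) - 1)).
  { unfold Cexp. change (Re (- z)%C) with (- Re z). change (Im (- z)%C) with (- Im z). simpl. ring. }
  assert (I1 : Im (1 - Cexp (- z))%C = - (exp (- Re z) * sin (- Im z))).
  { unfold Cexp. change (Re (- z)%C) with (- Re z). change (Im (- z)%C) with (- Im z). simpl. ring. }
  rewrite R1, I1, Rabs_Ropp.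
  assert (A1 : Rabs (exp (- Re z) * sin (- Im z)) <= Cmod z).
  { rewrite Rabs_mult, (Rabs_pos_eq (exp _)) by lra. pose proof (Rabs_pos (sin (- Im z))). nra. }
  assert (A2 : Rabs (exp (- Re z) * (cos (- Im z) - 1)) <= Cmod z).
  { rewrite Rabs_mult, (Rabs_pos_eq (exp _)) by lra. pose proof (Rabs_pos (cos (- Im z) - 1)). nra. }
  apply Rabs_le_between in A2.
  assert (Rabs ((1 - exp (- Re z)) - exp (- Re z) * (cos (- Im z) - 1)) <= 2 * Cmod z) by (apply Rabs_le; lra).
  lra.
Qed.

(** * Taylor coefficients of exponentials, summed over the degree *)

Lemma exp_partial_le (x : R) m : 0 <= x -> rsum (fun k => / INR (Factorial.fact k) * x ^ k) m <= exp x.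
Proof.
  intros Hx. rewrite <- (is_series_unique _ _ (exp_series x)). apply rsum_le_Series.
  - intros k. apply Rmult_le_pos; [apply Rlt_le, Rinv_0_lt_compat, INR_fact_lt_0|now apply pow_le].
  - eexists; apply exp_series.
Qed.

Lemma exp_partial_diff_le (x y : R) m : 0 <= x <= y ->
  rsum (fun k => / INR (Factorial.fact k) * (y ^ k - x ^ k)) m <= exp y - exp x.
Proof.
  intros Hx.
  assert (S : is_series (fun k => / INR (Factorial.fact k) * y ^ k - / INR (Factorial.fact k) * x ^ k) (exp y - exp x)).
  { exact (is_series_minus _ _ _ _ (exp_series y) (exp_series x)). }
  rewrite <- (is_series_unique _ _ S).
  rewrite (rsum_ext _ (fun k => / INR (Factorial.fact k) * y ^ k - / INR (Factorial.fact k) * x ^ k)) by (intros; ring).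
  apply rsum_le_Series; [|eexists; exact S].
  intros k. assert (x ^ k <= y ^ k) by (apply pow_incr; exact Hx).
  pose proof (Rinv_0_lt_compat _ (INR_fact_lt_0 k)). nra.
Qed.

(* The k-th Taylor coefficient at [s] of [exp (- s x)]. *)
Definition expterm (s : C) (x : R) (k : nat) : C := (Cexp (- s * x) * (expcoef k * (- x) ^ k))%C.

Lemma Cmod_expterm s x k : 0 <= x -> Cmod (expterm s x k) = exp (- Re s * x) * (/ INR (Factorial.fact k) * x ^ k).
Proof.
  intros Hx. unfold expterm. rewrite !Cmod_mult, Cmod_Cexp, Cmod_expcoef, Cmod_pow, Cmod_opp, Cmod_R, Rabs_pos_eq by exact Hx.
  rewrite re_scal_r. reflexivity.
Qed.

Lemma expterm_sum_le s x r m : 0 <= x -> 0 <= r ->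
  rsum (fun k => Cmod (expterm s x k) * r ^ k) m <= exp (- (Re s - r) * x).
Proof.
  intros Hx Hr.
  rewrite (rsum_ext _ (fun k => exp (- Re s * x) * (/ INR (Factorial.fact k) * (r * x) ^ k))).
  2:{ intros k _. rewrite Cmod_expterm, Rpow_mult_distr by exact Hx. ring. }
  rewrite rsum_scal. replace (- (Re s - r) * x) with (- Re s * x + r * x) by ring. rewrite exp_plus.
  apply Rmult_le_compat_l; [apply Rlt_le, exp_pos|]. apply exp_partial_le. now apply Rmult_le_pos.
Qed.

(** The difference of two products is split in two. The exponential factor varies, relative to its
    value at [x], by at most [4 * Cmod s * (y - x)]; the powers, summed against [r ^ k], become a
    difference of two real exponentials. The linear growth in [Cmod s] of the later bound on [L]
    originates here. *)
Lemma expterm_diff_sum_le s x y r m : 0 <= x <= y -> 0 <= r -> 0 <= Re s ->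
  rsum (fun k => Cmod (expterm s x k - expterm s y k) * r ^ k) m <=
  (y - x) * (4 * Cmod s * exp (- (Re s - r) * x) + r * exp (- (Re s - r) * y)).
Proof.
  intros Hx Hr Hs. set (l := y - x). assert (Hl : 0 <= l) by (unfold l; lra).
  apply Rle_trans with
    (rsum (fun k => (4 * Cmod s * l * exp (- Re s * x)) * (/ INR (Factorial.fact k) * (r * x) ^ k) +
       exp (- Re s * y) * (/ INR (Factorial.fact k) * ((r * y) ^ k - (r * x) ^ k))) m).
  - apply rsum_le. intros k _.
    pose proof (Rinv_0_lt_compat _ (INR_fact_lt_0 k)) as Pf. set (f := / INR (Factorial.fact k)) in *.
    assert (Prk : 0 <= r ^ k) by now apply pow_le.
    rewrite !Rpow_mult_distr.
    replace (expterm s x k - expterm s y k)%C with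
      (Cexp (- s * x) * (1 - Cexp (- (s * l))) * (expcoef k * (- x) ^ k) +
       Cexp (- s * y) * (expcoef k * ((- x) ^ k - (- y) ^ k)))%C.
    2:{ unfold expterm. replace (Cexp (- s * y)) with (Cexp (- s * x) * Cexp (- (s * l)))%C; [ring|].
        rewrite <- Cexp_plus. f_equal. unfold l. rewrite RtoC_minus. ring. }
    assert (B1 : Cmod (Cexp (- s * x) * (1 - Cexp (- (s * l))) * (expcoef k * (- x) ^ k)) <=
       exp (- Re s * x) * (4 * (Cmod s * l)) * (f * x ^ k)).
    { rewrite !Cmod_mult, Cmod_Cexp, Cmod_expcoef, Cmod_pow, Cmod_opp, Cmod_R, (Rabs_pos_eq x) by lra.
      rewrite re_scal_r. fold f. change (Re (- s)%C) with (- Re s).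
      apply Rmult_le_compat_r; [apply Rmult_le_pos; [lra|apply pow_le; lra]|].
      apply Rmult_le_compat_l; [apply Rlt_le, exp_pos|].
      eapply Rle_trans; [apply Cexp_opp_sub_1_le|].
      - rewrite re_scal_r. now apply Rmult_le_pos.
      - rewrite Cmod_mult, Cmod_R, (Rabs_pos_eq l) by exact Hl. lra. }
    assert (B2 : Cmod (Cexp (- s * y) * (expcoef k * ((- x) ^ k - (- y) ^ k))) <= exp (- Re s * y) * (f * (y ^ k - x ^ k))).
    { rewrite !Cmod_mult, Cmod_Cexp, Cmod_expcoef. fold f. rewrite re_scal_r. change (Re (- s)%C) with (- Re s).
      apply Rmult_le_compat_l; [apply Rlt_le, exp_pos|]. apply Rmult_le_compat_l; [lra|].
      rewrite <- !RtoC_opp, <- !RtoC_pow, <- RtoC_minus, Cmod_R.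
      assert (x ^ k <= y ^ k) by (apply pow_incr; lra).
      replace (- x) with (-1 * x) by ring. replace (- y) with (-1 * y) by ring. rewrite !Rpow_mult_distr.
      rewrite <- Rmult_minus_distr_l, Rabs_mult, pow_1_abs, Rmult_1_l, Rabs_minus_sym, Rabs_pos_eq; lra. }
    eapply Rle_trans; [apply Rmult_le_compat_r; [exact Prk|apply Cmod_triangle]|].
    apply Rle_trans with ((exp (- Re s * x) * (4 * (Cmod s * l)) * (f * x ^ k) + exp (- Re s * y) * (f * (y ^ k - x ^ k))) * r ^ k).
    + apply Rmult_le_compat_r; lra.
    + right. ring.
  - rewrite rsum_plus, !rsum_scal.
    assert (P1 : 0 <= r * x) by (apply Rmult_le_pos; lra).
    assert (P2 : r * x <= r * y) by (apply Rmult_le_compat_l; lra).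
    pose proof (exp_partial_le (r * x) m P1) as E1.
    pose proof (exp_partial_diff_le (r * x) (r * y) m (conj P1 P2)) as E2.
    pose proof (exp_pos (- Re s * x)). pose proof (exp_pos (- Re s * y)). pose proof (Cmod_ge_0 s).
    replace (- (Re s - r) * x) with (- Re s * x + r * x) by ring.
    replace (- (Re s - r) * y) with (- Re s * y + r * y) by ring. rewrite !exp_plus.
    assert (E3 : exp (r * y) - exp (r * x) <= exp (r * y) * (r * l)).
    { replace (exp (r * x)) with (exp (r * y) * exp (- (r * l))).
      2:{ rewrite <- exp_plus. f_equal. unfold l. ring. }
      destruct (exp_opp_diff_bound (r * l)) as [_ D]; [now apply Rmult_le_pos|].
      pose proof (exp_pos (r * y)). nra. }
    assert (T1 : 4 * Cmod s * l * exp (- Re s * x) * rsum (fun k => / INR (Factorial.fact k) * (r * x) ^ k) m <=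
      4 * Cmod s * l * exp (- Re s * x) * exp (r * x)).
    { apply Rmult_le_compat_l; [|exact E1]. repeat apply Rmult_le_pos; lra. }
    assert (T2 : exp (- Re s * y) * rsum (fun k => / INR (Factorial.fact k) * ((r * y) ^ k - (r * x) ^ k)) m <=
      exp (- Re s * y) * (exp (r * y) * (r * l))).
    { apply Rmult_le_compat_l; lra. }
    eapply Rle_trans; [apply Rplus_le_compat; [exact T1|exact T2]|]. right. ring.
Qed.

(* The partial sums of [u k] tend to [c k], so a bound uniform in [N] passes to the coefficients. *)
Lemma coef_limit_bound (c : nat -> C) (u : nat -> nat -> C) (r B : R) : 0 <= r ->
  (forall k, clim (u k) (c k)) ->
  (forall N m, rsum (fun k => Cmod (u k N) * r ^ k) m <= B) ->
  ex_series (fun k => Cmod (c k) * r ^ k) /\ Series (fun k => Cmod (c k) * r ^ k) <= B.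
Proof.
  intros Hr Hc Hu. apply nonneg_summable.
  - intros k. apply Rmult_le_pos; [apply Cmod_ge_0|now apply pow_le].
  - intros m. refine (is_lim_seq_le (fun N => rsum (fun k => Cmod (u k N) * r ^ k) m) (fun _ => B) (Finite _) (Finite _) _ _ (is_lim_seq_const _)).
    + intros N; apply Hu.
    + induction m as [|m IH]; simpl; [apply is_lim_seq_const|].
      apply is_lim_seq_plus'; [exact IH|].
      apply is_lim_seq_mult'; [now apply clim_norm|apply is_lim_seq_const].
Qed.

Lemma dterm_expterm (a : nat -> C) s k n : dterm a lnS s k n = (a n * expterm s (lnS n) k)%C.
Proof. unfold dterm, expterm. ring. Qed.

(** Abel summation acts on each Taylor coefficient, and the result is summed over [k] before the
    cutoff [N] is removed. So [r] may exceed [Re s - 1], where absolute convergence stops, and the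
    bound is linear in [Cmod s]. A step of [lnS] costs at most [/ INR (S n)], which with
    [Re s - r >= / 2] leaves the exponent 3/2; the factor 3 is [1 + 1 / (3/2 - 1)] from
    [zeta_partial]. *)
Lemma bounded_partial_sums (a : nat -> C) (s : C) (Q A r : R) :
  (forall n, Cmod (csum a n) <= Q) -> (forall n, Cmod (a n) <= A) ->
  1 < Re s -> 0 < r <= Re s - / 2 ->
  ex_series (fun k => Cmod (dcoef a lnS s k) * r ^ k) /\
  Series (fun k => Cmod (dcoef a lnS s k) * r ^ k) <= Q * (1 + 3 * (4 * Cmod s + r)).
Proof.
  intros HQ HA Hs Hr.
  assert (PQ : 0 <= Q) by (eapply Rle_trans; [apply Cmod_ge_0|apply (HQ O)]).
  (* At this smaller radius the series converges absolutely, which shows that each coefficient is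
     the limit of its partial sums; no bound is taken from it. *)
  set (r0 := (Re s - 1) / 2).
  assert (Hsum : ex_series (fun n => Cmod (a n) * exp (- lnS n * (Re s - r0)))).
  { apply bounded_dirichlet_summable with A; [unfold r0; lra|exact HA]. }
  apply coef_limit_bound with (fun k N => csum (dterm a lnS s k) N); [lra| |].
  - intros k. apply CSer_lim. apply (dterm_asum a lnS s r0 lnS_nonneg); [unfold r0; lra|exact Hsum|unfold r0; lra].
  - intros N m.
    apply Rle_trans with (rsum (fun k => Q * (Cmod (expterm s (lnS N) k) * r ^ k +
       rsum (fun n => Cmod (expterm s (lnS n) k - expterm s (lnS (S n)) k) * r ^ k) N)) m).
    + apply rsum_le. intros k _. assert (0 <= r ^ k) by (apply pow_le; lra).
      rewrite (csum_ext _ (fun n => a n * expterm s (lnS n) k)%C) by (intros; apply dterm_expterm).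
      pose proof (abel_bound a (fun n => expterm s (lnS n) k) Q N HQ) as Ab. cbv beta in Ab.
      apply Rmult_le_compat_r with (r := r ^ k) in Ab; [|assumption].
      eapply Rle_trans; [exact Ab|]. right.
      rewrite (rsum_ext (fun n => Cmod (expterm s (lnS n) k - expterm s (lnS (S n)) k) * r ^ k)
        (fun n => r ^ k * Cmod (expterm s (lnS n) k - expterm s (lnS (S n)) k))) by (intros; ring).
      rewrite rsum_scal. ring.
    + rewrite rsum_scal, rsum_plus, rsum_swap. apply Rmult_le_compat_l; [exact PQ|].
      pose proof (Cmod_ge_0 s) as Ps.
      apply Rplus_le_compat.
      * eapply Rle_trans; [apply expterm_sum_le; [apply lnS_nonneg|lra]|].
        rewrite <- exp_0. apply exp_le_compat. pose proof (lnS_nonneg N). nra.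
      * apply Rle_trans with (rsum (fun n => (4 * Cmod s + r) * exp (- (3 / 2) * lnS n)) N).
        -- apply rsum_le. intros n _. pose proof (lnS_nonneg n) as Pn. pose proof (lnS_incr n) as In.
           eapply Rle_trans; [apply expterm_diff_sum_le; lra|].
           destruct (lnS_step n) as [St _].
           assert (D : exp (- (Re s - r) * lnS (S n)) <= exp (- (Re s - r) * lnS n)) by (apply exp_le_compat; nra).
           assert (D2 : exp (- (Re s - r) * lnS n) <= exp (- / 2 * lnS n)) by (apply exp_le_compat; nra).
           replace (- (3 / 2) * lnS n) with (- lnS n + - / 2 * lnS n) by field. rewrite exp_plus.
           pose proof (exp_pos (- (Re s - r) * lnS n)). pose proof (exp_pos (- lnS n)).
           apply Rle_trans with (exp (- lnS n) * ((4 * Cmod s + r) * exp (- / 2 * lnS n))).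
           ++ apply Rmult_le_compat; [lra| |exact St|nra].
              apply Rplus_le_le_0_compat; repeat apply Rmult_le_pos; try lra. apply Rlt_le, exp_pos.
           ++ right; ring.
        -- rewrite rsum_scal. rewrite (Rmult_comm 3). apply Rmult_le_compat_l; [lra|].
           eapply Rle_trans; [apply zeta_partial; lra|]. right. field.
Qed.

(* An antiderivative of [exp (- a y) (- y) ^ k / k!], the k-th Taylor coefficient of [exp (- s y)] at [a]. *)
Fixpoint antider (a : R) (k : nat) (y : R) : R :=
  match k with
  | O => - exp (- a * y) / a
  | S j => - exp (- a * y) * (- y) ^ k / (INR (Factorial.fact k) * a) - antider a j y / a
  end.

Lemma antider_derive a k y : a <> 0 ->
  is_derive (antider a k) y (exp (- a * y) * ((- y) ^ k / INR (Factorial.fact k))).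
Proof.
  intros Ha. induction k as [|k IH].
  - simpl. auto_derive; [auto|]. field. exact Ha.
  - apply (is_derive_ext (fun y => - exp (- a * y) * (- y) ^ (S k) / (INR (Factorial.fact (S k)) * a) - antider a k y / a));
      [intros; reflexivity|].
    pose proof (INR_fact_neq_0 k) as Nk. pose proof (INR_fact_neq_0 (S k)) as NSk.
    evar_last.
    + apply (is_derive_minus (fun y => - exp (- a * y) * (- y) ^ (S k) / (INR (Factorial.fact (S k)) * a)) (fun y => antider a k y / a)).
      * auto_derive; [auto|reflexivity].
      * apply (is_derive_ext (fun y => scal (/ a) (antider a k y))).
        { intros t. unfold scal; simpl; unfold mult; simpl. unfold Rdiv. apply Rmult_comm. }
        apply (is_derive_scal (antider a k) y (/ a) _ IH).
    + unfold minus, plus, opp, scal; simpl. unfold mult; simpl.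
      change (Factorial.fact k + k * Factorial.fact k)%nat with (S k * Factorial.fact k)%nat.
      rewrite mult_INR. change (match k with 0%nat => 1 | S _ => INR k + 1 end) with (INR (S k)).
      assert (INR (S k) <> 0) by (apply not_0_INR; lia).
      field. auto.
Qed.

Lemma antider_0 a k : a <> 0 -> antider a k 0 = - ((-1) ^ k / a ^ S k).
Proof.
  intros Ha. induction k as [|k IH].
  - simpl. rewrite Rmult_0_r, exp_0. field. exact Ha.
  - cbn [antider]. rewrite IH, Ropp_0. rewrite pow_i by lia. simpl (_ ^ S _).
    assert (a ^ k <> 0) by now apply pow_nonzero.
    pose proof (INR_fact_neq_0 (S k)). field. auto.
Qed.

Lemma is_lim_lnS : is_lim_seq lnS p_infty.
Proof.
  apply is_lim_seq_spec. intros M. 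
  destruct (INR_unbounded (exp M)) as [N HN]. exists N. intros n Hn. unfold lnS.
  rewrite <- (ln_exp M). apply ln_increasing; [apply exp_pos|].
  eapply Rlt_le_trans; [exact HN|]. apply le_INR. lia.
Qed.

(** The single term of degree [S k] in the series of [exp (a * x)] bounds [exp (- a * x) * x ^ k] by
    a multiple of [/ x]. *)
Lemma exp_opp_pow_lim (a : R) (u : nat -> R) k : 0 < a -> (forall n, 0 <= u n) -> is_lim_seq u p_infty ->
  is_lim_seq (fun n => exp (- a * u n) * u n ^ k) 0.
Proof.
  intros Ha Hu Hl.
  set (K := INR (Factorial.fact (S k)) * / a ^ S k).
  assert (PK : 0 < K) by (apply Rmult_lt_0_compat; [apply INR_fact_lt_0|apply Rinv_0_lt_compat, pow_lt, Ha]).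
  assert (L : is_lim_seq (fun n => K * / u n) 0).
  { replace (Finite 0) with (Rbar_mult K 0) by (simpl; f_equal; ring).
    apply is_lim_seq_scal_l. apply (is_lim_seq_inv u p_infty Hl). discriminate. }
  apply is_lim_seq_spec in Hl. destruct (Hl 0) as [N HN].
  apply is_lim_seq_incr_n with N. apply (is_lim_seq_incr_n _ N) in L.
  refine (is_lim_seq_le_le (fun _ => 0) _ _ _ _ (is_lim_seq_const 0) L).
  intros n. specialize (HN (n + N)%nat ltac:(lia)). simpl in HN. set (x := u (n + N)%nat) in *.
  assert (Px : 0 <= x ^ k) by (apply pow_le; lra). pose proof (exp_pos (- a * x)) as Pe.
  split; [apply Rmult_le_pos; lra|].
  assert (E : / INR (Factorial.fact (S k)) * (a * x) ^ S k <= exp (a * x)).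
  { eapply Rle_trans; [|apply (exp_partial_le (a * x) (S (S k))); nra].
    cbn [rsum]. apply Rle_trans with (0 + / INR (Factorial.fact (S k)) * (a * x) ^ S k); [lra|].
    apply Rplus_le_compat_r. apply (rsum_nonneg (fun k => / INR (Factorial.fact k) * (a * x) ^ k) (S k)).
    intros j. apply Rmult_le_pos; [apply Rlt_le, Rinv_0_lt_compat, INR_fact_lt_0|apply pow_le; nra]. }
  apply Rmult_le_compat_l with (r := exp (- a * x)) in E; [|lra].
  rewrite <- exp_plus in E. replace (- a * x + a * x) with 0 in E by ring. rewrite exp_0, Rpow_mult_distr in E.
  assert (Pa : 0 < a ^ S k) by now apply pow_lt. pose proof (INR_fact_lt_0 (S k)) as Pf.
  apply Rmult_le_reg_r with (x * (a ^ S k * / INR (Factorial.fact (S k)))).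
  { apply Rmult_lt_0_compat; [lra|]. apply Rmult_lt_0_compat; [exact Pa|now apply Rinv_0_lt_compat]. }
  unfold K. replace (INR (Factorial.fact (S k)) * / a ^ S k * / x * (x * (a ^ S k * / INR (Factorial.fact (S k))))) with 1.
  - eapply Rle_trans; [|exact E]. right. simpl (x ^ S k). ring.
  - field. repeat split; lra.
Qed.

Lemma antider_lim a k : 0 < a -> is_lim_seq (fun n => antider a k (lnS n)) 0.
Proof.
  intros Ha. pose proof (exp_opp_pow_lim a lnS) as X.
  induction k as [|k IH].
  - apply is_lim_seq_ext with (fun n => (- / a) * (exp (- a * lnS n) * lnS n ^ 0)); [intros; simpl; field; lra|].
    replace (Finite 0) with (Rbar_mult (- / a) 0) by (simpl; f_equal; ring).
    apply is_lim_seq_scal_l, X; [exact Ha|exact lnS_nonneg|exact is_lim_lnS].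
  - pose proof (INR_fact_neq_0 (S k)) as NSk.
    apply is_lim_seq_ext with (fun n => (- (-1) ^ S k / (INR (Factorial.fact (S k)) * a)) * (exp (- a * lnS n) * lnS n ^ S k)
      + (- / a) * antider a k (lnS n)).
    + intros n. cbn [antider]. replace (- lnS n) with (-1 * lnS n) by ring. rewrite Rpow_mult_distr. field. lra.
    + replace (Finite 0) with (Finite (- (-1) ^ S k / (INR (Factorial.fact (S k)) * a) * 0 + - / a * 0)) by (f_equal; ring).
      apply is_lim_seq_plus'; apply is_lim_seq_mult'; try apply is_lim_seq_const; [|exact IH].
      apply X; [exact Ha|exact lnS_nonneg|exact is_lim_lnS].
Qed.

(** * Periodic coefficients *)


Lemma expterm_real (a x : R) k : expterm a x k = RtoC (exp (- a * x) * ((- x) ^ k / INR (Factorial.fact k))).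
Proof.
  unfold expterm, expcoef. rewrite <- !RtoC_opp, <- RtoC_mult, Cexp_RtoC, <- RtoC_pow, <- !RtoC_mult.
  f_equal. unfold Rdiv. ring.
Qed.

(* Error of replacing [1 / n * D(ln n)] by the integral of [D] over a unit step in [n], by the mean value theorem. *)
Lemma zeta_step_bound (a u v : R) k : 0 < a -> 0 <= u <= v -> v - u <= exp (- u) ->
  Rabs (exp (- (1 + a) * u) * ((- u) ^ k / INR (Factorial.fact k)) - (antider a k v - antider a k u)) <=
  exp (- u) * (a * (v - u)) * (exp (- a * u) * (/ INR (Factorial.fact k) * u ^ k)) +
  exp (- u) * exp (- a * u) * (/ INR (Factorial.fact k) * (v ^ k - u ^ k)) +
  (exp (- u) - (v - u)) * exp (- a * u) * (/ INR (Factorial.fact k) * v ^ k).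
Proof.
  intros Ha Hu Hv.
  set (f := / INR (Factorial.fact k)). assert (Pf : 0 < f) by (apply Rinv_0_lt_compat, INR_fact_lt_0).
  destruct (MVT_gen (antider a k) u v (fun y => exp (- a * y) * ((- y) ^ k / INR (Factorial.fact k)))) as (e & He & Ee).
  { intros x _. apply antider_derive. lra. }
  { intros x _. apply continuity_pt_filterlim, (ex_derive_continuous (V := R_NormedModule)).
    eexists. apply antider_derive. lra. }
  rewrite Rmin_left, Rmax_right in He by lra. rewrite Ee.
  replace (- (1 + a) * u) with (- u + - a * u) by ring. rewrite exp_plus.
  unfold Rdiv. fold f.
  assert (Neg : forall x, (- x) ^ k = (-1) ^ k * x ^ k).
  { intros x. rewrite <- Rpow_mult_distr. f_equal. ring. }
  rewrite !Neg.
  replace (exp (- u) * exp (- a * u) * ((-1) ^ k * u ^ k * f) - exp (- a * e) * ((-1) ^ k * e ^ k * f) * (v - u))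
    with ((-1) ^ k * (exp (- u) * (exp (- a * u) - exp (- a * e)) * (f * u ^ k)
           + exp (- u) * exp (- a * e) * (f * (u ^ k - e ^ k))
           + (exp (- u) - (v - u)) * exp (- a * e) * (f * e ^ k))) by ring.
  rewrite Rabs_mult, pow_1_abs, Rmult_1_l.
  pose proof (exp_pos (- u)) as P1. pose proof (exp_pos (- a * u)) as P2. pose proof (exp_pos (- a * e)) as P3.
  assert (D1 : exp (- a * e) <= exp (- a * u)) by (apply exp_le_compat; nra).
  assert (D2 : exp (- a * u) - exp (- a * e) <= exp (- a * u) * (a * (v - u))).
  { replace (- a * e) with (- a * u + - (a * (e - u))) by ring. rewrite exp_plus.
    destruct (exp_opp_diff_bound (a * (e - u))) as [_ D]; [nra|].
    assert (a * (e - u) <= a * (v - u)) by (apply Rmult_le_compat_l; lra). nra. }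
  assert (U0 : 0 <= u ^ k) by (apply pow_le; lra).
  assert (U1 : u ^ k <= e ^ k) by (apply pow_incr; lra). assert (U2 : e ^ k <= v ^ k) by (apply pow_incr; lra).
  eapply Rle_trans; [apply Rabs_triang|]. apply Rplus_le_compat; [eapply Rle_trans; [apply Rabs_triang|]; apply Rplus_le_compat|].
  - rewrite Rabs_pos_eq.
    + apply Rle_trans with (exp (- u) * (exp (- a * u) * (a * (v - u))) * (f * u ^ k)); [|right; ring].
      apply Rmult_le_compat_r; [nra|]. apply Rmult_le_compat_l; lra.
    + repeat apply Rmult_le_pos; lra.
  - rewrite <- Rabs_Ropp. replace (- (exp (- u) * exp (- a * e) * (f * (u ^ k - e ^ k))))
      with (exp (- u) * exp (- a * e) * (f * (e ^ k - u ^ k))) by ring.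
    rewrite Rabs_pos_eq by (repeat apply Rmult_le_pos; lra).
    apply Rmult_le_compat; [nra|nra| |apply Rmult_le_compat_l; lra].
    apply Rmult_le_compat_l; lra.
  - rewrite Rabs_pos_eq by (repeat apply Rmult_le_pos; lra).
    apply Rmult_le_compat; [nra|nra| |apply Rmult_le_compat_l; lra].
    apply Rmult_le_compat_l; lra.
Qed.

Lemma lnS_0 : lnS 0 = 0.
Proof. unfold lnS. simpl. apply ln_1. Qed.

Lemma csum_const_diff (f : nat -> R) N : csum (fun n => RtoC (f (S n) - f n)) N = RtoC (f N - f 0%nat).
Proof. induction N as [|N IH]; cbn [csum]; [f_equal; ring|]. rewrite IH, <- RtoC_plus. f_equal. ring. Qed.

Lemma ones_summable (sigma : R) : 1 < sigma -> ex_series (fun n => Cmod (RtoC 1) * exp (- lnS n * sigma)).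
Proof. intros. apply (bounded_dirichlet_summable (fun _ => RtoC 1) 1); [assumption|]. intros; rewrite Cmod_1; lra. Qed.

(* The Laurent expansion of zeta at 1, expanded at [1 + a]: subtracting the coefficients of
   [1 / (s - 1)] enlarges the radius of convergence. *)
Lemma zeta_regular (a : R) : 0 < a ->
  ex_series (fun k => Cmod (dcoef (fun _ => RtoC 1) lnS (1 + a)%R k - RtoC ((-1) ^ k / a ^ S k)) * (a + / 2) ^ k).
Proof.
  intros Ha. set (r := a + / 2).
  (* The coefficients [a], [exp r * r] and [exp r] come from [T1], [T2] and [T3], one for each error
     term of [zeta_step_bound]; 3 bounds the partial sums of zeta at 3/2. The antiderivative tends
     to 0 at infinity, so only its value at 0 survives in the limit. *)
  apply (coef_limit_bound _ (fun k N => (csum (dterm (fun _ => RtoC 1) lnS (1 + a)%R k) N -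
     RtoC (antider a k (lnS N) - antider a k 0))%C) r ((a + exp r * r + exp r) * 3)); [unfold r; lra| |].
  - intros k. unfold Cminus. apply clim_plus.
    + apply CSer_lim. apply (dterm_asum _ lnS (1 + a)%R (a / 2) lnS_nonneg); [lra| |lra].
      simpl. apply ones_summable. lra.
    + replace (- RtoC ((-1) ^ k / a ^ S k))%C with (- RtoC (0 - antider a k 0))%C.
      * rewrite <- RtoC_opp. apply clim_ext with (fun N => RtoC (- (antider a k (lnS N) - antider a k 0))).
        { intros; now rewrite RtoC_opp. }
        split; simpl; [|apply is_lim_seq_const].
        apply (is_lim_seq_opp _ (Finite (0 - antider a k 0))). apply is_lim_seq_minus'; [now apply antider_lim|apply is_lim_seq_const].
      * rewrite antider_0 by lra. f_equal. f_equal. ring.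
  - intros N m.
    apply Rle_trans with (rsum (fun k => rsum (fun n =>
       (exp (- lnS n) * (a * (lnS (S n) - lnS n)) * exp (- a * lnS n)) * (/ INR (Factorial.fact k) * (r * lnS n) ^ k) +
       (exp (- lnS n) * exp (- a * lnS n)) * (/ INR (Factorial.fact k) * ((r * lnS (S n)) ^ k - (r * lnS n) ^ k)) +
       ((exp (- lnS n) - (lnS (S n) - lnS n)) * exp (- a * lnS n)) * (/ INR (Factorial.fact k) * (r * lnS (S n)) ^ k)) N) m).
    + apply rsum_le. intros k _.
      assert (Pr : 0 <= r ^ k) by (apply pow_le; unfold r; lra).
      rewrite <- lnS_0. rewrite <- (csum_const_diff (fun n => antider a k (lnS n))).
      replace (csum (dterm (fun _ => RtoC 1) lnS (1 + a)%R k) N - csum (fun n => RtoC (antider a k (lnS (S n)) - antider a k (lnS n))) N)%C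
        with (csum (fun n => dterm (fun _ => RtoC 1) lnS (1 + a)%R k n + (-(1)) * RtoC (antider a k (lnS (S n)) - antider a k (lnS n)))%C N).
      2:{ rewrite csum_plus, csum_scal. ring. }
      eapply Rle_trans; [apply Rmult_le_compat_r; [exact Pr|apply Cmod_csum_le]|].
      rewrite Rmult_comm, <- rsum_scal. apply rsum_le. intros n _.
      rewrite dterm_expterm, Cmult_1_l, expterm_real.
      replace (RtoC (exp (- (1 + a) * lnS n) * ((- lnS n) ^ k / INR (Factorial.fact k))) +
         - (1) * RtoC (antider a k (lnS (S n)) - antider a k (lnS n)))%C
        with (RtoC (exp (- (1 + a) * lnS n) * ((- lnS n) ^ k / INR (Factorial.fact k)) - (antider a k (lnS (S n)) - antider a k (lnS n)))).
      2:{ rewrite RtoC_minus. ring. }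
      rewrite Cmod_R.
      pose proof (lnS_nonneg n). pose proof (lnS_incr n). destruct (lnS_step n) as [St _].
      eapply Rle_trans; [apply Rmult_le_compat_l; [exact Pr|apply zeta_step_bound; lra]|].
      right. rewrite !Rpow_mult_distr. ring.
    + rewrite rsum_swap.
      apply Rle_trans with (rsum (fun n => (a + exp r * r + exp r) * exp (- (3 / 2) * lnS n)) N).
      * apply rsum_le. intros n _. rewrite !rsum_plus, !rsum_scal.
        pose proof (lnS_nonneg n) as Pu. pose proof (lnS_incr n) as Puv. destruct (lnS_step n) as [St St2].
        set (u := lnS n) in *. set (v := lnS (S n)) in *. set (l := v - u) in *.
        pose proof (exp_pos (- u)) as Q1. pose proof (exp_pos (- a * u)) as Q2.
        assert (Hr : 0 < r) by (unfold r; lra).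
        assert (E1 := exp_partial_le (r * u) m ltac:(nra)).
        assert (E2 := exp_partial_le (r * v) m ltac:(nra)).
        assert (E3 := exp_partial_diff_le (r * u) (r * v) m ltac:(nra)).
        assert (l1 : 0 <= l <= 1).
        { unfold l in *. split; [lra|]. assert (exp (- u) <= exp 0) by (apply exp_le_compat; lra). rewrite exp_0 in *. lra. }
        assert (X1 : exp (- a * u) * exp (r * u) = exp (/ 2 * u)).
        { rewrite <- exp_plus. f_equal. unfold r. field. }
        assert (X2 : exp (- a * u) * exp (r * v) <= exp r * exp (/ 2 * u)).
        { replace (r * v) with (r * u + r * l) by (unfold l; ring). rewrite exp_plus, <- Rmult_assoc, X1, Rmult_comm.
          apply Rmult_le_compat_r; [apply Rlt_le, exp_pos|]. apply exp_le_compat. nra. }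
        assert (X3 : exp (r * v) - exp (r * u) <= exp (r * v) * (r * l)).
        { replace (exp (r * u)) with (exp (r * v) * exp (- (r * l))).
          2:{ rewrite <- exp_plus. f_equal. unfold l. ring. }
          destruct (exp_opp_diff_bound (r * l)) as [_ D]; [nra|]. pose proof (exp_pos (r * v)). nra. }
        (* With [m = INR (S n)] this is [1 / m - ln (1 + 1 / m) <= 1 / m ^ 2]. The second-order gain
           is what leaves the exponent 3/2 after the loss of [exp (/ 2 * u)]. *)
        assert (X4 : exp (- u) - l <= exp (- u) * exp (- u)).
        { assert (exp (- u) - exp (- v) <= exp (- u) * l).
          { replace (- v) with (- u + - l) by (unfold l; ring). rewrite exp_plus.
            destruct (exp_opp_diff_bound l) as [_ D]; [lra|]. nra. }
          nra. }
        set (Y := exp (/ 2 * u)) in *. assert (PY : 0 < Y) by apply exp_pos.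
        assert (X5 : exp (- (3 / 2) * u) = exp (- u) * exp (- u) * Y).
        { unfold Y. rewrite <- !exp_plus. f_equal. field. }
        rewrite X5. set (g := exp (- u)) in *. set (h := exp (- a * u)) in *.
        assert (Per : 0 < exp r) by apply exp_pos.
        assert (T1 : g * (a * l) * h * rsum (fun k => / INR (Factorial.fact k) * (r * u) ^ k) m <= a * (g * g * Y)).
        { apply Rle_trans with (g * (a * l) * h * exp (r * u)).
          - apply Rmult_le_compat_l; [|exact E1]. repeat apply Rmult_le_pos; lra.
          - replace (g * (a * l) * h * exp (r * u)) with (a * (g * l * (h * exp (r * u)))) by ring. rewrite X1.
            apply Rmult_le_compat_l; [lra|]. apply Rmult_le_compat_r; [lra|]. apply Rmult_le_compat_l; lra. }
        assert (T2 : g * h * rsum (fun k => / INR (Factorial.fact k) * ((r * v) ^ k - (r * u) ^ k)) m <= exp r * r * (g * g * Y)).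
        { apply Rle_trans with (g * h * (exp (r * v) * (r * l))).
          - apply Rmult_le_compat_l; [apply Rmult_le_pos; lra|lra].
          - replace (g * h * (exp (r * v) * (r * l))) with ((g * l * r) * (h * exp (r * v))) by ring.
            replace (exp r * r * (g * g * Y)) with ((g * g * r) * (exp r * Y)) by ring.
            apply Rmult_le_compat; [repeat apply Rmult_le_pos; lra|apply Rmult_le_pos; [lra|apply Rlt_le, exp_pos]| |exact X2].
            apply Rmult_le_compat_r; [lra|]. apply Rmult_le_compat_l; lra. }
        assert (T3 : (g - l) * h * rsum (fun k => / INR (Factorial.fact k) * (r * v) ^ k) m <= exp r * (g * g * Y)).
        { apply Rle_trans with ((g - l) * (h * exp (r * v))).
          - rewrite Rmult_assoc. apply Rmult_le_compat_l; [lra|]. apply Rmult_le_compat_l; lra.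
          - replace (exp r * (g * g * Y)) with ((g * g) * (exp r * Y)) by ring.
            apply Rmult_le_compat; [lra|apply Rmult_le_pos; [lra|apply Rlt_le, exp_pos]|exact X4|exact X2]. }
        lra.
      * rewrite rsum_scal. apply Rmult_le_compat_l.
        { pose proof (exp_pos r). assert (0 < r) by (unfold r; lra). nra. }
        eapply Rle_trans; [apply zeta_partial; lra|]. right; field.
Qed.

(** * Operations on power series *)

Lemma conv_of_summable (c : nat -> C) (r : R) : ex_series (fun k => Cmod (c k) * r ^ k) -> conv c r.
Proof.
  intros H r' Hr'. apply ex_series_comp with (fun k => Cmod (c k) * r ^ k); [|exact H].
  intros k. pose proof (Cmod_ge_0 (c k)). assert (0 <= r' ^ k) by (apply pow_le; lra).
  split; [now apply Rmult_le_pos|]. apply Rmult_le_compat_l; [assumption|]. apply pow_incr; lra.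
Qed.

Lemma CPS_plus (c d : nat -> C) rho w : conv c rho -> conv d rho -> Cmod w < rho ->
  CPS (fun k => c k + d k)%C w = (CPS c w + CPS d w)%C.
Proof.
  intros Hc Hd Hw. unfold CPS. rewrite <- CSer_plus by (apply conv_asum with rho; assumption).
  apply CSer_ext; intros; ring.
Qed.

Lemma CPS_scal (c : nat -> C) (x : C) rho w : conv c rho -> Cmod w < rho ->
  CPS (fun k => x * c k)%C w = (x * CPS c w)%C.
Proof.
  intros Hc Hw. unfold CPS. rewrite <- CSer_scal by (apply conv_asum with rho; assumption).
  apply CSer_ext; intros; ring.
Qed.

Lemma conv_plus c d rho : conv c rho -> conv d rho -> conv (fun k => c k + d k)%C rho.
Proof.
  intros Hc Hd r Hr. apply ex_series_comp with (fun k => Cmod (c k) * r ^ k + Cmod (d k) * r ^ k).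
  - intros k. assert (0 <= r ^ k) by (apply pow_le; lra).
    split; [apply Rmult_le_pos; [apply Cmod_ge_0|assumption]|].
    rewrite <- Rmult_plus_distr_r. apply Rmult_le_compat_r; [assumption|apply Cmod_triangle].
  - exact (ex_series_plus _ _ (Hc r Hr) (Hd r Hr)).
Qed.

Lemma conv_scal c x rho : conv c rho -> conv (fun k => x * c k)%C rho.
Proof.
  intros Hc r Hr. apply ex_series_extR with (fun k => Cmod x * (Cmod (c k) * r ^ k)).
  - intros k. rewrite Cmod_mult. ring.
  - exact (ex_series_scal_l (Cmod x) _ (Hc r Hr)).
Qed.

Definition shift_coef (c : nat -> C) (k : nat) : C := match k with O => RtoC 0 | S j => c j end.

Lemma conv_shift c rho : conv c rho -> conv (shift_coef c) rho.
Proof.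
  intros Hc r Hr. apply ex_series_incr_1.
  apply ex_series_extR with (fun k => r * (Cmod (c k) * r ^ k)); [intros; simpl; ring|].
  exact (ex_series_scal_l r _ (Hc r Hr)).
Qed.

Lemma CPS_shift c rho w : conv c rho -> Cmod w < rho -> CPS (shift_coef c) w = (w * CPS c w)%C.
Proof.
  intros Hc Hw. unfold CPS. rewrite CSer_shift by (apply conv_asum with rho; [now apply conv_shift|exact Hw]).
  rewrite <- CSer_scal by (apply conv_asum with rho; assumption).
  rewrite (CSer_ext (fun k => shift_coef c (S k) * w ^ S k)%C (fun k => w * (c k * w ^ k))%C) by (intros; simpl; ring).
  simpl. ring.
Qed.

Definition const_coef (x : C) (k : nat) : C := match k with O => x | S _ => RtoC 0 end.

Lemma conv_const x rho : conv (const_coef x) rho.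
Proof.
  intros r Hr. apply ex_series_incr_1. apply ex_series_extR with (fun _ => Cmod (RtoC 0)); [|exact asum_zero].
  intros k. simpl. rewrite Cmod_0. ring.
Qed.

Lemma CPS_const x w : CPS (const_coef x) w = x.
Proof.
  unfold CPS. rewrite CSer_shift by (apply conv_asum with (Cmod w + 1); [apply conv_const|lra]).
  rewrite (CSer_ext (fun k => const_coef x (S k) * w ^ S k)%C (fun _ => RtoC 0)) by (intros; simpl; ring).
  rewrite CSer_zero. simpl. ring.
Qed.

Lemma Cmod_scaled_lt (w : C) (a : R) : 0 < a -> Cmod w < a -> Cmod (RtoC (- / a) * w) < 1.
Proof.
  intros Ha Hw. assert (0 < / a) by now apply Rinv_0_lt_compat.
  rewrite Cmod_mult, Cmod_R, Rabs_Ropp, Rabs_pos_eq by lra.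
  apply Rmult_lt_reg_l with a; [exact Ha|]. rewrite <- Rmult_assoc, Rinv_r by lra. lra.
Qed.

Lemma conv_rescale (c : nat -> C) (a : R) : 0 < a -> conv c 1 -> conv (fun k => RtoC (- / a) ^ k * c k)%C a.
Proof.
  intros Ha Hc r Hr. assert (Pa : 0 < / a) by now apply Rinv_0_lt_compat.
  apply ex_series_extR with (fun k => Cmod (c k) * (r / a) ^ k).
  - intros k. rewrite Cmod_mult, Cmod_pow, Cmod_R, Rabs_Ropp, Rabs_pos_eq by lra.
    unfold Rdiv. rewrite Rpow_mult_distr. ring.
  - apply Hc. split; [apply Rmult_le_pos; lra|]. apply Rmult_lt_reg_r with a; [exact Ha|].
    unfold Rdiv. rewrite Rmult_assoc, Rinv_l by lra. lra.
Qed.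

Lemma CPS_rescale (c : nat -> C) (a : R) w : CPS (fun k => RtoC (- / a) ^ k * c k)%C w = CPS c (RtoC (- / a) * w).
Proof. unfold CPS. apply CSer_ext. intros k. rewrite Cpow_mult_l. ring. Qed.

Lemma CPS_inverse (a : R) (w : C) : 0 < a -> Cmod w < a ->
  ((a + w) * CPS (fun k => RtoC ((-1) ^ k / a ^ S k)) w)%C = RtoC 1.
Proof.
  intros Ha Hw. pose proof (Cmod_scaled_lt w a Ha Hw) as Hz.
  assert (E : CPS (fun k => RtoC ((-1) ^ k / a ^ S k)) w = (RtoC (/ a) * CPS (fun _ => RtoC 1) (RtoC (- / a) * w))%C).
  { rewrite <- CPS_rescale. rewrite <- (CPS_scal _ _ a).
    - unfold CPS. apply CSer_ext. intros k. f_equal. rewrite Cmult_1_r, <- RtoC_pow, <- RtoC_mult. f_equal.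
      replace (- / a) with (-1 * / a) by ring. rewrite Rpow_mult_distr, pow_inv. simpl. field.
      split; [apply pow_nonzero; lra|lra].
    - apply (conv_rescale (fun _ => RtoC 1)); [exact Ha|]. apply (conv_bounded _ 1). intros; rewrite Cmod_1; lra.
    - exact Hw. }
  rewrite E. pose proof (CPS_geom _ Hz) as G.
  transitivity (CPS (fun _ => RtoC 1) (RtoC (- / a) * w) * (RtoC (/ a) * a + RtoC (/ a) * w))%C; [ring|].
  rewrite <- RtoC_mult, Rinv_l by lra.
  transitivity (CPS (fun _ => RtoC 1) (RtoC (- / a) * w) * (1 - RtoC (- / a) * w))%C; [rewrite RtoC_opp; ring|exact G].
Qed.

Lemma csum_split (a : nat -> C) m n : csum a (m + n) = (csum a m + csum (fun k => a (m + k)%nat) n)%C.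
Proof.
  induction n as [|n IH]; [rewrite Nat.add_0_r; simpl; ring|].
  rewrite Nat.add_succ_r. cbn [csum]. rewrite IH. ring.
Qed.

Lemma periodic_sums_bounded (a : nat -> C) (q : nat) (A : R) : (0 < q)%nat ->
  (forall n, a (q + n)%nat = a n) -> (forall n, Cmod (a n) <= A) -> csum a q = RtoC 0 ->
  forall n, Cmod (csum a n) <= INR q * A.
Proof.
  intros Hq Hp HA H0 n. assert (PA : 0 <= A) by (eapply Rle_trans; [apply Cmod_ge_0|apply (HA O)]).
  induction n as [n IH] using lt_wf_ind. destruct (Nat.lt_ge_cases n q) as [L|L].
  - apply Rle_trans with (INR n * A).
    + clear - HA. induction n as [|n IH]; [simpl; rewrite Cmod_0; lra|]. cbn [csum]. rewrite S_INR.
      eapply Rle_trans; [apply Cmod_triangle|]. specialize (HA n). lra.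
    + apply Rmult_le_compat_r; [exact PA|]. apply le_INR. lia.
  - replace n with (q + (n - q))%nat by lia. rewrite csum_split, H0, Cplus_0_l.
    rewrite (csum_ext _ a) by (intros; apply Hp). apply IH. lia.
Qed.

Definition dirichlet (a : nat -> C) (s : C) : C := CSer (fun n => a n * Cexp (- s * lnS n))%C.

Lemma dirichlet_dcoef (a : nat -> C) (A : R) (s w : C) : (forall n, Cmod (a n) <= A) -> 1 < Re s -> Cmod w < Re s - 1 ->
  CPS (dcoef a lnS s) w = dirichlet a (s + w).
Proof.
  intros HA Hs Hw. pose proof (Cmod_ge_0 w). set (r := (Cmod w + (Re s - 1)) / 2).
  apply (dirichlet_taylor a lnS s r lnS_nonneg); unfold r; try lra.
  apply bounded_dirichlet_summable with A; [lra|exact HA].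
Qed.

Lemma dcoef_linear (a b : nat -> C) (x : C) (A : R) s k : (forall n, Cmod (a n) <= A) -> (forall n, Cmod (b n) <= A) -> 1 < Re s ->
  dcoef (fun n => a n + x * b n)%C lnS s k = (dcoef a lnS s k + x * dcoef b lnS s k)%C.
Proof.
  intros Ha Hb Hs.
  assert (X : forall c, (forall n, Cmod (c n) <= A) -> asum (dterm c lnS s k)).
  { intros c Hc. apply (dterm_asum c lnS s ((Re s - 1) / 2) lnS_nonneg); [lra| |lra].
    apply bounded_dirichlet_summable with A; [lra|exact Hc]. }
  unfold dcoef. rewrite <- CSer_scal by exact (X b Hb).
  rewrite <- CSer_plus; [|exact (X a Ha)|exact (asum_scal x _ (X b Hb))].
  apply CSer_ext. intros n. unfold dterm. ring.
Qed.

Lemma dirichlet_summable (a : nat -> C) (A : R) (s : C) : (forall n, Cmod (a n) <= A) -> 1 < Re s ->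
  asum (fun n => a n * Cexp (- s * lnS n))%C.
Proof.
  intros HA Hs.
  apply (asum_ext (fun n => a n * Cexp (- (s + 0) * lnS n))%C); [intros; do 3 f_equal; ring|].
  apply (dirichlet_asum a lnS s 0 lnS_nonneg); [|rewrite Cmod_0; lra].
  apply bounded_dirichlet_summable with A; [lra|exact HA].
Qed.

Definition mean (a : nat -> C) (q : nat) : C := (csum a q * / INR q)%C.

(** Subtracting the mean makes the sum over a period 0, which is the condition for bounded partial
    sums. *)
Lemma centered_periodic_bounded (a : nat -> C) (q : nat) : (0 < q)%nat ->
  (forall n, a (q + n)%nat = a n) -> (forall n, Cmod (a n) <= 1) ->
  (forall n, Cmod (a n + - mean a q * 1)%C <= 2) /\
  forall n, Cmod (csum (fun n => a n + - mean a q * 1)%C n) <= INR q * 2.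
Proof.
  intros Hq Hp HA.
  assert (Pq : 0 < INR q) by (apply lt_0_INR; exact Hq).
  assert (Nq : RtoC (INR q) <> RtoC 0) by (intros X; apply RtoC_inj in X; lra).
  assert (Cs : forall (x : C) n, csum (fun _ => x) n = (INR n * x)%C).
  { intros x n. induction n as [|n IH]; cbn [csum]; [simpl; ring|]. rewrite IH, S_INR, RtoC_plus. ring. }
  assert (Sb : forall n, Cmod (csum a n) <= INR n).
  { intros n. induction n as [|n IH]; [simpl; rewrite Cmod_0; lra|]. cbn [csum]. rewrite S_INR.
    eapply Rle_trans; [apply Cmod_triangle|]. specialize (HA n). lra. }
  assert (Mb : Cmod (mean a q) <= 1).
  { unfold mean. rewrite Cmod_mult, Cmod_inv, Cmod_R, Rabs_pos_eq by (assumption || lra).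
    apply Rmult_le_reg_r with (INR q); [exact Pq|]. rewrite Rmult_assoc, Rinv_l, Rmult_1_r, Rmult_1_l by lra. apply Sb. }
  assert (B2 : forall n, Cmod (a n + - mean a q * 1)%C <= 2).
  { intros n. rewrite Cmult_1_r. eapply Rle_trans; [apply Cmod_triangle|]. rewrite Cmod_opp. specialize (HA n). lra. }
  split; [exact B2|].
  apply periodic_sums_bounded; [exact Hq|intros; now rewrite Hp|exact B2|].
  rewrite csum_plus, Cs. unfold mean. field. exact Nq.
Qed.

(** With [s = 1 + off + w] this describes [(s - 1)] times the series on a disc that contains
    [s = 1]. The coefficients split into a part of mean 0, continued by [bounded_partial_sums], and
    [mean a q] times the constant 1, whose pole is split off by [zeta_regular]; the mean is the
    residue. *)
Lemma periodic_dirichlet (a : nat -> C) (q : nat) (off : R) : (0 < q)%nat ->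
  (forall n, a (q + n)%nat = a n) -> (forall n, Cmod (a n) <= 1) -> 0 < off ->
  exists g, conv g (off + / 2) /\
    (forall w, Cmod w < off -> CPS g w = ((off + w) * dirichlet a (1 + off + w))%C) /\
    CPS g (- off) = mean a q.
Proof.
  intros Hq Hp HA Hoff.
  destruct (centered_periodic_bounded a q Hq Hp HA) as [B2 BS].
  set (beta := mean a q) in *.
  set (b0 := fun n => (a n + - beta * 1)%C) in *.
  set (s0 := RtoC (1 + off)). assert (Hs0 : Re s0 = 1 + off) by reflexivity.
  set (r := off + / 2). assert (Hr : 0 < r) by (unfold r; lra).
  set (geo := fun k => RtoC ((-1) ^ k / off ^ S k)).
  set (rho := fun k => (dcoef (fun _ => RtoC 1) lnS s0 k - geo k)%C).
  set (eta := dcoef b0 lnS s0).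
  assert (Crho : conv rho r) by (apply conv_of_summable; exact (zeta_regular off Hoff)).
  assert (Ceta : conv eta r).
  { apply conv_of_summable.
    apply (bounded_partial_sums b0 s0 (INR q * 2) 2 r BS B2); rewrite Hs0; unfold r; lra. }
  set (h := fun k => (eta k + beta * rho k)%C).
  assert (Ch : conv h r) by (apply conv_plus; [exact Ceta|now apply conv_scal]).
  (* Coefficients of [beta + (off + w) * CPS h w], where [h] is the part of the series left after
     removal of the pole [beta / (off + w)]. *)
  set (g := fun k => (const_coef beta k + (off * h k + shift_coef h k))%C).
  assert (Cg : conv g r).
  { apply conv_plus; [apply conv_const|]. apply conv_plus; [now apply conv_scal|now apply conv_shift]. }
  assert (Eg : forall w, Cmod w < r -> CPS g w = (beta + (off + w) * CPS h w)%C).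
  { intros w Hw. unfold g.
    rewrite (CPS_plus _ _ r); [|apply conv_const|apply conv_plus; [now apply conv_scal|now apply conv_shift]|exact Hw].
    rewrite (CPS_plus _ _ r); [|now apply conv_scal|now apply conv_shift|exact Hw].
    rewrite CPS_const, (CPS_scal _ _ r), (CPS_shift _ r) by assumption. ring. }
  exists g. split; [exact Cg|]. split.
  - intros w Hw. rewrite Eg by (unfold r; lra).
    assert (Hones : forall n : nat, Cmod (RtoC 1) <= 2) by (intros; rewrite Cmod_1; lra).
    assert (C1 : conv (dcoef (fun _ => RtoC 1) lnS s0) off).
    { intros r' Hr'. destruct (Req_dec r' 0) as [->|].
      - apply ex_series_incr_1. apply ex_series_extR with (fun _ => Cmod (RtoC 0)); [|exact asum_zero].
        intros k. simpl. rewrite Cmod_0. ring.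
      - apply (dcoef_conv _ lnS s0 r' lnS_nonneg); try lra. apply ones_summable. rewrite Hs0. lra. }
    assert (Cgeo : conv geo off).
    { apply (conv_le _ r); [unfold r; lra|exact Crho] || idtac.
      intros r' Hr'. apply ex_series_comp with (fun k => Cmod (dcoef (fun _ => RtoC 1) lnS s0 k) * r' ^ k + Cmod (rho k) * r' ^ k).
      - intros k. assert (0 <= r' ^ k) by (apply pow_le; lra).
        split; [apply Rmult_le_pos; [apply Cmod_ge_0|assumption]|].
        rewrite <- Rmult_plus_distr_r. apply Rmult_le_compat_r; [assumption|].
        replace (geo k) with (dcoef (fun _ => RtoC 1) lnS s0 k - rho k)%C by (unfold rho; ring). apply Cmod_sub_le.
      - apply (ex_series_plus (V := R_NormedModule)); [apply C1; exact Hr'|apply Crho; unfold r; lra]. }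
    assert (Eh : CPS h w = (dirichlet a (s0 + w) - beta * CPS geo w)%C).
    { rewrite <- (dirichlet_dcoef a 1 s0 w HA) by (rewrite Hs0; lra).
      assert (Ea : forall k, dcoef a lnS s0 k = (h k + beta * geo k)%C).
      { intros k. unfold h, eta, rho.
        assert (X : dcoef b0 lnS s0 k = (dcoef a lnS s0 k + - beta * dcoef (fun _ => RtoC 1) lnS s0 k)%C).
        { apply (dcoef_linear a (fun _ => RtoC 1) (- beta) 1); [exact HA|intros; rewrite Cmod_1; lra|rewrite Hs0; lra]. }
        rewrite X. ring. }
      replace (dcoef a lnS s0) with (fun k => h k + beta * geo k)%C by (apply functional_extensionality; intros; now rewrite Ea).
      rewrite (CPS_plus _ _ off); [|apply (conv_le _ r); [unfold r; lra|exact Ch]|now apply conv_scal|exact Hw].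
      rewrite (CPS_scal _ _ off) by assumption. ring. }
    rewrite Eh. pose proof (CPS_inverse off w Hoff Hw) as Inv. fold geo in Inv.
    replace (1 + off + w)%C with (s0 + w)%C by (unfold s0; rewrite RtoC_plus; ring).
    transitivity ((off + w) * dirichlet a (s0 + w) + beta * (1 - (off + w) * CPS geo w))%C; [ring|]. rewrite Inv. ring.
  - rewrite Eg; [ring|]. rewrite Cmod_opp, Cmod_R, Rabs_pos_eq by lra. unfold r; lra.
Qed.

(** * Logarithms of Dirichlet series *)


(** Common framework for [chi], its square, the principal character and the constant 1. *)
Definition comp_mult (b : nat -> C) : Prop :=
  b 1%nat = RtoC 1 /\ (forall m n, b (m * n)%nat = (b m * b n)%C) /\ (forall n, Cmod (b n) <= 1).

(* The pairs [(p, k)] coding prime powers are enumerated by Cantor's pairing. *)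
Definition pp_coef (b : nat -> C) (i : nat) : C :=
  let (p, k) := Cantor.of_nat i in if isprime p then (logcoef k * b p ^ k)%C else RtoC 0.

(** The logarithm of [p ^ k]; the predecessor undoes the shift in [lnS]. At pairs whose first
    component is not prime [pp_coef] is 0, and only nonnegativity of the value matters. *)
Definition pp_log (i : nat) : R := let (p, k) := Cantor.of_nat i in INR k * lnS (Nat.pred p).

Definition log_dirichlet (b : nat -> C) (s : C) : C := CSer (fun i => pp_coef b i * Cexp (- s * pp_log i))%C.

Lemma pp_log_nonneg i : 0 <= pp_log i.
Proof.
  unfold pp_log. destruct (Cantor.of_nat i) as [p k]. apply Rmult_le_pos; [apply pos_INR|apply lnS_nonneg].
Qed.

Lemma lnS_mul m n : lnS (Nat.pred (S m * S n)) = lnS m + lnS n.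
Proof.
  unfold lnS. rewrite Nat.succ_pred by discriminate. rewrite mult_INR. apply ln_mult; apply INR_S_pos.
Qed.

(** The series is reindexed by the integers themselves, with value 0 at 0, so that the sieve
    applies. For a prime [p], [Re s > 1] gives a term of modulus at most [/ p <= / 2], inside the
    disc of the logarithmic series. *)
Lemma dirichlet_euler (b : nat -> C) (s : C) : comp_mult b -> 1 < Re s ->
  asum (fun i => pp_coef b i * Cexp (- s * pp_log i))%C /\
  dirichlet (fun n => b (S n)) s = Cexp (log_dirichlet b s).
Proof.
  intros (b1 & bmul & bb) Hs.
  set (t := fun n => match n with O => RtoC 0 | S m => (b n * Cexp (- s * lnS m))%C end).
  assert (St : asum (fun n => t (S n))).
  { apply (dirichlet_summable (fun n => b (S n)) 1); [intros; apply bb|exact Hs]. }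
  assert (At : asum t) by now apply asum_shift.
  assert (tm : forall m n, t (m * n)%nat = (t m * t n)%C).
  { intros [|m] [|n]; [simpl; ring|simpl; ring|rewrite Nat.mul_0_r; simpl; ring|].
    change (t (S m * S n)%nat) with (b (S m * S n)%nat * Cexp (- s * lnS (Nat.pred (S m * S n))))%C.
    rewrite bmul, lnS_mul, RtoC_plus. unfold t.
    replace (- s * (lnS m + lnS n))%C with (- s * lnS m + - s * lnS n)%C by ring. rewrite Cexp_plus. ring. }
  assert (th : forall p, isprime p = true -> Cmod (t p) <= / 2).
  { intros p Hp. apply prime_ge_2 in Hp. destruct p as [|m]; [lia|]. unfold t.
    rewrite Cmod_mult, Cmod_Cexp, re_scal_r. change (Re (- s)%C) with (- Re s).
    assert (E : exp (- Re s * lnS m) <= / INR (S m)).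
    { rewrite <- exp_opp_lnS. apply exp_le_compat. pose proof (lnS_nonneg m). nra. }
    assert (E2 : / INR (S m) <= / 2).
    { apply Rinv_le_contravar; [lra|]. apply (le_INR 2). lia. }
    specialize (bb (S m)). pose proof (Cmod_ge_0 (b (S m))). pose proof (exp_pos (- Re s * lnS m)). nra. }
  destruct (euler_product t eq_refl) as [E1 E2]; [|exact tm|exact th|exact At|].
  { unfold t. rewrite b1, lnS_0. replace (- s * 0)%C with (RtoC 0) by ring. rewrite Cexp_0. ring. }
  assert (Ep : forall i, prime_log t (fst (Cantor.of_nat i)) (snd (Cantor.of_nat i)) = (pp_coef b i * Cexp (- s * pp_log i))%C).
  { intros i. unfold prime_log, pp_coef, pp_log. destruct (Cantor.of_nat i) as [p k]. cbn [fst snd].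
    destruct (isprime p) eqn:Hp; [|ring]. apply prime_ge_2 in Hp. destruct p as [|m]; [lia|]. unfold t.
    rewrite Cpow_mult_l, Cexp_pow, RtoC_mult. cbn [Nat.pred].
    replace (INR k * (- s * lnS m))%C with (- s * (INR k * lnS m))%C by ring. ring. }
  split; [exact (asum_ext _ _ Ep E1)|].
  unfold log_dirichlet. rewrite <- (CSer_ext _ _ Ep), <- E2.
  unfold dirichlet. rewrite (CSer_shift t At). simpl (t 0%nat). rewrite Cplus_0_l. reflexivity.
Qed.

Lemma pp_summable (b : nat -> C) (sigma : R) : comp_mult b -> 1 < sigma ->
  ex_series (fun i => Cmod (pp_coef b i) * exp (- pp_log i * sigma)).
Proof.
  intros Hb Hs. destruct (dirichlet_euler b (RtoC sigma) Hb Hs) as [A _].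
  apply (ex_series_extR _ _ (fun i => eq_refl)) in A. unfold asum in A.
  refine (ex_series_extR _ _ _ A). intros i. simpl.
  rewrite Cmod_mult, Cmod_Cexp, re_scal_r. do 2 f_equal. simpl. ring.
Qed.

Lemma log_dirichlet_taylor (b : nat -> C) (s w : C) : comp_mult b -> 1 < Re s -> Cmod w < Re s - 1 ->
  CPS (dcoef (pp_coef b) pp_log s) w = log_dirichlet b (s + w).
Proof.
  intros Hb Hs Hw. pose proof (Cmod_ge_0 w). set (r := (Cmod w + (Re s - 1)) / 2).
  apply (dirichlet_taylor (pp_coef b) pp_log s r pp_log_nonneg); unfold r; try lra.
  apply pp_summable; [exact Hb|lra].
Qed.

Lemma conv_pos (c : nat -> C) (rho : R) : 0 < rho ->
  (forall r, 0 < r < rho -> ex_series (fun k => Cmod (c k) * r ^ k)) -> conv c rho.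
Proof.
  intros Hrho H r Hr. destruct (Req_dec r 0) as [->|].
  - apply ex_series_comp with (fun k => Cmod (c k) * (rho / 2) ^ k); [|apply H; lra].
    intros k. pose proof (Cmod_ge_0 (c k)). assert (0 <= 0 ^ k) by (apply pow_le; lra).
    split; [now apply Rmult_le_pos|]. apply Rmult_le_compat_l; [assumption|]. apply pow_incr; lra.
  - apply H; lra.
Qed.

Lemma log_dirichlet_conv (b : nat -> C) (s : C) : comp_mult b -> 1 < Re s ->
  conv (dcoef (pp_coef b) pp_log s) (Re s - 1).
Proof.
  intros Hb Hs. apply conv_pos; [lra|]. intros r Hr.
  apply (dcoef_conv (pp_coef b) pp_log s r pp_log_nonneg); try lra.
  apply pp_summable; [exact Hb|lra].
Qed.

Lemma dcoef_log (b : nat -> C) (s w : C) : comp_mult b -> 1 < Re s -> Cmod w < Re s - 1 ->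
  CPS (dcoef (fun n => b (S n)) lnS s) w = Cexp (CPS (dcoef (pp_coef b) pp_log s) w).
Proof.
  intros Hb Hs Hw. rewrite log_dirichlet_taylor by assumption.
  rewrite (dirichlet_dcoef _ 1) by (try assumption; intros; apply Hb).
  apply dirichlet_euler; [exact Hb|].
  change (Re (s + w)%C) with (Re s + Re w). pose proof (re_le_Cmod w) as B. apply Rabs_le_between in B. lra.
Qed.

(* The inequality 3 + 4 cos t + cos 2t >= 0, for points of the unit disc. *)
Lemma three_four_one_term (x : C) : Cmod x <= 1 -> 0 <= 3 + 4 * Re x + Re (x * x).
Proof.
  intros Hx. pose proof (Cmod2_alt x) as E. pose proof (Cmod_ge_0 x).
  assert (Re x ^ 2 + Im x ^ 2 <= 1) by (rewrite <- E; nra).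
  rewrite Re_mult. nra.
Qed.

Lemma comp_mult_ones : comp_mult (fun _ => RtoC 1).
Proof. split; [reflexivity|]. split; [intros; ring|]. intros; rewrite Cmod_1; lra. Qed.

Lemma comp_mult_sqr b : comp_mult b -> comp_mult (fun n => b n * b n)%C.
Proof.
  intros (h1 & h2 & h3). split; [rewrite h1; ring|]. split; [intros; rewrite h2; ring|].
  intros n. rewrite Cmod_mult. specialize (h3 n). pose proof (Cmod_ge_0 (b n)). nra.
Qed.

Lemma logcoef_nonneg k : 0 <= Re (logcoef k) /\ Im (logcoef k) = 0.
Proof.
  destruct k as [|k]; [simpl; lra|]. unfold logcoef. split; [|reflexivity].
  change (0 <= / INR (S k)). apply Rlt_le, Rinv_0_lt_compat, INR_S_pos.
Qed.

Lemma three_four_one (b : nat -> C) (sigma u : R) : comp_mult b -> 1 < sigma ->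
  0 <= 3 * Re (log_dirichlet (fun _ => RtoC 1) sigma) + 4 * Re (log_dirichlet b (sigma, u))
       + Re (log_dirichlet (fun n => b n * b n)%C (sigma, 2 * u)).
Proof.
  intros Hb Hs.
  destruct (dirichlet_euler _ (RtoC sigma) comp_mult_ones Hs) as [A1 _].
  destruct (dirichlet_euler b (sigma, u) Hb Hs) as [A2 _].
  destruct (dirichlet_euler _ (sigma, 2 * u) (comp_mult_sqr b Hb) Hs) as [A3 _].
  apply asum_Re in A1, A2, A3.
  set (x1 := fun i => Re (pp_coef (fun _ => RtoC 1) i * Cexp (- sigma * pp_log i))%C) in *.
  set (x2 := fun i => Re (pp_coef b i * Cexp (- (sigma, u) * pp_log i))%C) in *.
  set (x3 := fun i => Re (pp_coef (fun n => b n * b n)%C i * Cexp (- (sigma, (2 * u)%R) * pp_log i))%C) in *.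
  change (0 <= 3 * Series x1 + 4 * Series x2 + Series x3).
  pose proof (ex_series_scal_l 3 _ A1 : ex_series (fun i => 3 * x1 i)) as B1.
  pose proof (ex_series_scal_l 4 _ A2 : ex_series (fun i => 4 * x2 i)) as B2.
  pose proof (ex_series_plus _ _ B1 B2 : ex_series (fun i => 3 * x1 i + 4 * x2 i)) as B3.
  pose proof (ex_series_plus _ _ B3 A3 : ex_series (fun i => 3 * x1 i + 4 * x2 i + x3 i)) as B4.
  rewrite <- !Series_scal_l, <- (Series_plus _ _ B1 B2), <- (Series_plus _ _ B3 A3).
  apply Series_nonneg; [|exact B4].
  intros i. unfold x1, x2, x3. unfold pp_coef. pose proof (pp_log_nonneg i) as Pl. set (l := pp_log i) in *. clearbody l.
    destruct (Cantor.of_nat i) as [p k]. destruct (isprime p); [|simpl; lra].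
    destruct (logcoef_nonneg k) as [L1 L2]. set (c := logcoef k) in *. clearbody c.
    (* The oscillating part of the term. The three series have at this prime power the same
       nonnegative weight [Re c * E] and the factors 1, [x] and [x * x]. *)
    set (x := (b p ^ k * Cexp (0, (- u * l)%R))%C).
    assert (Hx : Cmod x <= 1).
    { unfold x. rewrite Cmod_mult, Cmod_Cexp, Cmod_pow. simpl. rewrite exp_0, Rmult_1_r.
      rewrite <- (pow1 k). apply pow_incr. split; [apply Cmod_ge_0|apply Hb]. }
    pose proof (three_four_one_term x Hx) as T.
    set (E := exp (- sigma * l)). assert (PE : 0 < E) by apply exp_pos.
    assert (E1 : (c * 1 ^ k * Cexp (- sigma * l))%C = (Re c * E)%R).
    { rewrite Cpow_1_l. replace (- sigma * l)%C with (RtoC (- sigma * l)) by (rewrite RtoC_mult, RtoC_opp; ring).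
      rewrite Cexp_RtoC. fold E. apply C_ext; simpl; rewrite ?L2; unfold Re, Im in *; rewrite ?L2; ring. }
    assert (Cr : forall y, (c * y)%C = (Re c * y)%C).
    { intros y. apply C_ext; simpl; unfold Re, Im in *; rewrite ?L2; ring. }
    assert (E2 : (c * b p ^ k * Cexp (- (sigma, u) * l))%C = ((Re c * E)%R * x)%C).
    { unfold x. replace (- (sigma, u) * l)%C with (RtoC (- sigma * l) + (0, (- u * l)%R))%C by (apply C_ext; simpl; ring).
      rewrite Cexp_plus, Cexp_RtoC. fold E. rewrite <- Cmult_assoc, Cr, RtoC_mult. ring. }
    assert (E3 : (c * (b p * b p) ^ k * Cexp (- (sigma, (2 * u)%R) * l))%C = ((Re c * E)%R * (x * x))%C).
    { unfold x. replace (- (sigma, (2 * u)%R) * l)%C with (RtoC (- sigma * l) + ((0, (- u * l)%R) + (0, (- u * l)%R)))%C by (apply C_ext; simpl; ring).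
      rewrite !Cexp_plus, Cexp_RtoC, Cpow_mult_l. fold E. rewrite <- Cmult_assoc, Cr, RtoC_mult. ring. }
    rewrite E1, E2, E3, !re_scal_l, re_RtoC.
    replace (3 * (Re c * E) + 4 * (Re c * E * Re x) + Re c * E * Re (x * x)) with ((Re c * E) * (3 + 4 * Re x + Re (x * x))) by ring.
    apply Rmult_le_pos; [apply Rmult_le_pos; lra|exact T].
Qed.

Lemma dirichlet_norm_log (b : nat -> C) (s : C) : comp_mult b -> 1 < Re s ->
  Cmod (dirichlet (fun n => b (S n)) s) = exp (Re (log_dirichlet b s)).
Proof. intros Hb Hs. rewrite (proj2 (dirichlet_euler b s Hb Hs)). apply Cmod_Cexp. Qed.

Lemma dirichlet_norm_le (a : nat -> C) (s : C) : (forall n, Cmod (a n) <= 1) -> 1 < Re s ->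
  Cmod (dirichlet a s) <= 1 + / (Re s - 1).
Proof.
  intros Ha Hs. destruct (zeta_summable (Re s) Hs) as [Z1 Z2].
  eapply Rle_trans; [|exact Z2]. apply CSer_bound; [|exact Z1].
  intros n. rewrite Cmod_mult, Cmod_Cexp, re_scal_r. change (Re (- s)%C) with (- Re s).
  specialize (Ha n). pose proof (exp_pos (- Re s * lnS n)). nra.
Qed.

(** A zero would make [Lf] of order [d] at distance [d] from it. Its fourth power beats the cube of
    the series of ones, which is of order [/ d], and the series of squares stays below [M], so the
    product of the three would tend to 0, whereas [three_four_one] keeps it at least 1. *)
Lemma nonvanishing_line_1 (b : nat -> C) (Lf : C -> C) (u M d0 : R) : comp_mult b ->
  (forall s, 1 < Re s -> Lf s = dirichlet (fun n => b (S n)) s) ->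
  ex_cderive Lf (1, u) -> 0 < d0 ->
  (forall d, 0 < d < d0 -> Cmod (dirichlet (fun n => b (S n) * b (S n))%C (1 + d, 2 * u)) <= M) ->
  Lf (1, u) <> RtoC 0.
Proof.
  intros Hb HL [l Hl] Hd0 HM H0.
  destruct (proj1 (cderive_eps _ _ _) Hl 1 Rlt_0_1) as (d1 & Hd1 & K).
  set (B := 1 + Cmod l). pose proof (Cmod_ge_0 l).
  assert (PB : 0 < B) by (unfold B; lra).
  assert (PM : 0 <= M) by (eapply Rle_trans; [apply Cmod_ge_0|apply (HM (d0 / 2)); lra]).
  (* The product of the three bounds is [(2 / d) ^ 3 * (B * d) ^ 4 * (M + 1) = X * d], and
     [d <= / (2 * X)] makes it at most 1/2. *)
  set (X := 8 * B ^ 4 * (M + 1)).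
  assert (PX : 0 < X) by (unfold X; assert (0 < B ^ 4) by (now apply pow_lt); nra).
  set (d := Rmin (Rmin (d0 / 2) (d1 / 2)) (Rmin (/ 2) (/ (2 * X)))).
  assert (Pd : 0 < d) by (unfold d; apply Rmin_glb_lt; apply Rmin_glb_lt; try lra; apply Rinv_0_lt_compat; lra).
  assert (q1 : d <= d0 / 2) by (unfold d; eapply Rle_trans; [apply Rmin_l|apply Rmin_l]).
  assert (q2 : d <= d1 / 2) by (unfold d; eapply Rle_trans; [apply Rmin_l|apply Rmin_r]).
  assert (q3 : d <= / 2) by (unfold d; eapply Rle_trans; [apply Rmin_r|apply Rmin_l]).
  assert (q4 : d <= / (2 * X)) by (unfold d; eapply Rle_trans; [apply Rmin_r|apply Rmin_r]).
  clearbody d.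
  assert (Lb : Cmod (Lf (1 + d, u)) <= B * d).
  { specialize (K (RtoC d)). rewrite Cmod_R, Rabs_pos_eq in K by lra. specialize (K ltac:(lra)).
    replace ((1, u) + d)%C with ((1 + d)%R, u) in K by (apply C_ext; simpl; ring).
    rewrite H0 in K.
    set (p := (1 + d, u)) in *.
    pose proof (Cmod_triangle (Lf p - 0 - d * l)%C (d * l)) as T.
    replace (Lf p - 0 - d * l + d * l)%C with (Lf p) in T by ring.
    rewrite Cmod_mult, Cmod_R, Rabs_pos_eq in T by lra. unfold B. nra. }
  assert (Hs : 1 < 1 + d) by lra.
  pose proof (three_four_one b (1 + d) u Hb Hs) as T.
  apply exp_le_compat in T. rewrite exp_0, !exp_plus in T.
  rewrite HL in Lb by exact Hs.
  rewrite (dirichlet_norm_log b (1 + d, u) Hb Hs) in Lb.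
  pose proof (HM d ltac:(lra)) as L2.
  rewrite (dirichlet_norm_log (fun n => b n * b n)%C (1 + d, 2 * u) (comp_mult_sqr b Hb) Hs) in L2.
  pose proof (dirichlet_norm_le (fun _ => RtoC 1) (RtoC (1 + d)) (proj2 (proj2 comp_mult_ones)) Hs) as L0.
  rewrite (dirichlet_norm_log (fun _ => RtoC 1) (RtoC (1 + d)) comp_mult_ones Hs) in L0.
  set (x := Re (log_dirichlet (fun _ => RtoC 1) (RtoC (1 + d)))) in *.
  set (y := Re (log_dirichlet b (1 + d, u))) in *.
  set (z := Re (log_dirichlet (fun n => b n * b n)%C (1 + d, 2 * u))) in *.
  change (Re (RtoC (1 + d))) with (1 + d) in L0. replace (1 + d - 1) with d in L0 by ring.
  assert (E3 : exp (3 * x) = exp x ^ 3) by (replace (3 * x) with (x + x + x) by ring; rewrite !exp_plus; ring).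
  assert (E4 : exp (4 * y) = exp y ^ 4) by (replace (4 * y) with (y + y + y + y) by ring; rewrite !exp_plus; ring).
  rewrite E3, E4 in T.
  pose proof (exp_pos x) as Px. pose proof (exp_pos y) as Py. pose proof (exp_pos z) as Pz.
  assert (F0 : exp x <= 2 * / d).
  { assert (1 <= / d) by (rewrite <- Rinv_1; apply Rinv_le_contravar; lra). lra. }
  assert (F1 : exp x ^ 3 <= (2 * / d) ^ 3) by (apply pow_incr; lra).
  assert (F2 : exp y ^ 4 <= (B * d) ^ 4) by (apply pow_incr; lra).
  assert (G1 : 0 <= exp x ^ 3) by (apply pow_le; lra). assert (G2 : 0 <= exp y ^ 4) by (apply pow_le; lra).
  assert (F : exp x ^ 3 * exp y ^ 4 * exp z <= (2 * / d) ^ 3 * (B * d) ^ 4 * (M + 1)).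
  { apply Rmult_le_compat; [now apply Rmult_le_pos|lra| |lra]. apply Rmult_le_compat; assumption. }
  replace ((2 * / d) ^ 3 * (B * d) ^ 4 * (M + 1)) with (X * d) in F by (unfold X; field; lra).
  assert (X * d <= / 2).
  { apply Rle_trans with (X * / (2 * X)); [apply Rmult_le_compat_l; lra|]. right. field. lra. }
  lra.
Qed.

(** * Taylor polynomials of the logarithm *)

Definition exp_trunc (m : nat) (x : R) : R := rsum (fun k => / INR (Factorial.fact k) * x ^ k) m.

(* After multiplication by [exp (- a * lam n)], the weights are Poisson probabilities. *)
Lemma dcoef_truncation (alpha : nat -> C) (lam : nat -> R) (s : C) (a r : R) m : (forall n, 0 <= lam n) -> 0 < r ->
  ex_series (fun n => Cmod (alpha n) * exp (- lam n * (Re s - r))) ->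
  let f := fun n => (alpha n * Cexp (- s * lam n) * RtoC (exp_trunc m (a * lam n)%R))%C in
  asum f /\ csum (fun k => dcoef alpha lam s k * (- a) ^ k)%C m = CSer f.
Proof.
  intros Hl Hr Hs. induction m as [|m [IH1 IH2]].
  - assert (E : forall n, RtoC 0 = (alpha n * Cexp (- s * lam n) * RtoC (exp_trunc 0 (a * lam n)%R))%C)
      by (intros; unfold exp_trunc; simpl; ring).
    split; [exact (asum_ext _ _ E asum_zero)|]. rewrite <- (CSer_ext _ _ E), CSer_zero. reflexivity.
  - pose proof (dterm_asum alpha lam s r Hl (Rlt_le _ _ Hr) Hs m Hr) as D.
    pose proof (asum_scal ((- a) ^ m)%C _ D) as D'.
    assert (E : forall n, (alpha n * Cexp (- s * lam n) * RtoC (exp_trunc m (a * lam n)%R)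
        + (- a) ^ m * dterm alpha lam s m n)%C =
       (alpha n * Cexp (- s * lam n) * RtoC (exp_trunc (S m) (a * lam n)%R))%C).
    { intros n. unfold exp_trunc. cbn [rsum]. unfold dterm, expcoef. rewrite RtoC_plus, RtoC_mult, RtoC_pow, RtoC_mult.
      replace (a * lam n)%C with (- a * - lam n)%C by ring. rewrite Cpow_mult_l. ring. }
    split; [exact (asum_ext _ _ E (asum_plus _ _ IH1 D'))|].
    rewrite <- (CSer_ext _ _ E), CSer_plus by assumption. rewrite CSer_scal by exact D.
    cbn [csum]. rewrite IH2. unfold dcoef. ring.
Qed.

Lemma truncation_compare (b : nat -> C) (f : nat -> R) (s : C) (a : R) m : comp_mult b -> comp_mult (fun n => RtoC (f n)) ->
  (forall n, Cmod (b n) <= f n) -> 0 < a -> 1 + a <= Re s ->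
  Re (csum (fun k => dcoef (pp_coef b) pp_log s k * (- a) ^ k)%C m) <=
  Re (csum (fun k => dcoef (pp_coef (fun n => RtoC (f n))) pp_log (1 + a)%R k * (- a) ^ k)%C m).
Proof.
  set (b0 := fun n => RtoC (f n)).
  intros Hb Hb0 Hle Ha Hs.
  assert (S1 : ex_series (fun n => Cmod (pp_coef b n) * exp (- pp_log n * (Re s - a / 2)))) by (apply pp_summable; [exact Hb|lra]).
  assert (S2 : ex_series (fun n => Cmod (pp_coef b0 n) * exp (- pp_log n * (Re (RtoC (1 + a)) - a / 2)))).
  { apply pp_summable; [exact Hb0|simpl; lra]. }
  destruct (dcoef_truncation (pp_coef b) pp_log s a (a / 2) m pp_log_nonneg ltac:(lra) S1) as [A1 E1].
  destruct (dcoef_truncation (pp_coef b0) pp_log (1 + a)%R a (a / 2) m pp_log_nonneg ltac:(lra) S2) as [A2 E2].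
  cbv zeta in *. rewrite E1, E2.
  eapply Rle_trans; [apply Re_le_Cmod|]. eapply Rle_trans; [now apply CSer_norm|].
  unfold CSer. unfold Re at 1. cbn [fst]. apply Series_le; [|exact (asum_Re _ A2)].
  intros i. split; [apply Cmod_ge_0|].
  pose proof (pp_log_nonneg i) as Pl.
  rewrite re_scal_r, Cmod_mult, Cmod_R.
  set (T := exp_trunc m (a * pp_log i)).
  assert (PT : 0 <= T).
  { apply rsum_nonneg. intros k. apply Rmult_le_pos; [apply Rlt_le, Rinv_0_lt_compat, INR_fact_lt_0|apply pow_le; nra]. }
  rewrite Rabs_pos_eq by exact PT. apply Rmult_le_compat_r; [exact PT|].
  replace (- RtoC (1 + a) * pp_log i)%C with (RtoC (- (1 + a) * pp_log i)) by (rewrite RtoC_mult, RtoC_opp; ring).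
  rewrite Cexp_RtoC, re_scal_r, Cmod_mult, Cmod_Cexp, re_scal_r. change (Re (- s)%C) with (- Re s).
  assert (X1 : exp (- Re s * pp_log i) <= exp (- (1 + a) * pp_log i)) by (apply exp_le_compat; nra).
  apply Rmult_le_compat; [apply Cmod_ge_0|apply Rlt_le, exp_pos| |exact X1].
  unfold pp_coef. destruct (Cantor.of_nat i) as [p k]. destruct (isprime p); [|rewrite Cmod_0; simpl; lra].
  rewrite Cmod_mult, Cmod_pow.
  assert (E : Re (logcoef k * b0 p ^ k)%C = Cmod (logcoef k) * f p ^ k).
  { unfold b0. rewrite <- RtoC_pow, re_scal_r. f_equal. destruct k as [|k]; [simpl; now rewrite Cmod_0|].
    unfold logcoef. rewrite Cmod_R, Rabs_pos_eq; [reflexivity|]. apply Rlt_le, Rinv_0_lt_compat, INR_S_pos. }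
  rewrite E. apply Rmult_le_compat_l; [apply Cmod_ge_0|]. apply pow_incr. split; [apply Cmod_ge_0|apply Hle].
Qed.

(** * The main term *)


Lemma polar_form (w : C) (a : R) : 0 < a -> Cmod w = a -> exists t, - PI <= t <= PI /\ w = circ a t.
Proof.
  intros Ha Hw. pose proof (Cmod2_alt w) as E. rewrite Hw in E.
  set (x := Re w / a). set (y := Im w / a).
  assert (Exy : x² + y² = 1).
  { unfold x, y, Rsqr. replace (Re w / a * (Re w / a) + Im w / a * (Im w / a)) with ((Re w ^ 2 + Im w ^ 2) / a ^ 2) by (field; lra).
    rewrite <- E. field. lra. }
  assert (Hx : -1 <= x <= 1) by (unfold Rsqr in Exy; nra).
  pose proof (acos_bound x) as B.
  assert (Ew : w = (a * x, a * y)) by (apply C_ext; unfold x, y; simpl; unfold Re, Im; field; lra).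
  assert (S : sin (acos x) = Rabs y).
  { rewrite sin_acos by exact Hx. replace (1 - x²) with (y²) by lra. apply sqrt_Rsqr_abs. }
  destruct (Rle_dec 0 y) as [Hy|Hy].
  - exists (acos x). split; [lra|]. unfold circ. rewrite cos_acos, S, Rabs_pos_eq by lra. exact Ew.
  - exists (- acos x). split; [lra|]. unfold circ. rewrite cos_neg, sin_neg, cos_acos, S, Rabs_left1 by lra.
    rewrite Ropp_involutive. exact Ew.
Qed.

Lemma CPS_lipschitz (g : nat -> C) (rho r : R) (w h : C) : conv g rho -> 0 <= r < rho ->
  Cmod w <= r -> Cmod (w + h) <= r ->
  Cmod (CPS g (w + h) - CPS g w) <= Series (fun k => Cmod (deriv_coef g k) * r ^ k) * Cmod h.
Proof.
  intros Hg Hr Hw Hwh. pose proof (conv_deriv g rho Hg r Hr) as Hd.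
  assert (A0 : asum (fun k => g k * w ^ k)%C) by (apply conv_asum with rho; [exact Hg|lra]).
  assert (A1 : asum (fun k => g k * (w + h) ^ k)%C) by (apply conv_asum with rho; [exact Hg|lra]).
  assert (A2 : asum (fun k => -(1) * (g k * w ^ k))%C) by now apply asum_scal.
  assert (E : (CPS g (w + h) - CPS g w)%C = CSer (fun k => g k * (w + h) ^ k + -(1) * (g k * w ^ k))%C).
  { rewrite CSer_plus by assumption. rewrite CSer_scal by exact A0. unfold CPS. ring. }
  rewrite E, CSer_shift by (now apply asum_plus).
  replace (g 0%nat * (w + h) ^ 0 + - (1) * (g 0%nat * w ^ 0))%C with (RtoC 0) by (simpl; ring).
  rewrite Cplus_0_l, Rmult_comm, <- Series_scal_l.
  apply CSer_bound; [|exact (ex_series_scal_l (Cmod h) _ Hd)].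
  intros k. replace (g (S k) * (w + h) ^ S k + - (1) * (g (S k) * w ^ S k))%C with (g (S k) * ((w + h) ^ S k - w ^ S k))%C by ring.
  rewrite Cmod_mult. unfold deriv_coef. rewrite Cmod_mult, Cmod_R, Rabs_pos_eq by apply pos_INR.
  pose proof (Cpow_diff_1 w h r k Hw Hwh) as D.
  replace (Cmod h * (INR (S k) * Cmod (g (S k)) * r ^ k)) with (Cmod (g (S k)) * (INR (S k) * r ^ k * Cmod h)) by ring.
  apply Rmult_le_compat_l; [apply Cmod_ge_0|exact D].
Qed.

(* Compactness of the circle lets nonvanishing spread from a closed disc to a slightly larger one. *)
Lemma nonvanishing_extend (g : nat -> C) (rho a : R) : 0 < a < rho -> conv g rho ->
  (forall w, Cmod w <= a -> CPS g w <> RtoC 0) ->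
  exists R0, a < R0 <= rho /\ forall w, Cmod w < R0 -> CPS g w <> RtoC 0.
Proof.
  intros Ha Hg Hnz. pose proof PI_RGT_0 as Hpi.
  set (m2 := fun t => Re (CPS g (circ a t)) * Re (CPS g (circ a t)) + Im (CPS g (circ a t)) * Im (CPS g (circ a t))).
  assert (Hm2 : forall w, Cmod w ^ 2 = Re w * Re w + Im w * Im w) by (intros w; rewrite Cmod2_alt; ring).
  destruct (continuity_ab_min m2 (- PI) PI) as (t0 & Ht0 & _); [lra| |].
  { intros t _. apply continuity_pt_filterlim.
    destruct (circ_continuous (CPS g) a t (proj1 Ha)) as [K1 K2].
    { apply ex_cderive_CPS with rho; [exact Hg|rewrite Cmod_circ; lra]. }
    exact (continuous_plus (V := R_NormedModule) _ _ _
      (continuous_mult (K := R_AbsRing) _ _ _ K1 K1) (continuous_mult (K := R_AbsRing) _ _ _ K2 K2)). }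
  set (m := Cmod (CPS g (circ a t0))).
  assert (Pm : 0 < m) by (apply Cmod_gt_0, Hnz; rewrite Cmod_circ; lra).
  assert (Min : forall w, Cmod w = a -> m <= Cmod (CPS g w)).
  { intros w Hw. destruct (polar_form w a (proj1 Ha) Hw) as (t & Ht & ->).
    specialize (Ht0 t Ht). unfold m2 in Ht0. rewrite <- !Hm2 in Ht0. fold m in Ht0.
    pose proof (Cmod_ge_0 (CPS g (circ a t))). nra. }
  set (r := (a + rho) / 2). assert (Hr : 0 <= r < rho) by (unfold r; lra).
  set (M := Series (fun k => Cmod (deriv_coef g k) * r ^ k)).
  assert (PM : 0 <= M).
  { apply Series_nonneg; [|now apply (conv_deriv g rho Hg)].
    intros; apply Rmult_le_pos; [apply Cmod_ge_0|apply pow_le; lra]. }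
  exists (Rmin r (a + m / (M + 1))).
  assert (Pq : 0 < m / (M + 1)) by (apply Rdiv_lt_0_compat; lra).
  split.
  - split; [apply Rmin_glb_lt; unfold r; lra|]. eapply Rle_trans; [apply Rmin_l|unfold r; lra].
  - intros w Hw.
    assert (h1 : Cmod w < r) by (eapply Rlt_le_trans; [exact Hw|apply Rmin_l]).
    assert (h2 : Cmod w < a + m / (M + 1)) by (eapply Rlt_le_trans; [exact Hw|apply Rmin_r]).
    destruct (Rle_dec (Cmod w) a) as [L|L]; [now apply Hnz|].
    apply Rnot_le_lt in L.
    set (x := Cmod w) in *.
    set (v := (RtoC (a / x) * w)%C).
    assert (Pax : 0 < a / x) by (apply Rdiv_lt_0_compat; lra).
    assert (Hv : Cmod v = a).
    { unfold v. rewrite Cmod_mult, Cmod_R, Rabs_pos_eq by lra. fold x. field. lra. }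
    assert (Hh : Cmod (w - v) = x - a).
    { replace (w - v)%C with (RtoC (1 - a / x) * w)%C by (unfold v; rewrite RtoC_minus; ring).
      rewrite Cmod_mult, Cmod_R. fold x. rewrite Rabs_pos_eq; [field; lra|].
      assert (a / x < 1); [|lra]. apply Rmult_lt_reg_r with x; [lra|]. unfold Rdiv. rewrite Rmult_assoc, Rinv_l; lra. }
    pose proof (CPS_lipschitz g rho r v (w - v) Hg Hr) as Lip.
    replace (v + (w - v))%C with w in Lip by ring.
    specialize (Lip ltac:(rewrite Hv; unfold r; lra) (Rlt_le _ _ h1)). fold M in Lip. rewrite Hh in Lip.
    specialize (Min v Hv). intros Z. rewrite Z in Lip.
    replace (0 - CPS g v)%C with (- CPS g v)%C in Lip by ring. rewrite Cmod_opp in Lip.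
    assert (M * (x - a) < m).
    { apply Rle_lt_trans with ((M + 1) * (x - a)); [nra|].
      replace m with ((M + 1) * (m / (M + 1))) by (field; lra). apply Rmult_lt_compat_l; lra. }
    lra.
Qed.

Lemma log_dirichlet_bound (b : nat -> C) (s : C) (sigma : R) : comp_mult b -> 1 < sigma -> sigma <= Re s ->
  Cmod (log_dirichlet b s) <= Series (fun i => Cmod (pp_coef b i) * exp (- pp_log i * sigma)).
Proof.
  intros Hb Hs Hle. apply CSer_bound; [|now apply pp_summable].
  intros i. rewrite Cmod_mult, Cmod_Cexp, re_scal_r. change (Re (- s)%C) with (- Re s).
  apply Rmult_le_compat_l; [apply Cmod_ge_0|]. apply exp_le_compat. pose proof (pp_log_nonneg i). nra.
Qed.

(** The circle of radius [a] about [1 + a] meets the line [Re s = 1] only at [s = 1], that is at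
    [w = - a], where the value is given. Every other boundary point has real part above 1, where the
    Euler product is bounded away from 0. *)
Lemma nonvanishing_boundary (b g : nat -> C) (a rho : R) (w : C) : comp_mult b -> 0 < a < rho -> conv g rho ->
  (forall w, Cmod w < a -> CPS g w = ((a + w) * Cexp (log_dirichlet b (1 + a + w)))%C) ->
  CPS g (- a) <> RtoC 0 -> Cmod w <= a -> CPS g w <> RtoC 0.
Proof.
  intros Hb Ha Hg Hin Hend Hw Z.
  destruct (Rlt_dec (Cmod w) a) as [L|L].
  { revert Z. rewrite Hin by exact L. apply Cmult_neq_0; [|apply Cexp_nz].
    intros E. assert (W : w = (- RtoC a)%C) by (replace w with ((a + w) - a)%C by ring; rewrite E; ring).
    rewrite W, Cmod_opp, Cmod_R, Rabs_pos_eq in L; lra. }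
  assert (Ew : Cmod w = a) by lra. clear L Hw.
  pose proof (re_le_Cmod w) as Bw. apply Rabs_le_between in Bw.
  set (d := a + Re w).
  destruct (Req_dec d 0) as [Ed|Ed].
  { apply Hend. replace (- RtoC a)%C with w; [exact Z|].
    assert (ER : Re w = - a) by (unfold d in Ed; lra).
    pose proof (Cmod2_alt w) as E2. rewrite Ew, ER in E2.
    apply C_ext; [exact ER|]. simpl. nra. }
  assert (Pd : 0 < d) by (unfold d in *; lra).
  set (M := Series (fun i => Cmod (pp_coef b i) * exp (- pp_log i * (1 + d / 2)))).
  set (c0 := d / 2 * exp (- M)). assert (Pc : 0 < c0) by (apply Rmult_lt_0_compat; [lra|apply exp_pos]).
  (* The formula [Hin] holds only inside the disc, so [w] is approached along its radius. There
     [Re (a + t w) >= t * d >= d / 2], which bounds both factors from below; continuity transfers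
     the bound to [w]. *)
  assert (Low : forall t, / 2 <= t < 1 -> c0 <= Cmod (CPS g (RtoC t * w))).
  { intros t Ht.
    assert (Htw : Cmod (RtoC t * w) < a) by (rewrite Cmod_mult, Cmod_R, Rabs_pos_eq, Ew by lra; nra).
    rewrite Hin by exact Htw. rewrite Cmod_mult, Cmod_Cexp.
    assert (Re1 : d / 2 <= Re (a + RtoC t * w)%C).
    { rewrite Re_plus, re_scal_l, re_RtoC. unfold d in *. nra. }
    apply Rmult_le_compat; [lra|apply Rlt_le, exp_pos| |].
    - eapply Rle_trans; [exact Re1|apply Re_le_Cmod].
    - apply exp_le_compat.
      assert (B : Cmod (log_dirichlet b (1 + a + RtoC t * w)) <= M).
      { apply log_dirichlet_bound; [exact Hb|lra|].
        replace (1 + a + RtoC t * w)%C with (1 + (a + RtoC t * w))%C by ring. rewrite Re_plus, re_RtoC. lra. }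
      pose proof (re_le_Cmod (log_dirichlet b (1 + a + RtoC t * w))) as B2. apply Rabs_le_between in B2. lra. }
  destruct (cderive_continuous (CPS g) w _ (CPS_derive g rho w Hg ltac:(lra)) c0 Pc) as (dl & Hdl & K).
  set (e := Rmin (/ 2) (dl / (2 * a))).
  assert (Pe : 0 < e) by (apply Rmin_glb_lt; [lra|apply Rdiv_lt_0_compat; lra]).
  assert (e1 : e <= / 2) by apply Rmin_l. assert (e2 : e <= dl / (2 * a)) by apply Rmin_r.
  specialize (Low (1 - e) ltac:(lra)). specialize (K (RtoC (- e) * w)%C).
  rewrite Cmod_mult, Cmod_R, Rabs_Ropp, Rabs_pos_eq, Ew in K by lra.
  assert (e * a < dl).
  { apply Rle_lt_trans with (dl / (2 * a) * a); [apply Rmult_le_compat_r; lra|].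
    replace (dl / (2 * a) * a) with (dl / 2) by (field; lra). lra. }
  specialize (K H). replace (w + RtoC (- e) * w)%C with (RtoC (1 - e) * w)%C in K
    by (rewrite RtoC_minus, RtoC_opp; ring).
  rewrite Z in K. replace (CPS g (RtoC (1 - e) * w) - 0)%C with (CPS g (RtoC (1 - e) * w)) in K by ring. lra.
Qed.

(* A replacement for Mertens' theorem: [(s - 1) L(s, f)] is analytic and zero-free on a disc around
   [1 + a] containing [1], where its value is the mean [beta]; the Taylor polynomial of [- log (s - 1)]
   contributes the harmonic number. *)
Lemma truncated_log_asymptotic (f : nat -> R) (q : nat) (a beta : R) :
  comp_mult (fun n => RtoC (f n)) -> (0 < q)%nat -> (forall n, f (S (q + n)) = f (S n)) -> 0 < a ->
  mean (fun n => RtoC (f (S n))) q = RtoC beta -> 0 < beta ->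
  is_lim_seq (fun K => Re (csum (fun k => dcoef (pp_coef (fun n => RtoC (f n))) pp_log (1 + a)%R k * (- a) ^ k)%C (S K))
                       - (rsum (fun j => / INR (S j)) K - ln a)) (ln beta).
Proof.
  intros Hb Hq Hper Ha Hmean Hbeta.
  set (b := fun n => RtoC (f n)) in *.
  destruct (periodic_dirichlet (fun n => b (S n)) q a Hq) as (g & Cg & Gin & Gend); [|intros; apply Hb|exact Ha|].
  { intros n. unfold b. now rewrite Hper. }
  assert (Em : mean (fun n => b (S n)) q = RtoC beta) by exact Hmean. rewrite Em in Gend. clear Em.
  assert (Re1 : forall w, Cmod w < a -> 1 < Re (1 + a + w)%C).
  { intros w Hw. rewrite !Re_plus, !re_RtoC. pose proof (re_le_Cmod w) as B. apply Rabs_le_between in B. lra. }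
  assert (Gin' : forall w, Cmod w < a -> CPS g w = ((a + w) * Cexp (log_dirichlet b (1 + a + w)))%C).
  { intros w Hw. rewrite Gin by exact Hw. f_equal. apply dirichlet_euler; [exact Hb|now apply Re1]. }
  assert (Hnz : forall w, Cmod w <= a -> CPS g w <> RtoC 0).
  { intros w. apply (nonvanishing_boundary b g a (a + / 2)); [exact Hb|lra|exact Cg|exact Gin'|].
    rewrite Gend. intros X. apply RtoC_inj in X. lra. }
  destruct (nonvanishing_extend g (a + / 2) a ltac:(lra) Cg Hnz) as (R0 & HR0 & Hnz2).
  set (e := dcoef (pp_coef b) pp_log (1 + a)%R).
  assert (Hs0 : 1 < Re (RtoC (1 + a))) by (simpl; lra).
  assert (Ce : conv e a).
  { pose proof (log_dirichlet_conv b (RtoC (1 + a)) Hb Hs0) as X. apply (conv_le _ (Re (RtoC (1 + a)) - 1)); [simpl; lra|exact X]. }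
  assert (Ee : forall w, Cmod w < a -> CPS e w = log_dirichlet b (1 + a + w)).
  { intros w Hw. unfold e. rewrite log_dirichlet_taylor; [f_equal; rewrite RtoC_plus; ring|exact Hb|exact Hs0|simpl; lra]. }
  set (ml := fun k => (RtoC (- / a) ^ k * logcoef k)%C).
  assert (Cml : conv ml a) by (apply conv_rescale; [exact Ha|apply conv_logcoef]).
  (* Taylor coefficients of [log (a + w)], that is of [log (s - 1)]. Their terms at [w = - a] are
     [ln a], then [- / INR k]: the harmonic sum. *)
  set (lc := fun k => (const_coef (ln a) k + -(1) * ml k)%C).
  assert (Clc : conv lc a) by (apply conv_plus; [apply conv_const|now apply conv_scal]).
  assert (Elc : forall w, Cmod w < a -> Cexp (CPS lc w) = (a + w)%C).
  { intros w Hw. unfold lc. rewrite (CPS_plus _ _ a); [|apply conv_const|now apply conv_scal|exact Hw].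
    rewrite (CPS_scal _ _ a) by assumption. rewrite CPS_const. unfold ml. rewrite CPS_rescale.
    rewrite Cexp_plus, Cexp_RtoC, exp_ln by exact Ha.
    pose proof (Cexp_log _ (Cmod_scaled_lt w a Ha Hw)) as X. set (z := (RtoC (- / a) * w)%C) in *.
    set (Y := CPS logcoef z) in *. replace (- (1) * Y)%C with (- Y)%C by ring.
    assert (X2 : Cexp (- Y) = (1 - z)%C).
    { transitivity (Cexp (- Y) * (Cexp Y * (1 - z)))%C; [rewrite X; ring|].
      transitivity ((Cexp Y * Cexp (- Y)) * (1 - z))%C; [ring|]. rewrite Cexp_opp_r. ring. }
    rewrite X2. unfold z. rewrite RtoC_opp.
    transitivity (a + (a * RtoC (/ a)) * w)%C; [ring|]. rewrite <- RtoC_mult, Rinv_r by lra. ring. }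
  (* The logarithm of [g]. Neither summand converges at [- a], where both have a logarithmic
     singularity, but the sum does, because [g] has no zero in the disc of radius [R0 > a]. *)
  set (bb := fun k => (lc k + e k)%C).
  destruct (analytic_log g bb R0 a) as [Cbb Ebb].
  - lra.
  - apply (conv_le _ (a + / 2)); [lra|exact Cg].
  - now apply conv_plus.
  - intros w Hw. unfold bb. rewrite (CPS_plus _ _ a) by assumption.
    rewrite Cexp_plus, Elc, Ee by exact Hw. now apply Gin'.
  - exact Hnz2.
  - assert (Hma : Cmod (- RtoC a) < R0) by (rewrite Cmod_opp, Cmod_R, Rabs_pos_eq; lra).
    specialize (Ebb _ Hma). rewrite Gend in Ebb.
    assert (Lim : clim (csum (fun k => bb k * (- RtoC a) ^ k)%C) (CPS bb (- a))) by (apply CSer_lim, conv_asum with R0; assumption).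
    destruct Lim as [Lim _].
    assert (EL : Re (CPS bb (- a)) = ln beta).
    { apply (f_equal Cmod) in Ebb. rewrite Cmod_R, Rabs_pos_eq, Cmod_Cexp in Ebb by lra. rewrite Ebb. now rewrite ln_exp. }
    rewrite EL in Lim.
    apply (is_lim_seq_incr_1 (fun n => Re (csum (fun k => bb k * (- RtoC a) ^ k)%C n))) in Lim.
    refine (is_lim_seq_ext _ _ _ _ Lim). intros K.
    rewrite (csum_ext _ (fun k => e k * (- RtoC a) ^ k + lc k * (- RtoC a) ^ k)%C) by (intros; unfold bb; ring).
    rewrite csum_plus, Re_plus. unfold Rminus at 1. f_equal.
    assert (Term : forall k, (RtoC (- / a) ^ k * (- RtoC a) ^ k)%C = RtoC 1).
    { intros k. rewrite <- Cpow_mult_l. rewrite <- RtoC_opp, <- RtoC_mult.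
      replace (- / a * - a) with 1 by (field; lra). apply Cpow_1_l. }
    induction K as [|K IH].
    + simpl. unfold lc, ml. simpl. ring.
    + change (csum (fun k => lc k * (- RtoC a) ^ k)%C (S (S K))) with
        (csum (fun k => lc k * (- RtoC a) ^ k)%C (S K) + lc (S K) * (- RtoC a) ^ (S K))%C.
      rewrite Re_plus, IH. cbn [rsum].
      replace (lc (S K) * (- RtoC a) ^ S K)%C with (RtoC (- / INR (S K))).
      * rewrite re_RtoC. ring.
      * unfold lc, ml. cbn [const_coef]. unfold logcoef.
        transitivity (- RtoC (/ INR (S K)) * (RtoC (- / a) ^ (S K) * (- RtoC a) ^ (S K)))%C; [|ring].
        rewrite Term, RtoC_opp. ring.
Qed.

(** * Primitive characters *)


Section Character.

Variables (q : nat) (chi : Z -> C).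
Hypothesis Hq : (2 < q)%nat.
Hypothesis Hchi : primitive_character q chi.

Let b (n : nat) : C := chi (Z.of_nat n).

Lemma chi_mul m n : b (m * n)%nat = (b m * b n)%C.
Proof. unfold b. rewrite Nat2Z.inj_mul. apply Hchi. Qed.

Lemma chi_one : b 1%nat = RtoC 1.
Proof.
  assert (N : b 1%nat <> RtoC 0) by (apply Hchi; apply Z.gcd_1_l).
  assert (E : b 1%nat = (b 1%nat * b 1%nat)%C) by (rewrite <- chi_mul; reflexivity).
  rewrite <- (Cmult_1_r (b 1%nat)) in E at 1.
  transitivity (/ b 1%nat * (b 1%nat * b 1%nat))%C; [|rewrite <- E]; field; exact N.
Qed.

Lemma chi_period n : b (q + n)%nat = b n.
Proof.
  unfold b. rewrite Nat2Z.inj_add, Z.add_comm. apply Hchi.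
Qed.

Lemma chi_mod n : b (n mod q) = b n.
Proof.
  rewrite (Nat.div_mod_eq n q) at 2. generalize (n / q)%nat as k. intros k. induction k as [|k IH].
  - now rewrite Nat.mul_0_r.
  - rewrite IH, <- (chi_period (q * k + n mod q)). f_equal. lia.
Qed.

(** The powers of a value are again values, and by periodicity there are finitely many; a value of
    modulus above 1 would have unbounded powers. *)
Lemma chi_le_1 n : Cmod (b n) <= 1.
Proof.
  apply Rnot_lt_le. intros H.
  set (M := rsum (fun k => Cmod (b k)) q).
  assert (HM : forall k, Cmod (b k) <= M).
  { intros k. rewrite <- chi_mod. assert (Hk : (k mod q < q)%nat) by (apply Nat.mod_upper_bound; lia).
    set (j := (k mod q)%nat) in *. unfold M.
    apply Rle_trans with (rsum (fun k => Cmod (b k)) (S j)).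
    - simpl. pose proof (rsum_nonneg (fun k => Cmod (b k)) j (fun _ => Cmod_ge_0 _)). lra.
    - apply rsum_mono; [intros; apply Cmod_ge_0|lia]. }
  assert (HP : forall k, Cmod (b n) ^ k <= M).
  { intros k. replace (Cmod (b n) ^ k) with (Cmod (b (n ^ k)%nat)); [apply HM|].
    induction k as [|k IH]; [simpl; now rewrite chi_one, Cmod_1|].
    rewrite Nat.pow_succ_r', chi_mul, Cmod_mult, IH. reflexivity. }
  destruct (Pow_x_infinity (Cmod (b n))) with (b := M + 1) as [N HN].
  { rewrite Rabs_pos_eq; [exact H|apply Cmod_ge_0]. }
  specialize (HN N (le_n N)). specialize (HP N).
  rewrite Rabs_pos_eq in HN by (apply pow_le, Cmod_ge_0). lra.
Qed.

Lemma chi_comp_mult : comp_mult b.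
Proof. split; [apply chi_one|]. split; [apply chi_mul|apply chi_le_1]. Qed.

(** A principal character is induced by the constant 1 mod 1, and [1 < q]. *)
Lemma primitive_not_principal : ~ principal q chi.
Proof.
  intros P. apply (proj2 Hchi 1%nat (fun _ => RtoC 1)); [lia|].
  split; [exists q; lia|]. split; [|exact P].
  split; [lia|]. split; [intros; ring|]. split; [reflexivity|].
  intros n. split; intros _; [apply Z.gcd_1_r|]. intros X. apply RtoC_inj in X. lra.
Qed.

Let lsum (l : list nat) : C := fold_right Cplus (RtoC 0) (map b l).

Lemma lsum_perm l l' : Permutation l l' -> lsum l = lsum l'.
Proof.
  unfold lsum. induction 1; simpl; try congruence. ring.
Qed.

Lemma lsum_seq n : csum b n = lsum (seq 0 n).
Proof.
  induction n as [|n IH]; [reflexivity|]. cbn [csum]. rewrite IH, seq_S. simpl.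
  unfold lsum. rewrite map_app, fold_right_app. simpl. generalize (map b (seq 0 n)) as l. intros l.
  replace (b n + 0)%C with (b n) by ring.
  induction l as [|x l IHl]; simpl; [ring|]. rewrite <- IHl. ring.
Qed.

Lemma chi_sum_zero : csum (fun n => b (S n)) q = RtoC 0.
Proof.
  assert (Hm : exists m : nat, Z.gcd (Z.of_nat m) (Z.of_nat q) = 1%Z /\ b m <> RtoC 1).
  { apply NNPP. intros X. apply primitive_not_principal. intros n Hn.
    apply NNPP. intros Y. apply X.
    assert (Pq : (0 < Z.of_nat q)%Z) by lia.
    exists (Z.to_nat (n mod Z.of_nat q)). pose proof (Z.mod_pos_bound n _ Pq) as Bd.
    rewrite Z2Nat.id by lia. split; [rewrite Z.gcd_mod, Z.gcd_comm by lia; exact Hn|].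
    unfold b. rewrite Z2Nat.id by lia. intros E. apply Y. rewrite <- E.
    assert (Per : forall k n, chi (n + Z.of_nat k * Z.of_nat q)%Z = chi n).
    { intros k. induction k as [|k IH]; intros x; [f_equal; lia|].
      rewrite <- (IH x), <- (proj1 (proj2 (proj2 (proj1 Hchi))) (x + Z.of_nat k * Z.of_nat q)%Z). f_equal. lia. }
    pose proof (Z.div_mod n (Z.of_nat q) ltac:(lia)) as D.
    clear Bd E. revert D. generalize (n / Z.of_nat q)%Z (n mod Z.of_nat q)%Z. intros d r D.
    destruct (Z.le_gt_cases 0 d) as [L|L].
    - rewrite <- (Per (Z.to_nat d) r). f_equal. rewrite Z2Nat.id by lia. lia.
    - rewrite <- (Per (Z.to_nat (- d)) n). f_equal. rewrite Z2Nat.id by lia. lia. }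
  destruct Hm as (m & Hg & Hne).
  assert (Z1 : csum (fun n => b (S n)) q = csum b q).
  { pose proof (csum_shift b q) as Sh. cbn [csum] in Sh.
    assert (bq : b q = b 0%nat) by (rewrite <- (chi_period 0); f_equal; lia). rewrite bq in Sh.
    transitivity ((b 0%nat + csum (fun k => b (S k)) q) - b 0%nat)%C; [ring|]. rewrite <- Sh. ring. }
  rewrite Z1, lsum_seq.
  (* Multiplication by the unit [m] permutes the residues and multiplies the sum by [b m <> 1], so
     the sum vanishes. *)
  set (f := fun n => ((m * n) mod q)%nat).
  assert (Pm : Permutation (map f (seq 0 q)) (seq 0 q)).
  { apply NoDup_Permutation_bis.
    - apply NoDup_map_NoDup_ForallPairs; [|apply seq_NoDup].
      intros x y Hx Hy E. apply in_seq in Hx, Hy. unfold f in E.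
      assert (D : (Z.of_nat q | Z.of_nat m * (Z.of_nat x - Z.of_nat y))%Z).
      { apply (f_equal Z.of_nat) in E. rewrite !Nat2Z.inj_mod, !Nat2Z.inj_mul in E.
        apply Z.mod_divide; [lia|]. rewrite Z.mul_sub_distr_l, Zminus_mod, E, Z.sub_diag. apply Z.mod_0_l. lia. }
      apply Z.gauss in D; [|rewrite Z.gcd_comm; exact Hg].
      destruct D as [c Hc]. rewrite Nat.add_0_l in Hx, Hy.
      assert (c < 1)%Z by (apply Z.lt_nge; intros G; assert (1 * Z.of_nat q <= c * Z.of_nat q)%Z by (apply Z.mul_le_mono_nonneg_r; lia); lia).
      assert (-1 < c)%Z by (apply Z.lt_nge; intros G; assert (c * Z.of_nat q <= -1 * Z.of_nat q)%Z by (apply Z.mul_le_mono_nonneg_r; lia); lia).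
      assert (c = 0)%Z by lia. subst c. lia.
    - rewrite length_map, !length_seq. lia.
    - intros x Hx. apply in_map_iff in Hx. destruct Hx as (y & <- & _). apply in_seq.
      unfold f. pose proof (Nat.mod_upper_bound (m * y) q ltac:(lia)). lia. }
  assert (E : lsum (map f (seq 0 q)) = (b m * lsum (seq 0 q))%C).
  { unfold lsum. generalize (seq 0 q) as l. intros l. induction l as [|x l IH]; simpl; [ring|].
    rewrite IH. unfold f at 1. rewrite chi_mod, chi_mul. ring. }
  rewrite (lsum_perm _ _ Pm) in E.
  assert (N : (1 - b m)%C <> RtoC 0) by (intros X; apply Hne; replace (b m) with (1 - (1 - b m))%C by ring; rewrite X; ring).
  transitivity (/ (1 - b m) * ((1 - b m) * lsum (seq 0 q)))%C; [field; exact N|].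
  replace ((1 - b m) * lsum (seq 0 q))%C with (lsum (seq 0 q) - b m * lsum (seq 0 q))%C by ring. rewrite <- E. ring.
Qed.

Lemma chi_partial_sums n : Cmod (csum (fun n => b (S n)) n) <= INR q.
Proof.
  rewrite <- (Rmult_1_r (INR q)). apply periodic_sums_bounded; [lia| |intros; apply chi_le_1|exact chi_sum_zero].
  intros k. rewrite <- (chi_period (S k)). f_equal. lia.
Qed.

(** The principal character, kept real because it serves as the majorant in [truncation_compare];
    its mean is [phi(q) / q]. *)
Definition coprime_ind (n : nat) : R := if div.coprime q n then 1 else 0.

Lemma coprime_ind_comp_mult : comp_mult (fun n => RtoC (coprime_ind n)).
Proof.
  unfold coprime_ind. split; [|split].
  - now rewrite div.coprimen1.
  - intros m n. change (m * n)%nat with (ssrnat.muln m n). rewrite div.coprimeMr, <- RtoC_mult. f_equal.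
    destruct (div.coprime q m), (div.coprime q n); simpl; ring.
  - intros n. rewrite Cmod_R. destruct div.coprime; [rewrite Rabs_R1|rewrite Rabs_R0]; lra.
Qed.

Lemma coprime_ind_period n : coprime_ind (q + n) = coprime_ind n.
Proof.
  unfold coprime_ind, div.coprime. change (q + n)%nat with (ssrnat.addn q n). now rewrite div.gcdnDl.
Qed.

Lemma dvdn_Zdivide m n : div.dvdn m n = true -> (Z.of_nat m | Z.of_nat n)%Z.
Proof.
  intros H. destruct (ssrbool.elimT div.dvdnP H) as [k ->]. exists (Z.of_nat k).
  change (ssrnat.muln k m) with (k * m)%nat. lia.
Qed.

Lemma chi_le_coprime_ind n : Cmod (b n) <= coprime_ind n.
Proof.
  unfold coprime_ind. destruct (div.coprime q n) eqn:E; [apply chi_le_1|].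
  replace (b n) with (RtoC 0); [rewrite Cmod_0; lra|].
  apply NNPP. intros N. apply not_eq_sym in N. apply Hchi in N.
  assert (D : (Z.of_nat (div.gcdn q n) | 1)%Z).
  { rewrite <- N. apply Z.gcd_greatest; apply dvdn_Zdivide; [apply div.dvdn_gcdr|apply div.dvdn_gcdl]. }
  apply Z.divide_1_r_nonneg in D; [|lia].
  assert (G : div.gcdn q n = 1%nat) by lia.
  unfold div.coprime in E. rewrite G in E. discriminate E.
Qed.

Lemma totient_rsum : rsum coprime_ind q = INR (prime.totient q).
Proof.
  rewrite prime.totient_count_coprime.
  set (S := fun n => bigop.bigop.body 0%nat (bigop.index_iota 0 n)
    (fun i => bigop.BigBody i ssrnat.addn true (ssrnat.nat_of_bool (div.coprime q i)))).
  assert (E : forall n, rsum coprime_ind n = INR (S n)); [|exact (E q)].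
  intros n. induction n as [|n IH].
  - unfold S. now rewrite bigop.big_geq.
  - assert (R : S (Datatypes.S n) = (S n + ssrnat.nat_of_bool (div.coprime q n))%nat).
    { exact (@bigop.big_nat_recr nat 0%nat bigop.ssrnat_addn__canonical__Monoid_Law n 0%nat
        (fun i => ssrnat.nat_of_bool (div.coprime q i)) eq_refl). }
    cbn [rsum]. rewrite IH, R, plus_INR. f_equal. unfold coprime_ind. now destruct div.coprime.
Qed.

Lemma coprime_ind_mean : mean (fun n => RtoC (coprime_ind (S n))) q = RtoC (INR (prime.totient q) / INR q).
Proof.
  assert (E : csum (fun n => RtoC (coprime_ind (S n))) q = RtoC (INR (prime.totient q))).
  { rewrite <- totient_rsum.
    assert (R : forall n, csum (fun k => RtoC (coprime_ind k)) n = RtoC (rsum coprime_ind n)).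
    { intros n. induction n as [|n IH]; [reflexivity|]. cbn [csum rsum]. now rewrite IH, RtoC_plus. }
    rewrite <- R. pose proof (csum_shift (fun k => RtoC (coprime_ind k)) q) as Sh. cbn [csum] in Sh.
    assert (bq : coprime_ind q = coprime_ind 0) by (rewrite <- (coprime_ind_period 0); f_equal; lia). rewrite bq in Sh.
    transitivity ((RtoC (coprime_ind 0) + csum (fun k => RtoC (coprime_ind (S k))) q) - RtoC (coprime_ind 0))%C; [ring|].
    rewrite <- Sh. ring. }
  unfold mean. rewrite E. symmetry. apply RtoC_div. apply not_0_INR. lia.
Qed.

Lemma totient_pos : 0 < INR (prime.totient q).
Proof.
  apply lt_0_INR.
  assert (H : ssrnat.leq 1 (prime.totient q) = true); [|now apply leq_le in H].
  rewrite prime.totient_gt0. apply leq_le. lia.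
Qed.

End Character.

(* Near [1 + i v], [v <> 0], a periodic Dirichlet series differs from a multiple of zeta by a series with bounded partial sums. *)
Lemma periodic_bounded_near_line (a : nat -> C) (q : nat) (zeta : C -> C) (v : R) : (0 < q)%nat ->
  (forall n, a (q + n)%nat = a n) -> (forall n, Cmod (a n) <= 1) -> v <> 0 ->
  (forall s, 1 < Re s -> zeta s = dirichlet (fun _ => RtoC 1) s) -> ex_cderive zeta (1, v) ->
  exists M d0, 0 < d0 /\ forall d, 0 < d < d0 -> Cmod (dirichlet a (1 + d, v)) <= M.
Proof.
  intros Hq Hp HA Hv Hz [l Hl].
  destruct (centered_periodic_bounded a q Hq Hp HA) as [B2 BS].
  set (beta := mean a q) in *. set (b0 := fun n => (a n + - beta * 1)%C) in *.
  (* Radius 1 about [2 + i v] is admissible since [1 <= 2 - 1/2], and the closed disc contains all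
     points [1 + d + i v] with [0 < d < 1]. The bound is thus uniform in [d]. *)
  set (s0 := (2, v) : C). assert (Hs0 : Re s0 = 2) by reflexivity.
  destruct (bounded_partial_sums b0 s0 (INR q * 2) 2 1 BS B2) as [S1 _]; [rewrite Hs0; lra|rewrite Hs0; lra|].
  set (M0 := Series (fun k => Cmod (dcoef b0 lnS s0 k) * 1 ^ k)) in *.
  destruct (cderive_continuous zeta _ l Hl 1 Rlt_0_1) as (d1 & Hd1 & K).
  exists (M0 + Cmod beta * (1 + Cmod (zeta (1, v)))), (Rmin d1 1).
  split; [apply Rmin_glb_lt; lra|]. intros d Hd.
  assert (q1 : d < d1) by (eapply Rlt_le_trans; [apply Hd|apply Rmin_l]).
  assert (q2 : d < 1) by (eapply Rlt_le_trans; [apply Hd|apply Rmin_r]).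
  set (s := (1 + d, v) : C). assert (Hs : 1 < Re s) by (simpl; lra).
  assert (E : dirichlet a s = (dirichlet b0 s + beta * dirichlet (fun _ => RtoC 1) s)%C).
  { unfold dirichlet.
    assert (X1 : asum (fun n => b0 n * Cexp (- s * lnS n))%C) by exact (dirichlet_summable b0 2 s B2 Hs).
    assert (X2 : asum (fun n => RtoC 1 * Cexp (- s * lnS n))%C).
    { apply (dirichlet_summable (fun _ => RtoC 1) 1 s); [intros; rewrite Cmod_1; lra|exact Hs]. }
    rewrite <- (CSer_scal beta _ X2), <- (CSer_plus _ _ X1 (asum_scal beta _ X2)).
    apply CSer_ext. intros n. unfold b0. ring. }
  rewrite E. eapply Rle_trans; [apply Cmod_triangle|]. apply Rplus_le_compat.
  - set (w := RtoC (d - 1)). assert (Hw : Cmod w <= 1) by (unfold w; rewrite Cmod_R; apply Rabs_le; lra).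
    assert (Hw2 : Cmod w < Re s0 - 1) by (rewrite Hs0; unfold w; rewrite Cmod_R, Rabs_left1; lra).
    replace s with (s0 + w)%C by (apply C_ext; simpl; ring).
    rewrite <- (dirichlet_dcoef b0 2 s0 w B2) by (try assumption; rewrite Hs0; lra).
    apply CSer_bound; [|exact S1]. intros k. rewrite Cmod_mult, Cmod_pow.
    apply Rmult_le_compat_l; [apply Cmod_ge_0|]. apply pow_incr. split; [apply Cmod_ge_0|exact Hw].
  - rewrite Cmod_mult. apply Rmult_le_compat_l; [apply Cmod_ge_0|]. rewrite <- Hz by exact Hs.
    specialize (K (RtoC d)). rewrite Cmod_R, Rabs_pos_eq in K by lra. specialize (K q1).
    replace ((1, v) + d)%C with s in K by (apply C_ext; simpl; ring).
    pose proof (Cmod_triangle (zeta s - zeta (1, v))%C (zeta (1, v))) as T.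
    replace (zeta s - zeta (1, v) + zeta (1, v))%C with (zeta s) in T by ring. lra.
Qed.

(** * The bound for L *)


Lemma CSer_split (a : nat -> C) n : asum a ->
  asum (fun k => a (n + k)%nat) /\ CSer a = (csum a n + CSer (fun k => a (n + k)%nat))%C.
Proof.
  intros Ha. induction n as [|n [IH1 IH2]].
  - split; [exact Ha|]. simpl. ring_simplify. reflexivity.
  - assert (E : forall k, a (n + S k)%nat = a (S n + k)%nat) by (intros; f_equal; lia).
    pose proof (proj1 (asum_shift _) IH1) as S1. cbv beta in S1.
    split; [exact (asum_ext _ _ E S1)|].
    rewrite IH2, (CSer_shift _ IH1), (CSer_ext _ _ E). rewrite Nat.add_0_r. cbn [csum]. ring.
Qed.

(** Since [euler_constant] is the [real] of a [Lim_seq], it is the limit only once a finite limit is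
    known to exist; here the sequence decreases and stays nonnegative. *)
Lemma harmonic_lim : is_lim_seq (fun n => rsum (fun j => / INR (S j)) (S n) - lnS n) euler_constant.
Proof.
  set (u := fun n => rsum (fun j => / INR (S j)) (S n) - lnS n).
  assert (Dec : forall n, u (S n) <= u n).
  { intros n. unfold u. cbn [rsum]. destruct (lnS_step n) as [_ H]. rewrite exp_opp_lnS in H. lra. }
  assert (Pos : forall n, 0 <= u n).
  { intros n. assert (G : lnS n <= rsum (fun j => / INR (S j)) n).
    { induction n as [|n IH]; [rewrite lnS_0; simpl; lra|]. cbn [rsum].
      destruct (lnS_step n) as [H _]. rewrite exp_opp_lnS in H. lra. }
    unfold u. cbn [rsum]. pose proof (Rinv_0_lt_compat _ (INR_S_pos n)). lra. }
  destruct (ex_finite_lim_seq_decr u 0 Dec Pos) as [l Hl].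
  assert (E : is_lim_seq (fun n => sum_n_m (fun k => / INR k) 1 n - ln (INR n)) l).
  { apply is_lim_seq_incr_1. refine (is_lim_seq_ext u _ _ _ Hl). intros n. unfold u. f_equal.
    induction n as [|n IH].
    - rewrite sum_n_n. simpl. ring.
    - rewrite sum_n_Sm by lia. cbn [rsum] in *. rewrite IH. reflexivity. }
  unfold euler_constant. rewrite (is_lim_seq_unique _ _ E). exact Hl.
Qed.

Lemma is_series_dirichlet (a : nat -> C) (s F : C) : (forall n, Cmod (a (S n)) <= 1) -> 1 < Re s ->
  @is_series C_AbsRing C_NormedModule (fun k => (a (S k) * nat_cpow (S k) (- s))%C) F ->
  F = dirichlet (fun n => a (S n)) s.
Proof.
  intros Ha Hs H. apply (is_series_CSer _ _ H).
  exact (dirichlet_summable (fun n => a (S n)) 1 s Ha Hs).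
Qed.

Section MainBound.

Variables (q : nat) (chi : Z -> C) (zeta L : C -> C).
Hypothesis hGRH : GRH.
Hypothesis hq : (2 < q)%nat.
Hypothesis hchi : primitive_character q chi.
Hypothesis hzeta : is_riemann_zeta zeta.
Hypothesis hL : is_dirichlet_L q chi L.

Let b (n : nat) : C := chi (Z.of_nat n).

Lemma b_comp_mult : comp_mult b.
Proof. exact (chi_comp_mult q chi hq hchi). Qed.

Lemma b_le_1 n : Cmod (b n) <= 1.
Proof. apply b_comp_mult. Qed.

Lemma L_entire s : ex_cderive L s.
Proof. apply hL. right. exact (primitive_not_principal q chi hq hchi). Qed.

Lemma L_series s : 1 < Re s -> L s = dirichlet (fun n => b (S n)) s.
Proof. intros Hs. apply (is_series_dirichlet b); [intros; apply b_le_1|exact Hs|exact (proj2 hL s Hs)]. Qed.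

Lemma zeta_series s : 1 < Re s -> zeta s = dirichlet (fun _ => RtoC 1) s.
Proof.
  intros Hs. apply (is_series_dirichlet (fun _ => RtoC 1)); [intros; rewrite Cmod_1; lra|exact Hs|exact (proj2 hzeta s Hs)].
Qed.

(** The Euler product settles [Re s > 1], and GRH the open strip. On the line [Re s = 1] the square
    of [chi] may be principal, with a pole at 1; [Im s <> 0] keeps [1 + 2 i Im s] away from it, and
    the analyticity of [zeta] there bounds the series of squares. *)
Lemma L_nonvanishing s : / 2 < Re s -> Im s <> 0 -> L s <> RtoC 0.
Proof.
  intros Hs Hi. destruct (Rlt_le_dec 1 (Re s)) as [H1|H1].
  { rewrite L_series by exact H1. rewrite (proj2 (dirichlet_euler b s b_comp_mult H1)). apply Cexp_nz. }
  destruct H1 as [H1|H1].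
  { intros Z. pose proof (hGRH q chi L hchi hL s Z ltac:(lra)). lra. }
  set (u := Im s) in *. assert (Es : s = (1, u)) by (apply C_ext; [exact H1|reflexivity]). rewrite Es.
  destruct (periodic_bounded_near_line (fun n => b (S n) * b (S n))%C q zeta (2 * u)) as (M & d0 & Hd0 & HM).
  - lia.
  - intros n. replace (S (q + n)) with (q + S n)%nat by lia. unfold b.
    rewrite (chi_period q chi hchi). reflexivity.
  - intros n. rewrite Cmod_mult. pose proof (b_le_1 (S n)). pose proof (Cmod_ge_0 (b (S n))). nra.
  - lra.
  - exact zeta_series.
  - apply (proj1 hzeta). intros E. apply (f_equal Im) in E. simpl in E. lra.
  - apply (nonvanishing_line_1 b L u M d0); [exact b_comp_mult|exact L_series|apply L_entire|exact Hd0|exact HM].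
Qed.

(** Near [s0] the function is its Dirichlet series, and the identity theorem carries the equality to
    the disc reaching the line [Re s = 1/2]. The bounded partial sums come from the vanishing of the
    sum of [chi] over a period. *)
Lemma L_taylor (s0 : C) : 1 < Re s0 ->
  conv (dcoef (fun n => b (S n)) lnS s0) (Re s0 - / 2) /\
  forall w, Cmod w < Re s0 - / 2 ->
    L (s0 + w) = CPS (dcoef (fun n => b (S n)) lnS s0) w /\
    Cmod (L (s0 + w)) <= INR q * (1 + 3 * (4 * Cmod s0 + (Re s0 - / 2))).
Proof.
  intros Hs. set (c := dcoef (fun n => b (S n)) lnS s0). set (r := Re s0 - / 2).
  destruct (bounded_partial_sums (fun n => b (S n)) s0 (INR q) 1 r) as [S1 S2].
  - exact (chi_partial_sums q chi hq hchi).
  - intros; apply b_le_1.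
  - exact Hs.
  - unfold r; lra.
  - fold c in S1, S2. pose proof (conv_of_summable c r S1) as Cc. split; [exact Cc|].
    intros w Hw.
    assert (E : L (s0 + w) = CPS c w).
    { apply (identity_theorem (fun w => L (s0 + w)) (CPS c) r (Re s0 - 1)); [lra| | | |exact Hw].
      - intros z _. apply (ex_cderive_comp L (fun z => s0 + z)%C); [apply L_entire|].
        apply ex_cderive_plus; [apply ex_cderive_const|apply ex_cderive_id].
      - intros z Hz. now apply ex_cderive_CPS with r.
      - intros z Hz. unfold c. rewrite (dirichlet_dcoef _ 1) by (try assumption; intros; apply b_le_1).
        apply L_series. rewrite Re_plus. pose proof (re_le_Cmod z) as B. apply Rabs_le_between in B. lra. }
    split; [exact E|]. rewrite E. eapply Rle_trans; [|exact S2].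
    apply CSer_bound; [|exact S1]. intros k. rewrite Cmod_mult, Cmod_pow.
    apply Rmult_le_compat_l; [apply Cmod_ge_0|]. apply pow_incr. split; [apply Cmod_ge_0|lra].
Qed.

Let mass (a : R) : R := Series (fun i => Cmod (pp_coef b i) * exp (- pp_log i * (1 + a))).

(* Truncating the Taylor series of [log L] at [s + a], evaluated at [s], after [S K] terms. *)
Lemma L_truncated (s : C) (a B : R) (K : nat) : 0 < a -> 1 <= Re s -> a + / 2 < Im s ->
  INR q * (1 + 3 * (4 * Cmod (s + a) + (Re s + a - / 2))) <= B -> 0 < B ->
  Cmod (L s) <= exp (Re (csum (fun k => dcoef (pp_coef b) pp_log (s + a) k * (- a) ^ k)%C (S K)) +
    4 * (ln B + mass a) * (2 * a + 1) * (a / (a + / 2)) ^ S K).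
Proof.
  intros Ha Hs Ht HB PB. set (s0 := (s + a)%C).
  assert (Hs0 : Re s0 = Re s + a) by reflexivity.
  assert (Hi0 : Im s0 = Im s) by (unfold s0; rewrite Im_plus; simpl; ring).
  assert (Hs1 : 1 < Re s0) by lra.
  destruct (L_taylor s0 Hs1) as [Cc Hc].
  set (c := dcoef (fun n => b (S n)) lnS s0) in *. set (e := dcoef (pp_coef b) pp_log s0) in *.
  set (rho := a + / 2) in *. assert (Hrho : rho <= Re s0 - / 2) by (unfold rho; lra).
  destruct (analytic_log c e rho a) as [Ce Ee].
  - unfold rho; lra.
  - exact (conv_le _ _ _ Hrho Cc).
  - apply (conv_le _ (Re s0 - 1)); [lra|]. now apply log_dirichlet_conv; [exact b_comp_mult|].
  - intros w Hw. apply dcoef_log; [exact b_comp_mult|exact Hs1|lra].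
  (* The disc has centre [s + a] and radius [a + / 2]: it lies to the right of 1/2 because
     [Re s >= 1], and above the real axis because [a + / 2 < Im s]. *)
  - intros w Hw. rewrite <- (proj1 (Hc w ltac:(lra))). apply L_nonvanishing.
    + rewrite Re_plus. pose proof (re_le_Cmod w) as Bw. apply Rabs_le_between in Bw. unfold rho in Hw. lra.
    + rewrite Im_plus. pose proof (im_le_Cmod w) as Bw. apply Rabs_le_between in Bw. lra.
  - assert (HRe : forall w, Cmod w < rho -> Re (CPS e w) <= ln B).
    { intros w Hw. destruct (Hc w ltac:(lra)) as [E1 E2]. rewrite E1, Ee, Cmod_Cexp in E2 by exact Hw.
      rewrite Hs0 in E2. fold s0 in HB. rewrite <- (ln_exp (Re (CPS e w))). apply Rcomplements.ln_le; [apply exp_pos|lra]. }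
    assert (E0 : Rabs (Re (e O)) <= mass a).
    { rewrite <- (CPS_0 e). unfold e. rewrite log_dirichlet_taylor; [|exact b_comp_mult|exact Hs1|rewrite Cmod_0; lra].
      eapply Rle_trans; [apply re_le_Cmod|]. apply log_dirichlet_bound; [exact b_comp_mult|lra|]. rewrite Cplus_0_r. lra. }
    apply Rabs_le_between in E0.
    set (A := 4 * (ln B + mass a)).
    assert (Coef : forall k, Cmod (e (S k)) * rho ^ S k <= A).
    { intros k. eapply Rle_trans; [apply (coef_bound_of_Re e rho (ln B) k Ce); [unfold rho; lra|exact HRe]|].
      unfold A. lra. }
    assert (Hma : Cmod (- RtoC a) < rho) by (rewrite Cmod_opp, Cmod_R, Rabs_pos_eq; unfold rho; lra).
    assert (Es : s = (s0 + - RtoC a)%C) by (unfold s0; ring).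
    assert (EL : L s = Cexp (CPS e (- a))).
    { rewrite Es at 1. rewrite (proj1 (Hc (- RtoC a)%C ltac:(lra))). now apply Ee. }
    rewrite EL, Cmod_Cexp. apply exp_le_compat.
    assert (As : asum (fun k => e k * (- RtoC a) ^ k)%C) by (apply conv_asum with rho; assumption).
    destruct (CSer_split _ (S K) As) as [T1 T2].
    unfold CPS. rewrite T2, Re_plus. apply Rplus_le_compat_l.
    eapply Rle_trans; [apply Re_le_Cmod|].
    (* Ratio of the distance from the centre to the radius. The tail is a geometric series, and
       [/ (1 - x) = 2 * a + 1]. *)
    set (x := a / rho). assert (Prho : 0 < rho) by (unfold rho; lra).
    assert (Hx : 0 < x < 1).
    { unfold x. split; [apply Rdiv_lt_0_compat; lra|]. apply Rmult_lt_reg_r with rho; [lra|].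
      unfold Rdiv. rewrite Rmult_assoc, Rinv_l by lra. unfold rho; lra. }
    assert (G : is_series (fun k => (A * x ^ S K) * x ^ k) ((A * x ^ S K) * / (1 - x))).
    { apply (is_series_scal_l (K := R_AbsRing) (V := R_NormedModule) (A * x ^ S K)), is_series_geom. rewrite Rabs_pos_eq; lra. }
    apply Rle_trans with (Series (fun k => (A * x ^ S K) * x ^ k)).
    + apply CSer_bound; [|eexists; exact G]. intros k.
      rewrite Cmod_mult, Cmod_pow, Cmod_opp, Cmod_R, Rabs_pos_eq by lra.
      specialize (Coef (K + k)%nat). change (S K + k)%nat with (S (K + k)).
      assert (Pr : 0 < rho ^ S (K + k)) by now apply pow_lt.
      assert (Pa : 0 < a ^ S (K + k)) by now apply pow_lt.
      assert (Bk : Cmod (e (S (K + k))) <= A * / rho ^ S (K + k)).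
      { apply Rmult_le_reg_r with (rho ^ S (K + k)); [exact Pr|]. rewrite Rmult_assoc, Rinv_l, Rmult_1_r; lra. }
      replace (A * x ^ S K * x ^ k) with (A * / rho ^ S (K + k) * a ^ S (K + k)).
      * apply Rmult_le_compat_r; lra.
      * rewrite (Rmult_assoc A (x ^ S K)), <- pow_add. change (S K + k)%nat with (S (K + k)).
        unfold x, Rdiv. rewrite Rpow_mult_distr, pow_inv. ring.
    + rewrite (is_series_unique _ _ G). right.
      replace (/ (1 - x)) with (2 * a + 1); [ring|]. unfold x, rho. field. lra.
Qed.

Let beta : R := INR (prime.totient q) / INR q.

Lemma beta_pos : 0 < beta.
Proof. apply Rdiv_lt_0_compat; [exact (totient_pos q hq)|apply lt_0_INR; lia]. Qed.

Lemma main_term_bound (a eps : R) : 0 < a -> 0 < eps -> exists K0 : nat, (0 < K0)%nat /\ forall K s, (K0 <= K)%nat -> 1 <= Re s ->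
  Re (csum (fun k => dcoef (pp_coef b) pp_log (s + a) k * (- a) ^ k)%C (S K)) <=
  ln (INR K) + euler_constant - ln a + ln beta + eps.
Proof.
  intros Ha Heps.
  assert (X := truncated_log_asymptotic (coprime_ind q) q a beta (coprime_ind_comp_mult q) ltac:(lia)).
  specialize (X (fun n => eq_trans (f_equal (coprime_ind q) (eq_sym (Nat.add_succ_r q n))) (coprime_ind_period q (S n))) Ha).
  specialize (X (coprime_ind_mean q hq) beta_pos).
  apply is_lim_seq_spec in X. assert (Heps2 : 0 < eps / 2) by lra.
  destruct (X (mkposreal _ Heps2)) as [N1 HN1]. cbn [pos] in HN1.
  pose proof harmonic_lim as Y. apply is_lim_seq_spec in Y. destruct (Y (mkposreal _ Heps2)) as [N2 HN2]. cbn [pos] in HN2.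
  exists (S (Nat.max N1 N2)). split; [lia|]. intros K s HK Hs.
  (* With [K = S n], [lnS n] is [ln (INR K)] and the harmonic sum has [K] terms. Half of [eps] goes
     to each of the two limits. *)
  destruct K as [|n]; [lia|].
  specialize (HN1 (S n) ltac:(lia)). specialize (HN2 n ltac:(lia)).
  apply Rabs_lt_between in HN1, HN2.
  pose proof (truncation_compare b (coprime_ind q) (s + a) a (S (S n)) b_comp_mult (coprime_ind_comp_mult q)) as C.
  specialize (C (chi_le_coprime_ind q chi hq hchi) Ha).
  assert (Hsa : 1 + a <= Re (s + a)) by (rewrite Re_plus, re_RtoC; lra).
  specialize (C Hsa). unfold lnS in HN2.
  lra.
Qed.

(* The number of terms is chosen so that the truncation error is a negative power of [log t]. *)
Lemma L_eventually_bounded (eta : R) : 0 < eta <= 1 -> exists T, 1 < T /\ forall s, 1 <= Re s <= 2 -> T < Im s ->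
  0 < ln (ln (Im s)) /\
  Cmod (L s) <= (2 + 5 * eta) * (1 + eta) * (beta * exp euler_constant) * ln (ln (Im s)).
Proof.
  (* A single parameter: as [eta] tends to 0, the distance [a] to the centre tends to infinity. *)
  intros Heta. set (a := / eta).
  assert (Ha : 1 <= a) by (unfold a; rewrite <- Rinv_1; apply Rinv_le_contravar; lra).
  assert (Eae : a * eta = 1) by (unfold a; field; lra).
  (* One share for the main term and one for the truncation error; together they cost the factor
     [1 + eta]. *)
  set (e1 := ln (1 + eta) / 2).
  assert (He1 : 0 < e1) by (unfold e1; rewrite <- ln_1 at 1; pose proof (ln_increasing 1 (1 + eta)); rewrite ln_1 in *; lra).
  destruct (main_term_bound a e1) as (K0 & PK0 & HK0); [lra|exact He1|].
  (* The exponential rate at which the Taylor tail decays. Its lower bound [/ (2 * a + 1)] is what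
     produces the constant 2. *)
  set (kap := ln ((a + / 2) / a)).
  assert (Hkap : / (2 * a + 1) <= kap <= / 2).
  { assert (Py : 0 < (a + / 2) / a) by (apply Rdiv_lt_0_compat; lra). split.
    - pose proof (exp_ge_1_plus (- kap)) as E. unfold kap in E at 2. rewrite exp_Ropp, exp_ln in E by exact Py.
      replace (/ ((a + / 2) / a)) with (1 - / (2 * a + 1)) in E by (field; lra). lra.
    - pose proof (exp_ge_1_plus kap) as E. unfold kap in E at 2. rewrite exp_ln in E by exact Py.
      assert ((a + / 2) / a <= 1 + / 2); [|lra].
      apply Rmult_le_reg_r with a; [lra|]. unfold Rdiv. rewrite Rmult_assoc, Rinv_l by lra. lra. }
  assert (Pk : 0 < kap) by (eapply Rlt_le_trans; [|apply Hkap]; apply Rinv_0_lt_compat; lra).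
  (* From [Cmod (s + a) <= 2 + a + t] and [t >= 1], the bound of [L_truncated] is at most
     [Q * t]. *)
  set (Q := INR q * (16 * (2 + a) + 12)).
  (* Once [mass a <= ln t], the prefactor [4 * (2 * ln t + mass a) * (2 * a + 1)] is at most
     [W * ln t]. *)
  set (W := 12 * (2 * a + 1)).
  (* Threshold for [x = ln (ln t)]: beyond it [K >= K0], and [W * exp (- eta * x) <= e1], which is
     the final form of the truncation error. *)
  set (X := 1 + INR K0 + Rabs (ln (Rmax 1 (W / e1))) / eta).
  (* In turn: [ln (ln t) > X]; [t >= 1] and [Q * t <= t * t]; the disc avoids the real axis;
     [mass a <= ln t]. *)
  set (T := Rmax (exp (exp X)) (Rmax (Rmax 1 Q) (Rmax (a + / 2) (exp (mass a))))).
  assert (Pq : 0 < INR q) by (apply lt_0_INR; lia).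
  assert (PX : 1 <= X).
  { unfold X. pose proof (pos_INR K0). assert (0 <= Rabs (ln (Rmax 1 (W / e1))) / eta); [|lra].
    apply Rmult_le_pos; [apply Rabs_pos|apply Rlt_le, Rinv_0_lt_compat; lra]. }
  exists T.
  assert (T1 : exp (exp X) <= T) by apply Rmax_l.
  assert (T2 : Rmax 1 Q <= T) by (eapply Rle_trans; [|apply Rmax_r]; apply Rmax_l).
  assert (T3 : a + / 2 <= T) by (eapply Rle_trans; [|apply Rmax_r]; eapply Rle_trans; [|apply Rmax_r]; apply Rmax_l).
  assert (T4 : exp (mass a) <= T) by (eapply Rle_trans; [|apply Rmax_r]; eapply Rle_trans; [|apply Rmax_r]; apply Rmax_r).
  assert (T5 : 1 <= T) by (eapply Rle_trans; [apply Rmax_l|exact T2]).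
  assert (T6 : Q <= T) by (eapply Rle_trans; [apply Rmax_r|exact T2]).
  clearbody T.
  split.
  { assert (exp 0 < exp (exp X)) by apply exp_increasing, exp_pos. rewrite exp_0 in *. lra. }
  intros s Hs Ht. set (t := Im s) in *.
  assert (HlX : exp X < ln t) by (rewrite <- (ln_exp (exp X)); apply ln_increasing; [apply exp_pos|lra]).
  set (x := ln (ln t)).
  assert (Hx : X < x) by (unfold x; rewrite <- (ln_exp X); apply ln_increasing; [apply exp_pos|lra]).
  split; [lra|].
  assert (Hlt : ln t = exp x) by (unfold x; rewrite exp_ln; [reflexivity|pose proof (exp_pos X); lra]).
  assert (Hmass : mass a <= ln t) by (rewrite <- (ln_exp (mass a)); apply Rcomplements.ln_le; [apply exp_pos|lra]).
  assert (Py : 0 <= (1 + eta) * x / kap).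
  { apply Rmult_le_pos; [apply Rmult_le_pos; lra|apply Rlt_le, Rinv_0_lt_compat; lra]. }
  (* [K] is the floor plus one, so that [INR K * kap > (1 + eta) * x] and the tail factor is at most
     [(ln t) ^ (- (1 + eta))]: it beats the factor [ln t] in front. *)
  destruct (nfloor_ex _ Py) as [n Hn].
  set (K := S n). assert (EK : INR K = INR n + 1) by apply S_INR.
  assert (HKx : x <= (1 + eta) * x / kap).
  { apply Rmult_le_reg_r with kap; [exact Pk|]. unfold Rdiv. rewrite Rmult_assoc, Rinv_l, Rmult_1_r by lra. nra. }
  assert (HK : (K0 <= K)%nat).
  { apply INR_le. assert (INR K0 <= X); [|lra]. unfold X.
    assert (0 <= Rabs (ln (Rmax 1 (W / e1))) / eta); [|lra].
    apply Rmult_le_pos; [apply Rabs_pos|apply Rlt_le, Rinv_0_lt_compat; lra]. }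
  specialize (HK0 K s HK (proj1 Hs)).
  pose proof (L_truncated s a (t * t) K ltac:(lra) (proj1 Hs) ltac:(fold t; lra)) as Tr.
  assert (HB : INR q * (1 + 3 * (4 * Cmod (s + a) + (Re s + a - / 2))) <= t * t).
  { assert (Bs : Cmod (s + a) <= 2 + a + t).
    { eapply Rle_trans; [apply Cmod_le_sum|]. rewrite Re_plus, Im_plus, re_RtoC, im_RtoC. fold t. rewrite !Rabs_pos_eq by lra. lra. }
    apply Rle_trans with (Q * t); [|apply Rmult_le_compat_r; lra].
    unfold Q. rewrite Rmult_assoc. apply Rmult_le_compat_l; [lra|].
    assert ((2 + a) * 1 <= (2 + a) * t) by (apply Rmult_le_compat_l; lra). lra. }
  specialize (Tr HB ltac:(apply Rmult_lt_0_compat; lra)).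
  assert (Elt : ln (t * t) = 2 * ln t) by (rewrite ln_mult by lra; ring). rewrite Elt in Tr.
  assert (Err : 4 * (2 * ln t + mass a) * (2 * a + 1) * (a / (a + / 2)) ^ S K <= e1).
  { assert (P0 : (a / (a + / 2)) ^ S K <= exp (- (1 + eta) * x)).
    { replace (a / (a + / 2)) with (exp (- kap)).
      2:{ unfold kap. rewrite exp_Ropp, exp_ln by (apply Rdiv_lt_0_compat; lra). field. lra. }
      assert (Ep : forall y j, exp y ^ j = exp (INR j * y)).
      { intros y j. induction j as [|j IH]; [simpl; now rewrite Rmult_0_l, exp_0|].
        cbn [pow]. rewrite IH, <- exp_plus, S_INR. f_equal. ring. }
      rewrite Ep. apply exp_le_compat. rewrite S_INR, EK.
      assert ((1 + eta) * x <= (INR n + 1) * kap).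
      { destruct Hn as [_ Hn]. apply Rmult_lt_compat_r with (r := kap) in Hn; [|exact Pk].
        unfold Rdiv in Hn. rewrite Rmult_assoc, Rinv_l, Rmult_1_r in Hn by lra. lra. }
      nra. }
    apply Rle_trans with (W * exp x * exp (- (1 + eta) * x)).
    - apply Rmult_le_compat; [|apply pow_le, Rlt_le, Rdiv_lt_0_compat; lra| |exact P0].
      + assert (0 <= mass a).
        { apply Series_nonneg; [intros; apply Rmult_le_pos; [apply Cmod_ge_0|apply Rlt_le, exp_pos]|].
          apply pp_summable; [exact b_comp_mult|lra]. }
        pose proof (exp_pos X). apply Rmult_le_pos; lra.
      + rewrite <- Hlt. unfold W. nra.
    - rewrite Rmult_assoc, <- exp_plus. replace (x + - (1 + eta) * x) with (- (eta * x)) by ring.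
      assert (E2 : ln (W / e1) <= eta * x).
      { assert (PW : 0 < W / e1) by (apply Rdiv_lt_0_compat; unfold W; lra).
        apply Rle_trans with (ln (Rmax 1 (W / e1))); [apply Rcomplements.ln_le; [exact PW|apply Rmax_r]|].
        eapply Rle_trans; [apply Rle_abs|].
        assert (Rabs (ln (Rmax 1 (W / e1))) / eta <= x) by (unfold X in Hx; pose proof (pos_INR K0); lra).
        apply Rmult_le_compat_r with (r := eta) in H; [|lra]. unfold Rdiv in H. rewrite Rmult_assoc, Rinv_l, Rmult_1_r in H by lra. lra. }
      assert (PW : 0 < W) by (unfold W; lra).
      apply exp_le_compat in E2. rewrite exp_ln in E2 by (apply Rdiv_lt_0_compat; lra).
      rewrite exp_Ropp. pose proof (exp_pos (eta * x)).
      apply Rmult_le_reg_r with (exp (eta * x)); [assumption|]. rewrite Rmult_assoc, Rinv_l, Rmult_1_r by lra.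
      apply Rmult_le_compat_r with (r := e1) in E2; [|lra]. unfold Rdiv in E2. rewrite Rmult_assoc, Rinv_l, Rmult_1_r in E2 by lra. lra. }
  pose proof beta_pos as Pb. assert (PKp : 0 < INR K) by (rewrite EK; pose proof (pos_INR n); lra).
  eapply Rle_trans; [exact Tr|].
  apply Rle_trans with (exp (ln (INR K) + euler_constant - ln a + ln beta + e1 + e1)); [apply exp_le_compat; lra|].
  replace (ln (INR K) + euler_constant - ln a + ln beta + e1 + e1) with (ln (INR K) + - ln a + (ln beta + euler_constant) + ln (1 + eta)) by (unfold e1; field).
  rewrite !exp_plus, exp_Ropp, !exp_ln by lra.
  assert (PD : 0 < beta * exp euler_constant) by (apply Rmult_lt_0_compat; [lra|apply exp_pos]).
  (* By [/ kap <= 2 * a + 1] and [a * eta = 1] the factor is [(1 + eta) * (2 + eta) <= 2 + 4 * eta];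
     rounding up to [K] costs one more [eta], since [1 <= x]. *)
  assert (HKa : INR K * / a <= (2 + 5 * eta) * x).
  { assert (Q1 : (1 + eta) * x / kap <= (1 + eta) * x * (2 * a + 1)).
    { unfold Rdiv. apply Rmult_le_compat_l; [nra|]. rewrite <- (Rinv_inv (2 * a + 1)). apply Rinv_le_contravar; [apply Rinv_0_lt_compat; lra|apply Hkap]. }
    apply Rle_trans with (((1 + eta) * x * (2 * a + 1) + 1) * / a).
    - apply Rmult_le_compat_r; [apply Rlt_le, Rinv_0_lt_compat; lra|]. lra.
    - replace (/ a) with eta by (unfold a; now rewrite Rinv_inv).
      replace (((1 + eta) * x * (2 * a + 1) + 1) * eta) with ((1 + eta) * x * (2 * (a * eta) + eta) + eta) by ring.
      rewrite Eae.
      assert (eta * eta <= eta) by nra.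
      assert (eta * eta * x <= eta * x) by (apply Rmult_le_compat_r; lra).
      assert (eta * 1 <= eta * x) by (apply Rmult_le_compat_l; lra). lra. }
  apply Rle_trans with ((2 + 5 * eta) * x * (beta * exp euler_constant) * (1 + eta)); [|right; ring].
  apply Rmult_le_compat_r; [lra|]. apply Rmult_le_compat_r; lra.
Qed.

Lemma L_limsup_bound (eps : R) : 0 < eps -> exists T, forall s, 1 <= Re s -> T < Im s ->
  Cmod (L s) / ln (ln (Im s)) <= 2 * exp euler_constant * beta + eps.
Proof.
  intros Heps. set (D := beta * exp euler_constant).
  assert (PD : 0 < D) by (apply Rmult_lt_0_compat; [exact beta_pos|apply exp_pos]).
  (* For [eta <= 1], [(2 + 5 * eta) * (1 + eta) <= 2 + 12 * eta]. *)
  set (eta := Rmin 1 (eps / (12 * D))).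
  assert (Pe : 0 < eta) by (apply Rmin_glb_lt; [lra|apply Rdiv_lt_0_compat; lra]).
  assert (e1 : eta <= 1) by apply Rmin_l. assert (e2 : eta <= eps / (12 * D)) by apply Rmin_r.
  destruct (L_eventually_bounded eta (conj Pe e1)) as (T & HT1 & HT).
  (* The second threshold is for [Re s > 2]: there the series is at most 2 in modulus, and
     [2 <= eps * ln (ln (Im s))]. *)
  exists (Rmax T (exp (exp (2 / eps)))). intros s Hs Ht.
  assert (t1 : T < Im s) by (eapply Rle_lt_trans; [apply Rmax_l|exact Ht]).
  assert (t2 : exp (exp (2 / eps)) < Im s) by (eapply Rle_lt_trans; [apply Rmax_r|exact Ht]).
  assert (Hx : 2 / eps < ln (ln (Im s))).
  { rewrite <- (ln_exp (2 / eps)). apply ln_increasing; [apply exp_pos|].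
    rewrite <- (ln_exp (exp (2 / eps))). apply ln_increasing; [apply exp_pos|exact t2]. }
  assert (P2 : 0 < 2 / eps) by (apply Rdiv_lt_0_compat; lra).
  set (x := ln (ln (Im s))) in *.
  replace (2 * exp euler_constant * beta) with (2 * D) by (unfold D; ring).
  apply Rmult_le_reg_r with x; [lra|]. unfold Rdiv. rewrite Rmult_assoc, Rinv_l, Rmult_1_r by lra.
  destruct (Rle_dec (Re s) 2) as [L2|L2].
  - destruct (HT s (conj Hs L2) t1) as [_ B]. fold x D in B. eapply Rle_trans; [exact B|].
    apply Rmult_le_compat_r; [lra|].
    assert (eta * (12 * D) <= eps).
    { apply Rmult_le_compat_r with (r := 12 * D) in e2; [|lra]. unfold Rdiv in e2. rewrite Rmult_assoc, Rinv_l, Rmult_1_r in e2; lra. }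
    assert ((2 + 5 * eta) * (1 + eta) <= 2 + 12 * eta) by nra. nra.
  - apply Rnot_le_lt in L2. rewrite L_series by lra.
    eapply Rle_trans; [apply dirichlet_norm_le; [intros; apply b_le_1|lra]|].
    assert (/ (Re s - 1) <= 1) by (rewrite <- Rinv_1; apply Rinv_le_contravar; lra).
    assert (2 <= eps * x).
    { apply Rmult_lt_compat_l with (r := eps) in Hx; [|exact Heps]. replace (eps * (2 / eps)) with 2 in Hx by (field; lra). lra. }
    nra.
Qed.

End MainBound.

Lemma limsup_Im_le (P : C -> Prop) (f : C -> R) (c : R) :
  (forall eps, 0 < eps -> exists T, forall s, P s -> T < Im s -> f s <= c + eps) -> Rbar_le (limsup_Im P f) c.
Proof.
  intros H. unfold limsup_Im.
  set (E := fun v : Rbar => exists T : R, v = Lub_Rbar (fun y : R => exists s : C, P s /\ T < Im s /\ y = f s)).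
  assert (G : forall eps, 0 < eps -> Rbar_le (Rbar_glb E) (c + eps)).
  { intros eps Heps. destruct (H eps Heps) as [T HT].
    destruct (Rbar_ex_glb E) as [l Hl]. rewrite (Rbar_is_glb_unique E l Hl).
    apply Rbar_le_trans with (Lub_Rbar (fun y : R => exists s : C, P s /\ T < Im s /\ y = f s)).
    - apply Hl. now exists T.
    - apply Lub_Rbar_correct. intros y (s & Ps & Hs & ->). now apply HT. }
  (* The value [p_infty] contradicts [G], and [m_infty] lies below every bound. *)
  destruct (Rbar_glb E) as [r| |]; simpl in *.
  - apply Rnot_lt_le. intros Hr. specialize (G ((r - c) / 2) ltac:(lra)). lra.
  - exact (G 1 Rlt_0_1).
  - exact I.
Qed.

Theorem theorem1 (q : nat) (chi : Z -> C) (zeta L : C -> C)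
    (hGRH : GRH)
    (hq : (2 < q)%nat)
    (hchi : primitive_character q chi)
    (hzeta : is_riemann_zeta zeta)
    (hL : is_dirichlet_L q chi L) :
  Rbar_le
    (limsup_Im (fun rho => critical_point zeta rho /\ (1 <= Re rho)%R)
               (fun rho => (Cmod (L rho) / ln (ln (Im rho)))%R))
    (Finite (2 * exp euler_constant * (INR (prime.totient q) / INR q))%R).
Proof.
  apply limsup_Im_le. intros eps Heps.
  destruct (L_limsup_bound q chi zeta L hGRH hq hchi hzeta hL eps Heps) as [T HT].
  exists T. intros s [_ Hs] Ht. now apply HT.
Qed.
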